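(* Let $U$ be an admissible control for the reduced Brownian network with state process $W$ and Brownian motion $\chi$, all defined on a filtered probability space $(\Lambda,\mathcal G,\{\mathcal G_t\},Q)$. Suppose that $Z$ is a $\{\mathcal G_t\}$-adapted $m$-dimensional process satisfying $Q$-a.s. $$MZ=W\quad\text{and}\quad Z(t)\in\mathcal Z\ \text{ for all } t\ge0.$$ Then there is a product extension $(\Omega,\mathcal F,\{\mathcal F_t\},P)$ of $(\Lambda,\mathcal G,\{\mathcal G_t\},Q)$ such that on this extended space there is an $m$-dimensional $\{\mathcal F_t\}$-Brownian motion $X$ with statistics $(\theta,\Sigma)$ and starting point $z^o$ that satisfies $MX=\chi$. On any such extension there is an admissible control $Y$ for the Brownian network that has extended state process $(Z,U)$ and Brownian motion $X$. Given $Z,U,X$, the process $Y$ is uniquely determined (up to indistinguishability) by $$Y(t)=\widehat Y(t)+\widetilde Y(t),\qquad t\ge0,$$ where, for each $t\ge0$, $\widehat Y(t)=K^\dagger U(t)$ and $\widetilde Y(t)=R^\dagger\big(Z(t)-X(t)-R\widehat Y(t)\big)$.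
   Context: Conventions. Vectors are column vectors, $'$ denotes transpose, $\mathbb R^0=\{0\}$, vector inequalities are componentwise. A $k$-dimensional process is a family $\{X(t):t\ge0\}$ of $\mathbb R^k$-valued measurable functions on a probability space whose sample paths are right continuous with finite left limits. Two processes are indistinguishable if a.s. they agree for all $t\ge0$. A filtered probability space is a probability space with an increasing family of sub-$\sigma$-algebras. An $\{\mathcal F_t\}$-Brownian motion with statistics $(\gamma,\Xi)$ and starting point $x\in\mathbb R^k$ is a $k$-dimensional $\{\mathcal F_t\}$-adapted Brownian motion with continuous paths, $X(0)=x$ a.s., drift $\gamma$, symmetric strictly positive definite covariance matrix $\Xi$, and increments after each $t$ independent of $\mathcal F_t$. A $0$-dimensional process or Brownian motion is identically $0$. A product extension of $(\Lambda,\mathcal G,\{\mathcal G_t\},Q)$ is a filtered probability space $(\Lambda\times\tilde\Lambda,\mathcal G\times\tilde{\mathcal G},\{\mathcal G_t\times\tilde{\mathcal G}_t\},Q\times\tilde Q)$ for some filtered probability space $(\tilde\Lambda,\tilde{\mathcal G},\{\tilde{\mathcal G}_t\},\tilde Q)$; processes on $\Lambda$ are implicitly extended trivially (not depending on the second coordinate). Brownian network. Data: positive integers $m,n,p$; $z^o,\theta\in\mathbb R^m$; a symmetric strictly positive definite $m\times m$ matrix $\Sigma$; an $m\times n$ matrix $R$; a $p\times n$ matrix $K$; a compact convex set $\mathcal Z\subset\mathbb R^m$ with nonempty interior. An admissible control for the Brownian network is an $n$-dimensional adapted process $Y$ on some filtered probability space $(\Omega,\mathcal F,\{\mathcal F_t\},P)$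 which supports an $m$-dimensional adapted process $Z$ and an $m$-dimensional $\{\mathcal F_t\}$-Brownian motion $X$ with statistics $(\theta,\Sigma)$ and starting point $z^o$ such that $P$-a.s.: (i) $Z(t)=X(t)+RY(t)\in\mathcal Z$ for all $t\ge0$; (ii) $U\equiv KY$ is nondecreasing with $U(0)\ge0$. $(Z,U)$ is the extended state process and $X$ the Brownian motion under $Y$ (processes are identified up to indistinguishability). Standing assumptions: for a fixed $v\in\mathbb R^n$, $\{Ry:Ky\ge0,\ y\in\mathbb R^n\}=\mathbb R^m$ and $\{y\in\mathbb R^n:Ky\ge0,\ Ry=0,\ v'y\le0\}=\{0\}$. Algebra. $\mathcal N=\{y\in\mathbb R^n:Ky=0\}$, $\mathcal R=\{Ry:y\in\mathcal N\}$, $\mathcal M=\mathcal R^\perp$ in $\mathbb R^m$, $d=\dim\mathcal M$. $M$ is a $d\times m$ matrix whose rows form a maximal linearly independent set in $\mathcal M$ (if $d=0$, $M$ is the map $\mathbb R^m\to\mathbb R^0$). $\mathcal W=\{Mz:z\in\mathcal Z\}$; $\mathcal K$ is the range of $K$. $K^\dagger:\mathbb R^p\to\mathbb R^n$ is a linear map with range in $\mathcal N^\perp$ whose restriction to $\mathcal K$ is the inverse of the bijection $K:\mathcal N^\perp\to\mathcal K$. $R^\dagger:\mathbb R^m\to\mathbb R^n$ is a linear map with range in $\mathcal N$ such that $RR^\dagger\delta=\delta$ for all $\delta\in\mathcal R$. $G:\mathbb R^p\to\mathbb R^d$ is a fixed linear map with $MR=GK$ (one exists). Reduced Brownian network. Let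 $w^o=Mz^o$, $\vartheta=M\theta$, $\Gamma=M\Sigma M'$. An admissible control for the reduced Brownian network is a $p$-dimensional adapted process $U$ on some filtered probability space $(\Lambda,\mathcal G,\{\mathcal G_t\},Q)$ which supports a $d$-dimensional adapted process $W$ and a $d$-dimensional $\{\mathcal G_t\}$-Brownian motion $\chi$ with statistics $(\vartheta,\Gamma)$ and starting point $w^o$ such that $Q$-a.s.: (i) $W(t)=\chi(t)+GU(t)\in\mathcal W$ for all $t\ge0$; (ii) $U$ is nondecreasing, $U(0)\ge0$, and $U(t)\in\mathcal K$ for all $t\ge0$. $W$ is called the state process with Brownian motion $\chi$ under $U$. *)

(* Defs.v *)
From HB Require Import structures.
From mathcomp Require Import all_boot all_order all_algebra.
From mathcomp Require Import all_classical all_reals all_analysis.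

Set Implicit Arguments.
Unset Strict Implicit.
Unset Printing Implicit Defensive.

Import Order.TTheory GRing.Theory Num.Theory.
Import numFieldNormedType.Exports.

Local Open Scope classical_set_scope.
Local Open Scope ring_scope.

(* Vectors of R^k are column vectors 'cV[R]_k, linear maps are matrices, and
   time is the set of t : R with 0 <= t: what families indexed by R do at
   negative times is irrelevant throughout. *)

Section Vectors.
Context {R : realType}.

Definition cv_le k (x y : 'cV[R]_k) : Prop := forall i, x i 0 <= y i 0.

Definition dot k (x y : 'cV[R]_k) : R := (x^T *m y) 0 0.

Definition orth k (S : set 'cV[R]_k) : set 'cV[R]_k :=
  [set x | forall y, S y -> dot x y = 0].

Definition sym_posdef k (C : 'M[R]_k) : Prop :=
  C^T = C /\ forall x : 'cV[R]_k, x != 0 -> 0 < dot x (C *m x).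

(* The Borel sets of R^k, as the product sigma-algebra generated by the
   coordinates. *)
Definition borel k : set (set 'cV[R]_k) :=
  g_sigma_preimage (fun (i : 'I_k) (x : 'cV[R]_k) => x i 0).

End Vectors.

Section Processes.
Context {R : realType}.

Definition process (T : Type) (k : nat) := R -> T -> 'cV[R]_k.

Definition is_filtration d (T : measurableType d) (F : R -> set (set T)) : Prop :=
  (forall t, 0 <= t -> sigma_algebra setT (F t) /\ F t `<=` measurable) /\
  (forall s t, 0 <= s -> s <= t -> F s `<=` F t).

Definition is_process d (T : measurableType d) k (X : process T k) : Prop :=
  (forall t, 0 <= t -> forall B, borel B -> measurable (X t @^-1` B)) /\
  (forall w, (forall t, 0 <= t -> X s w @[s --> t^'+] --> X t w) /\
             (forall t, 0 < t -> exists l : 'cV[R]_k, X s w @[s --> t^'-] --> l)).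

Definition is_adapted_process d (T : measurableType d) (F : R -> set (set T))
    k (X : process T k) : Prop :=
  is_process X /\
  forall t, 0 <= t -> forall B, borel B -> F t (X t @^-1` B).

Definition indistinguishable d (T : measurableType d) (P : probability T R)
    k (X Y : process T k) : Prop :=
  {ae P, forall w, forall t, 0 <= t -> X t w = Y t w}.

Definition proc_mul (T : Type) k l (A : 'M[R]_(l, k)) (X : process T k) :
  process T l := fun t w => A *m X t w.

(* Multivariate normal law with mean mu and positive definite covariance C:
   every nontrivial linear combination a'V of the coordinates is normal with
   mean a'mu and variance a'Ca. The second parameter of normal_prob is the
   standard deviation, and normal_prob _ 0 is not a Dirac mass, hence a != 0. *)
Definition normal_vector d (T : measurableType d) (P : probability T R)
    k (V : T -> 'cV[R]_k) (mu : 'cV[R]_k) (C : 'M[R]_k) : Prop :=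
  forall (a : 'cV[R]_k) (B : set R), a != 0 -> measurable B ->
    P ((fun w => dot a (V w)) @^-1` B) =
    normal_prob (dot a mu) (Num.sqrt (dot a (C *m a))) B.

Definition increments_after T k (X : process T k) (t : R) : set (set T) :=
  <<s [set A | exists u v B, [/\ t <= u, u <= v, borel B &
                A = (fun w => X v w - X u w) @^-1` B]] >>.

Record is_brownian_motion d (T : measurableType d) (P : probability T R)
    (F : R -> set (set T)) k (gamma : 'cV[R]_k) (Xi : 'M[R]_k) (x : 'cV[R]_k)
    (X : process T k) : Prop := IsBrownianMotion {
  bm_posdef : sym_posdef Xi ;
  bm_adapted : is_adapted_process F X ;
  bm_continuous :
    forall w, {within [set t : R | 0 <= t], continuous (fun t => X t w)} ;
  bm_start : {ae P, forall w, X 0 w = x} ;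
  bm_normal : forall s t, 0 <= s -> s < t ->
    normal_vector P (fun w => X t w - X s w) ((t - s) *: gamma) ((t - s) *: Xi) ;
  bm_indep : forall t, 0 <= t -> forall A B, F t A -> increments_after X t B ->
    P (A `&` B) = (P A * P B)%E }.

Definition prod_filtration (T T' : Type) (F : R -> set (set T))
    (F' : R -> set (set T')) : R -> set (set (T * T')) :=
  fun t => <<s [set A `*` B | A in F t & B in F' t] >>.

Definition lift_process (T T' : Type) k (X : process T k) :
  process (T * T')%type k := fun t w => X t w.1.

End Processes.

Section Network.
Context {R : realType}.

Record is_network_control (m n p : nat) (zo theta : 'cV[R]_m)
    (Sigma : 'M[R]_m) (Rm : 'M[R]_(m, n)) (Km : 'M[R]_(p, n))
    (Zset : set 'cV[R]_m)
    d (T : measurableType d) (P : probability T R) (F : R -> set (set T))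
    (Y : process T n) (Z X : process T m) : Prop := IsNetworkControl {
  nc_filtration : is_filtration F ;
  nc_Y : is_adapted_process F Y ;
  nc_Z : is_adapted_process F Z ;
  nc_X : is_brownian_motion P F theta Sigma zo X ;
  nc_state : {ae P, forall w, forall t, 0 <= t ->
    Z t w = X t w + Rm *m Y t w /\ Zset (Z t w)} ;
  nc_U : {ae P, forall w, cv_le 0 (Km *m Y 0 w) /\
    forall s t, 0 <= s -> s <= t -> cv_le (Km *m Y s w) (Km *m Y t w)} }.

(* Y is an admissible control with extended state process (Z, U) and Brownian
   motion X. *)
Definition is_network_control_for (m n p : nat) (zo theta : 'cV[R]_m)
    (Sigma : 'M[R]_m) (Rm : 'M[R]_(m, n)) (Km : 'M[R]_(p, n))
    (Zset : set 'cV[R]_m)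
    d (T : measurableType d) (P : probability T R) (F : R -> set (set T))
    (Z : process T m) (U : process T p) (X : process T m)
    (Y : process T n) : Prop :=
  is_network_control zo theta Sigma Rm Km Zset P F Y Z X /\
  indistinguishable P (proc_mul Km Y) U.

Definition standing_assumptions (m n p : nat) (Rm : 'M[R]_(m, n))
    (Km : 'M[R]_(p, n)) (v : 'cV[R]_n) : Prop :=
  [set Rm *m y | y in [set y | cv_le 0 (Km *m y)]] = [set: 'cV[R]_m] /\
  [set y | [/\ cv_le 0 (Km *m y), Rm *m y = 0 & dot v y <= 0]] = [set 0].

Definition calN (n p : nat) (Km : 'M[R]_(p, n)) : set 'cV[R]_n :=
  [set y | Km *m y = 0].

Definition calR (m n p : nat) (Rm : 'M[R]_(m, n)) (Km : 'M[R]_(p, n)) :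
  set 'cV[R]_m := mulmx Rm @` calN Km.

Definition calM (m n p : nat) (Rm : 'M[R]_(m, n)) (Km : 'M[R]_(p, n)) :
  set 'cV[R]_m := orth (calR Rm Km).

Definition calK (n p : nat) (Km : 'M[R]_(p, n)) : set 'cV[R]_p :=
  range (mulmx Km : 'cV[R]_n -> 'cV[R]_p).

Definition calW (m d : nat) (Mm : 'M[R]_(d, m)) (Zset : set 'cV[R]_m) :
  set 'cV[R]_d := mulmx Mm @` Zset.

(* The rows of Mm form a maximal linearly independent family in calM; in
   particular their number d is the dimension of calM. *)
Definition is_workload_matrix (m n p d : nat) (Rm : 'M[R]_(m, n))
    (Km : 'M[R]_(p, n)) (Mm : 'M[R]_(d, m)) : Prop :=
  [/\ row_free Mm,
      (forall i, calM Rm Km (row i Mm)^T) &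
      (forall z, calM Rm Km z -> ~~ row_free (col_mx Mm z^T))].

Definition is_Kdagger (n p : nat) (Km : 'M[R]_(p, n)) (Kdag : 'M[R]_(n, p)) :
    Prop :=
  [/\ (forall u, orth (calN Km) (Kdag *m u)),
      (forall u, calK Km u -> Km *m (Kdag *m u) = u) &
      (forall y, orth (calN Km) y -> Kdag *m (Km *m y) = y)].

Definition is_Rdagger (m n p : nat) (Rm : 'M[R]_(m, n)) (Km : 'M[R]_(p, n))
    (Rdag : 'M[R]_(n, m)) : Prop :=
  (forall z, calN Km (Rdag *m z)) /\
  (forall delta, calR Rm Km delta -> Rm *m (Rdag *m delta) = delta).

Record is_reduced_control (m n p d : nat) (zo theta : 'cV[R]_m)
    (Sigma : 'M[R]_m) (Km : 'M[R]_(p, n)) (Zset : set 'cV[R]_m)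
    (Mm : 'M[R]_(d, m)) (Gm : 'M[R]_(d, p))
    disp (T : measurableType disp) (Q : probability T R) (F : R -> set (set T))
    (U : process T p) (W chi : process T d) : Prop := IsReducedControl {
  rc_filtration : is_filtration F ;
  rc_U : is_adapted_process F U ;
  rc_W : is_adapted_process F W ;
  rc_chi : is_brownian_motion Q F (Mm *m theta) (Mm *m Sigma *m Mm^T)
             (Mm *m zo) chi ;
  rc_state : {ae Q, forall w, forall t, 0 <= t ->
    W t w = chi t w + Gm *m U t w /\ calW Mm Zset (W t w)} ;
  rc_control : {ae Q, forall w, cv_le 0 (U 0 w) /\
    (forall s t, 0 <= s -> s <= t -> cv_le (U s w) (U t w)) /\
    (forall t, 0 <= t -> calK Km (U t w))} }.

Definition Yhat (n p : nat) (Kdag : 'M[R]_(n, p)) T (U : process T p) :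
  process T n := fun t w => Kdag *m U t w.

Definition Ytilde (m n p : nat) (Rm : 'M[R]_(m, n)) (Kdag : 'M[R]_(n, p))
    (Rdag : 'M[R]_(n, m)) T (Z X : process T m) (U : process T p) :
  process T n :=
  fun t w => Rdag *m (Z t w - X t w - Rm *m Yhat Kdag U t w).

End Network.

(* Main.v *)
Require Import Defs.
From HB Require Import structures.
From mathcomp Require Import all_boot all_order all_algebra.
From mathcomp Require Import all_classical all_reals all_analysis.
From mathcomp Require Import measurable_realfun ring lra zify.

Set Implicit Arguments.
Unset Strict Implicit.
Unset Printing Implicit Defensive.

Import Order.TTheory GRing.Theory Num.Theory.
Import numFieldNormedType.Exports.

Local Open Scope classical_set_scope.
Local Open Scope ring_scope.

(* Since M has full row rank, G = M Sigma M' is invertible; put C = Sigma M' G^-1,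
   so that M C = 1. If beta is a Brownian motion with statistics (theta, Sigma)
   started at zo and independent of chi, then X = C chi + (1 - C M) beta satisfies
   M X = chi identically, and its covariance C G C' + (1 - C M) Sigma (1 - C M)'
   is Sigma. The independent beta lives on the second factor of the product
   extension. It is built from scalar Brownian motions by adding one coordinate at
   a time with the Schur complement, and the scalar one by Levy's midpoint
   construction, fed by the bits of a single uniform variable.

   For the control, delta = Z - X - R K^+ U satisfies M delta = 0, so delta is
   orthogonal to calM, i.e. delta lies in calR, where R^+ inverts R while staying in
   the kernel of K; hence Z = X + R Y and K Y = U. Two controls differ by y with
   K y = 0 and R y = 0, and the second standing assumption applied to y or - y gives
   y = 0. *)

(** Three clauses of the definition of Brownian motion shape the proof: the covariance is strictly
    positive, every path is continuous, and normality is tested through [normal_prob], which at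
    standard deviation 0 is not a point mass. The two summands of X have covariances C G C' and (1 -
    C M) Sigma (1 - C M)', which are in general singular, so neither need be a Brownian motion in
    this sense. Only their sum is shown to be one, by testing one linear functional at a time and
    treating constant functionals separately. The null set left by Borel-Cantelli is removed before
    any path is built. Independence of the increments from the past is reduced to product formulas
    on pi-systems: rectangles of increments at one dyadic level for the scalar motion, and sets A x
    B for the product extension. For X it holds because its increments are functions of those of chi
    and beta, each independent of its own past. Limits of normal laws are taken with Fatou's lemma
    on densities and open sets, which replaces characteristic functions. *)

Local Notation Nv m v := (normal_prob m (Num.sqrt v)).

(** * Independence and sums of normal variables *)

Section Independence.
Local Open Scope ereal_scope.
Context d (T : measurableType d) {R : realType} (P : probability T R).

Definition indep_families (C1 C2 : set (set T)) : Prop :=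
  forall A B, C1 A -> C2 B -> P (A `&` B) = P A * P B.

Lemma indep_familiesC C1 C2 : indep_families C1 C2 -> indep_families C2 C1.
Proof. by move=> i12 A B CA CB; rewrite setIC muleC i12. Qed.

(** For fixed [B] in [C2] the events independent of [B] form a Dynkin system, so the pi-system [C1]
    may be replaced by the sigma-algebra it generates. *)
Lemma indep_generated_l C1 C2 : C1 `<=` measurable -> C2 `<=` measurable ->
  setI_closed C1 -> indep_families C1 C2 -> indep_families <<s C1 >> C2.
Proof.
move=> mC1 mC2 iC1 i12 A B sA CB.
have mB : measurable B by exact: mC2.
suff : <<s C1 >> `<=` [set A | measurable A /\ P (A `&` B) = P A * P B].
  by move=> /(_ _ sA)[].
rewrite -setI_closed_g_dynkin_g_sigma_algebra//; apply: smallest_sub; last first.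
  by move=> E CE; split; [exact: mC1|exact: i12].
split.
- by split; [exact: measurableT|rewrite setTI probability_setT mul1e].
- move=> E [mE PE]; split; first exact: measurableC.
  rewrite probability_setC// setIC -setDE measureD//=; last first.
    by rewrite (le_lt_trans (probability_le1 _ _)) ?ltry.
  rewrite (setIC B) PE muleBl ?mul1e ?fin_num_adde_defl ?fin_numN ?fin_num_measure//.
- move=> F tF FE; have mF i : measurable (F i) by have [] := FE i.
  split; first exact: bigcupT_measurable.
  rewrite setI_bigcupl !measure_bigcup//; last 2 first.
  + by move=> i _; exact: measurableI.
  + by under eq_fun do rewrite setIC; exact: trivIset_setIl.
  have PBE : P B = (fine (P B))%:E by rewrite fineK ?fin_num_measure.
  rewrite muleC PBE -nneseriesZl//; apply: eq_eseriesr => i _.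
  by rewrite /= -PBE muleC; have [_ <-] := FE i.
Qed.

Lemma g_sigma_sub_measurable C : C `<=` measurable ->
  <<s C >> `<=` @measurable d T.
Proof. by apply: smallest_sub; exact: sigma_algebra_measurable. Qed.

Lemma indep_generated C1 C2 : C1 `<=` measurable -> C2 `<=` measurable ->
  setI_closed C1 -> setI_closed C2 -> indep_families C1 C2 ->
  indep_families <<s C1 >> <<s C2 >>.
Proof.
move=> mC1 mC2 iC1 iC2 i12; apply: indep_generated_l => //.
  exact: g_sigma_sub_measurable.
apply: indep_familiesC; apply: indep_generated_l => //.
exact: indep_familiesC.
Qed.

End Independence.

Section FiniteMeasureUnique.
Local Open Scope ereal_scope.
Context d (T : measurableType d) {R : realType}.

Lemma finite_measure_unique (G : set (set T)) (m1 m2 : {measure set T -> \bar R}) :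
  measurable = <<s G >> -> setI_closed G -> G setT -> m1 setT < +oo ->
  (forall A, G A -> m1 A = m2 A) -> forall A, measurable A -> m1 A = m2 A.
Proof.
move=> mG iG GT fm e A mA; apply: (measure_unique G (fun=> setT)) => //.
by apply/seteqP; split => // x _; exists 0%N.
Qed.

End FiniteMeasureUnique.

Section PairLaw.
Local Open Scope ereal_scope.
Context d (T : measurableType d) {R : realType} (P : probability T R).
Context d1 (T1 : measurableType d1) d2 (T2 : measurableType d2).
Variables (mu1 : probability T1 R) (mu2 : probability T2 R).

(** Testing with [A] and [B] equal to [setT] shows that [c] is [P F]: the pair has the product law
    independently of [F]. The event [F] will carry the constraints on all other variables. *)
Lemma pair_law (X : T -> T1) (Y : T -> T2) (F : set T) (c : R) :
  measurable_fun setT X -> measurable_fun setT Y -> measurable F -> (0 <= c)%R ->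
  (forall A B, measurable A -> measurable B ->
    P ((X @^-1` A `&` Y @^-1` B) `&` F) = mu1 A * mu2 B * c%:E) ->
  forall S, measurable S ->
    P ((fun w => (X w, Y w)) @^-1` S `&` F) = (mu1 \x mu2) S * c%:E.
Proof.
move=> mX mY mF c0 h S mS.
have mXY : measurable_fun setT (fun w => (X w, Y w)) by exact: measurable_fun_pair.
pose m1_ := [the {measure set _ -> \bar R} of
  pushforward (mrestr P mF) (fun w => (X w, Y w))].
pose m1 := m1_ mXY.
pose m2 := [the {measure set _ -> \bar R} of mscale (NngNum c0) (mu1 \x mu2)].
suff : m1 S = m2 S by rewrite /m1 /m1_ /m2 /= /pushforward /mrestr /mscale /= muleC.
apply: (@finite_measure_unique _ _ _ [set A `*` B | A in measurable & B in measurable]) => //.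
- exact: measurable_prod_measurableType.
- move=> _ _ [A mA [B mB <-]] [A' mA' [B' mB' <-]].
  exists (A `&` A'); first exact: measurableI.
  by exists (B `&` B'); [exact: measurableI|rewrite setXI].
- by exists setT => //; exists setT => //; rewrite setXTT.
- rewrite /m1 /m1_ /= /pushforward /mrestr preimage_setT setTI.
  by rewrite (le_lt_trans (probability_le1 _ _)) ?ltry.
- move=> _ [A mA [B mB <-]].
  rewrite /m1 /m1_ /m2 /= /pushforward /mrestr /mscale /= product_measure1E//.
  by rewrite [RHS]muleC -h.
Qed.

End PairLaw.

(** * Lebesgue integrals under translation and shear *)

Section Translation.
Local Open Scope ereal_scope.
Context {R : realType}.
Local Notation mu := (@lebesgue_measure R).

Lemma lebesgue_measureD (a : R) (A : set R) : measurable A ->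
  pushforward mu (fun x : measurableTypeR R => x + a : measurableTypeR R)%R A = mu A.
Proof.
have mD : measurable_fun setT (fun x : measurableTypeR R => x + a : measurableTypeR R)%R.
  exact: measurable_funD.
move=> mA; apply/esym/lebesgue_measure_unique => //= _ [[b c]] _ <-.
rewrite /pushforward.
rewrite (_ : _ @^-1` _ = `]b - a, c - a]%classic)%R; last first.
  by apply/seteqP; split => x /=; rewrite !in_itv/= ltrBlDr lerBrDr.
rewrite !lebesgue_measure_itv/= !lte_fin ltrD2r.
by case: ifPn => // _; rewrite -!EFinB; congr EFin; ring.
Qed.

Lemma ge0_integral_translation (f : R -> \bar R) (a : R) :
  measurable_fun setT f -> (forall x, 0 <= f x) ->
  \int[mu]_x f (x + a)%R = \int[mu]_x f x.
Proof.
move=> mf f0.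
have mD : measurable_fun setT (fun x : measurableTypeR R => x + a : measurableTypeR R)%R.
  exact: measurable_funD.
transitivity (\int[pushforward mu (fun x : measurableTypeR R => x + a : measurableTypeR R)%R]_x f
  x).
  by rewrite ge0_integral_pushforward.
by apply: eq_measure_integral => //= A mA _; exact: lebesgue_measureD.
Qed.

Lemma ge0_integral_shear (f : R * R -> \bar R) (c : R) :
  measurable_fun setT f -> (forall z, 0 <= f z) ->
  \int[mu]_x \int[mu]_y f (x, y) = \int[mu]_u \int[mu]_x f (x, u - c * x)%R.
Proof.
move=> mf f0.
have mg : measurable_fun setT (fun z : R * R => f (z.1, z.2 - c * z.1)%R).
  apply: (measurableT_comp mf); apply/measurable_fun_pair => //=.
  by apply: measurable_funB => //; apply: measurable_funM => //; exact: measurable_cst.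
rewrite -[RHS](fubini_tonelli (m1 := mu) (m2 := mu) (fun z : R * R => f (z.1, z.2 - c * z.1)%R))//=.
apply: eq_integral => x _.
rewrite -(@ge0_integral_translation (fun y => f (x, y)) (- (c * x))%R)//.
by apply: (measurableT_comp mf); exact: measurable_fun_pair.
Qed.

End Translation.

(** * Products of normal densities: sums and midpoints *)

Section NormalLaw.
Local Open Scope ereal_scope.
Context {R : realType}.
Local Notation mu := (@lebesgue_measure R).

(** [normal_prob] gives a density formula for sets only. For functions it is recovered from the
    Radon-Nikodym derivative, which agrees with the density almost everywhere; the bound by 1
    supplies integrability. *)
Lemma integral_normal_prob_bounded (m s : R) (h : R -> \bar R) :
  measurable_fun setT h -> (forall x, 0 <= h x <= 1) ->
  \int[normal_prob m s]_x h x = \int[mu]_x (h x * (normal_pdf m s x)%:E).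
Proof.
move=> mh h01; have dom := normal_prob_dominates m s.
have mpdf : measurable_fun [set: measurableTypeR R] (fun x => (normal_pdf m s x)%:E).
  by apply/measurable_EFinP; exact: measurable_normal_pdf.
rewrite -(Radon_Nikodym_change_of_variables dom)//=; last first.
  apply/integrableP; split => //.
  apply: (@le_lt_trans _ _ (\int[normal_prob m s]_x (cst 1 x))).
    apply: ge0_le_integral => //.
    - exact: measurableT_comp.
    - by move=> x _; have /andP[h0 h1] := h01 x; rewrite gee0_abs.
  by rewrite integral_cst// mul1e -[ltLHS]/(normal_prob m s setT) probability_setT ltry.
apply: ae_eq_integral => //.
- exact: emeasurable_funM.
- exact: emeasurable_funM.
- apply: ae_eqe_mul2l.
  rewrite Radon_NikodymE//=.
  case: cid => /= g [g1 g2 g3].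
  apply: integral_ae_eq => //=.
  + by move=> E _ mE; rewrite -g3.
Qed.

Lemma product_normal_probE (m1 s1 m2 s2 : R) (S : set (R * R)) : measurable S ->
  (normal_prob m1 s1 \x normal_prob m2 s2) S =
  \int[mu]_x \int[mu]_y
    (\1_S (x, y) * normal_pdf m1 s1 x * normal_pdf m2 s2 y)%:E.
Proof.
move=> mS; rewrite /product_measure1 integral_normal_prob_bounded; last 2 first.
- exact: measurable_fun_xsection.
- move=> x /=; rewrite measure_ge0/= probability_le1//; exact: measurable_xsection.
apply: eq_integral => x _ /=.
transitivity ((normal_pdf m1 s1 x)%:E *
    \int[mu]_y ((fun y => (normal_pdf m2 s2 y)%:E) \_ (xsection S x)) y).
  by rewrite muleC; congr (_ * _); rewrite /normal_prob integral_mkcond.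
rewrite -ge0_integralZl//; last 3 first.
- have mxS : measurable (xsection S x) by exact: measurable_xsection.
  have mp : measurable_fun (xsection S x) (fun y => (normal_pdf m2 s2 y)%:E).
    by apply/measurable_funTS/measurable_EFinP; exact: measurable_normal_pdf.
  exact: (measurable_restrictT _ mxS).1 mp.
- by move=> y _; rewrite patchE; case: ifPn; rewrite ?lee_fin ?normal_pdf_ge0.
- by rewrite lee_fin normal_pdf_ge0.
apply: eq_integral => y _; rewrite patchE mem_xsection indicE.
by case: ifPn => _; rewrite ?mule0 /= ?mul1r ?mul0r// -EFinM.
Qed.

Lemma normal_pdf_sqrtE (m v x : R) : (0 < v)%R -> normal_pdf m (Num.sqrt v) x =
  ((Num.sqrt (v * pi *+ 2))^-1 * expR (- (x - m) ^+ 2 / (v *+ 2)))%R.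
Proof.
move=> v0; rewrite normal_pdfE ?gt_eqF ?sqrtr_gt0//.
by rewrite /normal_peak /normal_fun sqr_sqrtr// ltW.
Qed.

(** Completing the square: the joint density of the first component and the sum is the density of
    the sum times the conditional density of the first component given the sum. *)
Lemma normal_pdf_conv (m1 m2 v1 v2 u x : R) : (0 < v1)%R -> (0 < v2)%R ->
  (normal_pdf m1 (Num.sqrt v1) x * normal_pdf m2 (Num.sqrt v2) (u - x) =
   normal_pdf (m1 + m2) (Num.sqrt (v1 + v2)) u *
   normal_pdf (m1 + (u - (m1 + m2)) * v1 / (v1 + v2))
     (Num.sqrt (v1 * v2 / (v1 + v2))) x)%R.
Proof.
move=> v10 v20; have v120 : (0 < v1 + v2)%R by exact: addr_gt0.
rewrite !normal_pdf_sqrtE ?divr_gt0 ?mulr_gt0//.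
rewrite mulrACA -expRD [RHS]mulrACA -expRD -!invfM -!sqrtrM; last 2 first.
- by rewrite mulrn_wge0// mulr_ge0 ?pi_ge0// ltW.
- by rewrite mulrn_wge0// mulr_ge0 ?pi_ge0// ltW.
congr ((Num.sqrt _)^-1 * expR _)%R; field; lra.
Qed.

(** The map from (a, b) to (a + b, (a - b) / 2) has Jacobian of absolute value 1, and (a + b)^2 + (a
    - b)^2 = 2 a^2 + 2 b^2 matches the exponents. This is the midpoint refinement at the level of
    densities. *)
Lemma normal_pdf_half_rotation (v a b : R) : (0 < v)%R ->
  (normal_pdf 0 (Num.sqrt v) (a + b) * normal_pdf 0 (Num.sqrt (v / 4)) ((a - b) / 2) =
   normal_pdf 0 (Num.sqrt (v / 2)) a * normal_pdf 0 (Num.sqrt (v / 2)) b)%R.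
Proof.
move=> v0; rewrite !normal_pdf_sqrtE ?divr_gt0//.
rewrite mulrACA -expRD [RHS]mulrACA -expRD -!invfM -!sqrtrM; last 2 first.
- by rewrite mulrn_wge0// mulr_ge0 ?pi_ge0// divr_ge0// ltW.
- by rewrite mulrn_wge0// mulr_ge0 ?pi_ge0// ltW.
congr ((Num.sqrt _)^-1 * expR _)%R; field; lra.
Qed.

Lemma normal_probE (m s : R) (A : set R) :
  normal_prob m s A = \int[mu]_x (\1_A x * normal_pdf m s x)%:E.
Proof.
rewrite /normal_prob integral_mkcond; apply: eq_integral => x _.
by rewrite patchE indicE; case: ifPn => _; rewrite ?mul1r ?mul0r.
Qed.

Lemma measurable_normal_pdf_prod (S : set (R * R)) (m1 s1 m2 s2 : R) :
  measurable S -> measurable_fun setT (fun z : R * R =>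
    (\1_S z * normal_pdf m1 s1 z.1 * normal_pdf m2 s2 z.2)%:E).
Proof.
move=> mS; apply/measurable_EFinP; apply: measurable_funM.
  apply: measurable_funM; first exact: measurable_indic.
  by apply: measurableT_comp; first exact: measurable_normal_pdf.
by apply: measurableT_comp; first exact: measurable_normal_pdf.
Qed.

(** After the shear u = x + y the indicator depends on u alone, and the conditional density of x
    given u integrates to 1. *)
Lemma normal_prob_conv (m1 m2 v1 v2 : R) (A : set R) : (0 < v1)%R -> (0 < v2)%R ->
  measurable A ->
  (Nv m1 v1 \x Nv m2 v2) [set z | A (z.1 + z.2)%R] = Nv (m1 + m2)%R (v1 + v2)%R A.
Proof.
move=> v10 v20 mA; set S := (X in product_measure1 _ _ X).
have mS : measurable S.
  rewrite -[S]setTI.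
  by apply: (@measurable_funD _ _ R setT fst snd).
rewrite product_normal_probE//.
rewrite (ge0_integral_shear 1 (measurable_normal_pdf_prod _ _ _ _ mS)); last first.
  by move=> z; rewrite lee_fin !mulr_ge0 ?normal_pdf_ge0.
rewrite normal_probE; apply: eq_integral => u _.
under eq_integral => x _.
  rewrite /= mul1r -mulrA normal_pdf_conv// mulrA.
  rewrite (_ : \1_S _ = \1_A u); last by rewrite !indicE; congr (nat_of_bool _)%:R; apply/idP/idP;
    rewrite /S !in_setE /= addrC subrK.
  rewrite EFinM.
  over.
rewrite ge0_integralZl//.
- by rewrite integral_normal_pdf mule1.
- by apply/measurable_EFinP; exact: measurable_normal_pdf.
- by move=> x _; rewrite lee_fin normal_pdf_ge0.
- by rewrite lee_fin mulr_ge0 ?normal_pdf_ge0.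
Qed.

Lemma normal_prob_half_rotation (v : R) (A B : set R) : (0 < v)%R ->
  measurable A -> measurable B ->
  (Nv 0%R v \x Nv 0%R (v / 4)%R) [set z | A (z.1 / 2 + z.2)%R /\ B (z.1 / 2 - z.2)%R] =
  Nv 0%R (v / 2)%R A * Nv 0%R (v / 2)%R B.
Proof.
move=> v0 mA mB; set S := (X in product_measure1 _ _ X).
have mhalf : measurable_fun setT (fun z : R * R => z.1 / 2)%R.
  by apply: measurable_funM => //; exact: measurable_cst.
have mS : measurable S.
  apply: measurableI; rewrite -[X in measurable X]setTI.
    exact: (measurable_funD mhalf measurable_snd).
  exact: (measurable_funB mhalf measurable_snd).
rewrite product_normal_probE//.
(* With x the total and y the midpoint deviation, the new variable u = y + x / 2 is the first
   half. *)
rewrite (ge0_integral_shear 2^-1 (measurable_normal_pdf_prod _ _ _ _ mS)); last first.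
  by move=> z; rewrite lee_fin !mulr_ge0 ?normal_pdf_ge0.
rewrite !normal_probE.
rewrite -ge0_integralZr//; last 3 first.
- by apply/measurable_EFinP/measurable_funM; [exact: measurable_indic|exact: measurable_normal_pdf].
- by move=> x _; rewrite lee_fin mulr_ge0 ?normal_pdf_ge0.
- by apply: integral_ge0 => x _; rewrite lee_fin mulr_ge0 ?normal_pdf_ge0.
apply: eq_integral => u _.
rewrite -ge0_integralZl//; last 3 first.
- by apply/measurable_EFinP/measurable_funM; [exact: measurable_indic|exact: measurable_normal_pdf].
- by move=> x _; rewrite lee_fin mulr_ge0 ?normal_pdf_ge0.
- by rewrite lee_fin mulr_ge0 ?normal_pdf_ge0.
(* The total is replaced by x + u, so that x becomes the second half. *)
rewrite -(ge0_integral_translation u); last 2 first.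
- have mz : measurable_fun setT (fun x : R => (x, u - 2^-1 * x)%R).
    apply: measurable_fun_pair => //; apply: measurable_funB; first exact: measurable_cst.
    by apply: measurable_funM => //; exact: measurable_cst.
  exact: measurableT_comp (measurable_normal_pdf_prod _ _ _ _ mS) mz.
- by move=> z; rewrite lee_fin !mulr_ge0 ?normal_pdf_ge0.
apply: eq_integral => x _; rewrite -EFinM; congr EFin => /=.
rewrite [RHS]mulrACA -(normal_pdf_half_rotation u x v0) mulrA.
have E0 : (u - 2^-1 * (x + u) = (u - x) / 2)%R by field.
have E1 : ((x + u) / 2 + (u - x) / 2 = u)%R by field.
have E2 : ((x + u) / 2 - (u - x) / 2 = x)%R by field.
rewrite E0 (addrC u x); congr (_ * _ * _)%R.
rewrite !indicE -natrM mulnb; congr (nat_of_bool _)%:R.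
have SE : S (x + u, (u - x) / 2)%R = (A u /\ B x) by rewrite /S /= E1 E2.
by apply/idP/andP; rewrite !in_setE SE.
Qed.

End NormalLaw.

(** * Comparing laws on the line, and limits of normal laws *)

Section RealLaws.
Local Open Scope ereal_scope.
Context {R : realType}.

Lemma lee_onem_inv (x y : \bar R) : x \is a fin_num -> y \is a fin_num ->
  1 - y <= 1 - x -> x <= y.
Proof.
by case: x y => [x| |] [y| |]// _ _; rewrite -!EFinB !lee_fin lerD2l lerN2.
Qed.

Lemma eq_law_rays (m1 m2 : {measure set (measurableTypeR R) -> \bar R}) :
  m1 setT < +oo -> (forall x, m1 `]x, +oo[%classic = m2 `]x, +oo[%classic) ->
  forall A, measurable A -> m1 A = m2 A.
Proof.
move=> fm h A mA.
apply: (@measure_unique _ R (measurableTypeR R) (@RGenOInfty.G R) (fun n => `](- n%:R)%R,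
  +oo[%classic)) => //.
- exact: RGenOInfty.measurableE.
- move=> _ _ [x ->] [y ->]; exists (Num.max x y).
  by apply/seteqP; split => z /=; rewrite !in_itv/= !andbT gt_max => /andP.
- by move=> i; exists (- i%:R)%R.
- apply/seteqP; split => // x _; exists (Num.truncn (- x)).+1 => //=.
  by rewrite in_itv/= andbT ltrNl truncnS_gt.
- by move=> _ [x ->]; exact: h.
- by move=> k; apply: le_lt_trans fm; apply: le_measure; rewrite ?inE.
Qed.

(** A one-sided bound on open sets is what a pointwise limit of variables provides. For the reverse
    inequality on []x, +oo[], the complementary closed ray is a decreasing limit of open rays, to
    which the same bound applies. *)
Lemma eq_law_open (m1 m2 : probability (measurableTypeR R) R) :
  (forall U : set R, open U -> m1 U <= m2 U) ->
  forall A, measurable A -> m1 A = m2 A.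
Proof.
move=> h; apply: eq_law_rays => [|x].
  by rewrite (le_lt_trans (probability_le1 _ _)) ?ltry.
apply/eqP; rewrite eq_le h//=.
have -> : `]x, +oo[%classic = ~` `]-oo, x]%classic :> set R.
  by rewrite setCitvl.
rewrite !probability_setC// leeB//.
have -> : `]-oo, x]%classic = \bigcap_n `]-oo, (x + n.+1%:R^-1)%R]%classic :> set R.
  exact: itvNycEbigcap.
have cv : m2 `]-oo, (x + n.+1%:R^-1)%R]%classic @[n --> \oo] -->
    m2 (\bigcap_n `]-oo, (x + n.+1%:R^-1)%R]%classic).
  apply: nonincreasing_cvg_mu => //.
  - by rewrite (le_lt_trans (probability_le1 _ _)) ?ltry.
  - by apply: bigcap_measurable => //; exists 0%N.
  - move=> k n kn; apply/subsetPset; apply: subset_itvl.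
    by rewrite bnd_simp lerD2l lef_pV2 ?posrE// ler_nat.
rewrite -(cvg_lim _ cv)//; apply: lime_ge; first by apply/cvg_ex; eexists; exact: cv.
apply: nearW => n; apply: (@le_trans _ _ (m1 `]-oo, (x + n.+1%:R^-1)%R[%classic)).
  apply: le_measure; rewrite ?inE//.
    by apply: bigcap_measurable => //; exists 0%N.
  rewrite -itvNycEbigcap => y /=; rewrite !in_itv/= => /le_lt_trans; apply.
  by rewrite ltrDl invr_gt0.
apply: (@le_trans _ _ (m2 `]-oo, (x + n.+1%:R^-1)%R[%classic)); first exact/h/interval_open.
by apply: le_measure; rewrite ?inE//; apply: subset_itvl; rewrite bnd_simp.
Qed.

End RealLaws.

Section NormalLimit.
Local Open Scope ereal_scope.
Context {R : realType}.
Local Notation mu := (@lebesgue_measure R).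

Lemma normal_prob_fatou (m v : R) (v_ : nat -> R) (B : set R) : measurable B ->
  (0 < v)%R -> (forall k, 0 < v_ k)%R -> v_ @ \oo --> v ->
  Nv m v B <= limn_einf (fun k => Nv m (v_ k) B).
Proof.
move=> mB v0 v0_ cv; rewrite /normal_prob.
apply: (@le_trans _ _ (\int[mu]_(x in B)
    limn_einf (fun k => (normal_pdf m (Num.sqrt (v_ k)) x)%:E))); last first.
  apply: fatou => //.
  - move=> n; apply/measurable_funTS/measurable_EFinP; exact: measurable_normal_pdf.
  - by move=> n x _; rewrite lee_fin normal_pdf_ge0.
rewrite le_eqVlt; apply/orP; left; apply/eqP; apply: eq_integral => x _.
have cx : (normal_pdf m (Num.sqrt (v_ k)) x)%:E @[k --> \oo] -->
    (normal_pdf m (Num.sqrt v) x)%:E.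
  apply: cvg_EFin; first exact: nearW.
  rewrite /comp /= normal_pdf_sqrtE//.
  under eq_cvg do rewrite normal_pdf_sqrtE//.
  apply: cvgM.
    apply: cvgV; first by rewrite gt_eqF// sqrtr_gt0 mulrn_wgt0// mulr_gt0// pi_gt0.
    apply: (cvg_comp _ Num.sqrt); last exact: sqrt_continuous.
    by apply: cvgMn; apply: cvgMl.
  apply: (cvg_comp _ expR); last exact: continuous_expR.
  apply: cvgMr; apply: cvgV; first by rewrite gt_eqF// mulrn_wgt0.
  exact: cvgMn.
rewrite is_cvg_limn_einfE; last by apply/cvg_ex; eexists; exact: cx.
by apply/esym/cvg_lim.
Qed.

Lemma limn_einf_le (u : nat -> \bar R) (c : \bar R) (n : nat) :
  (forall j, (n <= j)%N -> u j <= c) -> limn_einf u <= c.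
Proof.
move=> h; rewrite limn_einf_lim; apply: lime_le; first exact: is_cvg_einfs.
near=> j; apply: (@le_trans _ _ (u j)); last by apply: h; near: j; exists n.
by apply: ereal_inf_lbound; exists j => /=.
Unshelve. all: by end_near. Qed.

Context d (T : measurableType d) (P : probability T R).

(** For [U] open, pointwise convergence puts the event [Y] in [U] inside the increasing union of the
    events [F n] that [X k] is in [U] for all k >= n. Fatou's lemma only bounds limits from below,
    so it is applied to the complement of [U] to bound [P (F n)] from above. *)
Lemma normal_limit (X : nat -> T -> R) (Y : T -> R) (m v : R) (v_ : nat -> R) :
  (forall k, measurable_fun setT (X k)) -> measurable_fun setT Y ->
  (forall w, X ^~ w @ \oo --> Y w) ->
  (forall k, 0 < v_ k)%R -> (0 < v)%R -> v_ @ \oo --> v ->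
  (forall k A, measurable A -> P (X k @^-1` A) = Nv m (v_ k) A) ->
  forall A, measurable A -> P (Y @^-1` A) = Nv m v A.
Proof.
move=> mX mY cX v0_ v0 cv lX A mA.
have mXk k B : measurable B -> measurable (X k @^-1` B).
  by move=> mB; rewrite -[_ @^-1` _]setTI; exact: mX.
have mY' : measurable_fun setT (Y : T -> measurableTypeR R) by [].
pose Y' : {RV P >-> measurableTypeR R} := HB.pack Y (isMeasurableFun.Build _ _ _ _ _ mY').
suff : distribution P Y' A = Nv m v A by [].
apply: (@eq_law_open R (distribution P Y') (Nv m v)) => // U oU.
have mU := open_measurable oU.
rewrite -[leLHS]/(P (Y @^-1` U)).
pose F n := \bigcap_(k >= n) (X k @^-1` U).
have mF n : measurable (F n).
  by apply: bigcap_measurable; [exists n => //=|move=> k _; exact: mXk].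
have PF n : P (F n) <= Nv m v U.
  have : Nv m v (~` U) <= 1 - P (F n).
    apply: le_trans (normal_prob_fatou _ (measurableC mU) v0 v0_ cv) _.
    apply: (@limn_einf_le _ _ n) => j nj.
    apply: (@le_trans _ _ (1 - P (X j @^-1` U))).
      by rewrite lX// probability_setC.
    apply: leeB => //.
    by apply: le_measure; rewrite ?inE//; [exact: mXk|move=> w; apply].
  rewrite probability_setC//.
  by apply: lee_onem_inv; rewrite fin_num_measure.
apply: (@le_trans _ _ (P (\bigcup_n F n))).
  apply: (le_measure P); rewrite ?inE//.
  - by rewrite -[_ @^-1` _]setTI; exact: mY.
  - exact: bigcupT_measurable.
  - move=> w /= UY; have := cX w; move/(_ U (open_nbhs_nbhs (conj oU UY))).
    by case=> n _ nU; exists n => // k nk; exact: nU.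
have cF : P (F n) @[n --> \oo] --> P (\bigcup_n F n).
  apply: nondecreasing_cvg_mu => //; first exact: bigcupT_measurable.
  by move=> k n kn; apply/subsetPset => w Fw j nj; apply: Fw; exact: leq_trans kn nj.
rewrite -(cvg_lim _ cF)//; apply: lime_le; first by apply/cvg_ex; eexists; exact: cF.
exact: nearW.
Qed.

End NormalLimit.

(** * Tails of the normal law *)

Section NormalTail.
Local Open Scope ereal_scope.
Context {R : realType}.
Local Notation mu := (@lebesgue_measure R).

Lemma normal_pdf_shift_le (v a x : R) : (0 < v)%R -> (0 <= a * x)%R ->
  (normal_pdf 0 (Num.sqrt v) (x + a) <=
   expR (- a ^+ 2 / (v *+ 2)) * normal_pdf 0 (Num.sqrt v) x)%R.
Proof.
move=> v0 ax; rewrite !normal_pdf_sqrtE// mulrCA ler_pM2l; last first.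
  by rewrite invr_gt0 sqrtr_gt0 mulrn_wgt0// mulr_gt0// pi_gt0.
rewrite -expRD ler_expR -mulrDl ler_pM2r ?invr_gt0 ?mulrn_wgt0//; nra.
Qed.

(** For a x >= 0 one has (x + a)^2 >= x^2 + a^2, so translating the tail [A] by [a] gains the
    exponential factor. [A] and [B] stay abstract to cover both signs of [a]. *)
Lemma normal_tail_le (v a : R) (A B : set R) : (0 < v)%R -> measurable A -> measurable B ->
  (forall x, A (x + a)%R -> B x) -> (forall x, B x -> 0 <= a * x)%R ->
  Nv 0%R v A <= (expR (- a ^+ 2 / (v *+ 2)))%:E.
Proof.
move=> v0 mA mB AB Ba; rewrite normal_probE.
have mpA (C : set R) : measurable C ->
    measurable_fun setT (fun x => (\1_C x * normal_pdf 0 (Num.sqrt v) x)%:E).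
  by move=> mC; apply/measurable_EFinP/measurable_funM;
    [exact: measurable_indic|exact: measurable_normal_pdf].
rewrite -(ge0_integral_translation a); last 2 first.
- exact: mpA.
- by move=> x; rewrite lee_fin mulr_ge0// normal_pdf_ge0.
apply: (@le_trans _ _ (\int[mu]_x ((expR (- a ^+ 2 / (v *+ 2)))%:E *
    (normal_pdf 0 (Num.sqrt v) x)%:E))).
  apply: ge0_le_integral => //.
  - by move=> x _; rewrite lee_fin mulr_ge0// normal_pdf_ge0.
  - apply: (measurableT_comp (mpA _ mA)).
    by apply: measurable_funD => //; exact: measurable_cst.
  - apply/measurable_EFinP/measurable_funM => //; exact: measurable_normal_pdf.
  - move=> x _; rewrite -EFinM lee_fin indicE.
    case: (boolP (x + a \in A)%R) => [|_]; last first.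
      by rewrite mul0r mulr_ge0 ?expR_ge0// normal_pdf_ge0.
    rewrite in_setE => Axa; rewrite mul1r; apply: normal_pdf_shift_le => //.
    exact/Ba/AB.
rewrite ge0_integralZl//.
- by rewrite integral_normal_pdf mule1.
- by apply/measurable_EFinP; exact: measurable_normal_pdf.
- by move=> x _; rewrite lee_fin normal_pdf_ge0.
Qed.

Lemma normal_tail (v a : R) : (0 < v)%R -> (0 <= a)%R ->
  Nv 0%R v [set x | a < `|x|]%R <= (expR (- a ^+ 2 / (v *+ 2)) *+ 2)%:E.
Proof.
move=> v0 a0.
have -> : [set x | a < `|x|]%R = `]a, +oo[%classic `|` `]-oo, (- a)%R[%classic.
  by apply/seteqP; split => x /=; rewrite !in_itv/= andbT lter_normr ltrNr => /orP.
rewrite mulr2n EFinD; apply: le_trans (measureU2 _ _ _) _ => //; apply: leeD.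
  apply: (@normal_tail_le _ _ _ `[0%R, +oo[%classic) => // x /=; rewrite !in_itv/= !andbT.
    by rewrite ltrDr => /ltW.
  by move=> x0; exact: mulr_ge0.
rewrite -sqrrN; apply: (@normal_tail_le _ _ _ `]-oo, 0%R]%classic) => // x /=; rewrite !in_itv/=.
  by rewrite gtrDr => /ltW.
by move=> x0; rewrite mulr_le0// oppr_le0.
Qed.

End NormalTail.

(** * Independent variables from the bits of a uniform one *)

Section UniformSpace.
Local Open Scope ereal_scope.
Context {R : realType}.
Local Notation mu := (@lebesgue_measure R).
Local Notation P := (uniform_prob (@ltr01 R)).

(** The endpoint 1 is dropped because the cells [i / n, (i + 1) / n[ tile the half-open interval
    exactly. *)
Lemma uniform01E (A : set R) : measurable A -> P A = mu (A `&` `[0%R, 1%R[).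
Proof.
move=> mA; rewrite /uniform_prob integral_uniform_pdf.
rewrite (eq_integral (fun=> 1)); last first.
  by move=> x; rewrite inE => -[_ /=]; rewrite in_itv/= /uniform_pdf => ->; rewrite subr0 invr1.
rewrite integral_cst ?mul1e; last exact: measurableI.
have -> : A `&` `[0%R, 1%R] = (A `&` `[0%R, 1%R[) `|` (A `&` [set 1%R]).
  apply/seteqP; split => x /=; rewrite !in_itv/=.
    move=> [Ax /andP[x0]]; rewrite le_eqVlt => /orP[/eqP x1|x1]; first by right.
    by left; rewrite x0.
  by case=> -[Ax]; [move=> /andP[x0 /ltW x1]; rewrite x0 x1|move=> x1;
    rewrite x1 ler01 lexx in Ax *].
rewrite measureU//.
- rewrite [X in _ + X](_ : _ = 0) ?adde0//.
  apply/eqP; rewrite eq_le measure_ge0 andbT -(lebesgue_measure_set1 1%R).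
  by apply: le_measure; rewrite ?inE//; exact: measurableI.
- exact: measurableI.
- exact: measurableI.
- rewrite setIACA setIid (_ : `[0%R, 1%R[ `&` _ = set0) ?setI0//.
  by apply/seteqP; split => // x []; rewrite /= in_itv/= => /andP[_ x1] x1E; rewrite x1E ltxx in x1.
Qed.

Lemma measurable_truncn : measurable_fun setT (Num.truncn : R -> nat).
Proof.
move=> _ B _; rewrite setTI.
have -> : Num.truncn @^-1` B = \bigcup_(n in B) (Num.truncn @^-1` [set n]) :> set R.
  by apply/seteqP; split => [x Bx|x [n Bn /= ->]//]; exists (Num.truncn x).
apply: bigcup_measurable => n _.
have mge k : measurable [set x : R | (k <= Num.truncn x)%N].
  case: k => [|k]; first by rewrite (_ : [set _ | _] = setT)//; apply/seteqP; split.
  rewrite (_ : [set _ | _] = `[k.+1%:R, +oo[%classic)//.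
  by apply/seteqP; split => x /=; rewrite in_itv/= andbT truncn_gt_nat.
rewrite (_ : _ @^-1` _ = [set x : R | (n <= Num.truncn x)%N] `\` [set x : R | (n.+1 <= Num.truncn
  x)%N]).
  exact: measurableD.
apply/seteqP; split => x /=; first by move=> ->; rewrite ltnn leqnn.
by case=> nx /negP; rewrite -leqNgt => xn; apply/eqP; rewrite eqn_leq nx xn.
Qed.

Lemma uniform_truncn (n : nat) (E : set nat) : (0 < n)%N ->
  P [set x | E (Num.truncn (n%:R * x))] = (n%:R^-1 * \sum_(i < n) \1_E (i : nat))%:E.
Proof.
move=> n0; have n0' : (0 < n%:R :> R)%R by rewrite ltr0n.
have mnx : measurable_fun setT (fun x : R => Num.truncn (n%:R * x)).
  by apply: (measurableT_comp measurable_truncn); exact: measurable_funM.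
have mE (B : set nat) : measurable [set x : R | B (Num.truncn (n%:R * x))].
  by rewrite -[X in measurable X]setTI; exact: (mnx measurableT B).
rewrite uniform01E//.
pose F (i : nat) := [set x : R | (0 <= x < 1)%R /\ Num.truncn (n%:R * x) = i /\ E i].
have mF i : measurable (F i).
  rewrite (_ : F i = `[0%R, 1%R[%classic `&` [set x : R | [set i] (Num.truncn (n%:R * x))]
     `&` [set x | E i]); last first.
    by apply/seteqP; split => x /=; rewrite in_itv /= ; [move=> [? [? ?]]|move=> [[? ?] ?]].
  apply: measurableI; first exact: measurableI.
  have [Ei|nEi] := pselect (E i).
    by rewrite (_ : [set _ | _] = setT)//; apply/seteqP; split.
  by rewrite (_ : [set _ | _] = set0)//; apply/seteqP; split.
have -> : [set x | E (Num.truncn (n%:R * x))] `&` `[0%R, 1%R[ = \big[setU/set0]_(i < n) F i.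
  rewrite -bigcup_mkord; apply/seteqP; split => [x [Ex]/=|x [i /= ni [x01 [<- Ei]]]].
    rewrite in_itv/= => x01; exists (Num.truncn (n%:R * x)) => //=.
    rewrite truncn_lt_nat ?mulr_ge0//; last by case/andP: x01.
    by rewrite gtr_pMr//; case/andP: x01.
  by split => //=; rewrite in_itv.
rewrite measure_bigsetU//; last first.
  move=> i j _ _ [x [[_ [xi _]] [_ [xj _]]]].
  by rewrite -xi -xj.
rewrite mulr_sumr -sumEFin; apply: eq_bigr => i _.
have [Ei|nEi] := pselect (E i); last first.
  rewrite indicE memNset// mulr0 (_ : F i = set0) ?measure0//.
  by apply/seteqP; split => // x [_ []].
rewrite indicE mem_set// mulr1.
have -> : F i = `[(i%:R / n%:R)%R, (i.+1%:R / n%:R)%R[%classic.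
  apply/seteqP; split => x /=; rewrite in_itv/= ler_pdivrMr// ltr_pdivlMr// !(mulrC x).
    move=> [/andP[x0 x1] [xi _]]; have := truncn_itv (mulr_ge0 (ltW n0') x0).
    by rewrite xi.
  move=> /andP[ix xi]; split; last split => //; last first.
    by apply/truncn_def; rewrite ix.
  rewrite -(pmulr_rge0 _ n0') (le_trans _ ix)//= -(ltr_pM2l n0') mulr1 (lt_le_trans xi)//.
  by rewrite ler_nat.
rewrite [LHS]lebesgue_measure_itv/= lte_fin ltr_pM2r ?invr_gt0// ltr_nat leqnn -EFinB -mulrBl.
by rewrite -natrB// subSnn mul1r.
Qed.

End UniformSpace.

(* The base-4 digits of N are the pairs (even bit, odd bit) of its binary expansion. *)
Fixpoint deinterleave (k N : nat) : nat * nat :=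
  if k is k'.+1 then
    ((deinterleave k' (N %/ 4)).1 * 2 + (N %% 4) %/ 2,
     (deinterleave k' (N %/ 4)).2 * 2 + N %% 2)%N
  else (0, 0)%N.

(** * Counting with separated binary digits *)

Section Deinterleave.
Context {R : realType}.

Lemma big_quad (h : nat -> R) (n : nat) :
  \sum_(N < (n * 4)%N) h N =
  \sum_(N < n) (h (N * 4)%N + h (N * 4 + 1)%N + h (N * 4 + 2)%N + h (N * 4 + 3)%N).
Proof.
elim: n => [|n IH]; first by rewrite !big_ord0.
rewrite [RHS]big_ord_recr/= -IH.
have -> : (n.+1 * 4 = (n * 4).+4)%N by lia.
rewrite !big_ord_recr /= -!addrA.
by have [-> -> ->] : [/\ n * 4 + 1 = (n * 4).+1, n * 4 + 2 = (n * 4).+2 & n * 4 + 3 = (n * 4).+3]%N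
  by split; lia.
Qed.

Lemma big_double (h : nat -> R) (n : nat) :
  \sum_(N < (n * 2)%N) h N = \sum_(N < n) (h (N * 2)%N + h (N * 2 + 1)%N).
Proof.
elim: n => [|n IH]; first by rewrite !big_ord0.
rewrite [RHS]big_ord_recr/= -IH.
have -> : (n.+1 * 2 = (n * 2).+2)%N by lia.
rewrite !big_ord_recr /= -!addrA.
by have -> : (n * 2 + 1 = (n * 2).+1)%N by lia.
Qed.

Lemma deinterleaveS k N r : (r < 4)%N ->
  deinterleave k.+1 (N * 4 + r)%N =
  ((deinterleave k N).1 * 2 + r %/ 2, (deinterleave k N).2 * 2 + r %% 2)%N.
Proof.
move=> r4 /=; have -> : ((N * 4 + r) %/ 4 = N)%N by lia.
by congr ((_ + _)%N, (_ + _)%N); lia.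
Qed.

(** This is the bijection between numbers below 4^k and pairs of numbers below 2^k, stated through
    sums of products so that the induction can absorb the last base-4 digit into [f] and [g]. *)
Lemma sum_deinterleave k (f g : nat -> R) :
  \sum_(N < (4 ^ k)%N) f (deinterleave k N).1 * g (deinterleave k N).2 =
  (\sum_(i < (2 ^ k)%N) f i) * (\sum_(i < (2 ^ k)%N) g i).
Proof.
elim: k f g => [|k IH] f g; first by rewrite !expn0 !big_ord1.
rewrite !expnSr (big_quad (fun N => f (deinterleave k.+1 N).1 * g (deinterleave k.+1 N).2)).
rewrite (big_double f) (big_double g).
rewrite -(IH (fun i => f (i * 2)%N + f (i * 2 + 1)%N) (fun i => g (i * 2)%N + g (i * 2 + 1)%N)).
apply: eq_bigr => N _.
rewrite -{1 2}[(N * 4)%N]addn0 !deinterleaveS//=.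
by rewrite !addn0; ring.
Qed.

Lemma truncn_mul_div (x : R) (b : nat) : (0 < b)%N ->
  (Num.truncn (b%:R * x) %/ b)%N = Num.truncn x.
Proof.
move=> b0; have b0' : 0 < b%:R :> R by rewrite ltr0n.
have [x0|x0] := lerP 0 x; last first.
  have H (y : R) : y < 0 -> Num.truncn y = 0%N.
    by move=> y0; apply/truncn0Pn; rewrite -ltNge (lt_trans y0).
  by rewrite !H ?div0n// pmulr_rlt0.
have [le1 lt1] := andP (truncn_itv x0).
have bx0 : 0 <= b%:R * x by rewrite mulr_ge0// ltW.
apply/eqP; rewrite eqn_leq; apply/andP; split.
  rewrite -ltnS ltn_divLR// truncn_lt_nat// mulnC natrM ltr_pM2l//.
by rewrite leq_divRL// truncn_ge_nat// mulnC natrM ler_pM2l.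
Qed.

Definition evenbits (k : nat) (x : R) : R :=
  ((deinterleave k (Num.truncn ((4 ^ k)%:R * x))).1)%:R / (2 ^ k)%:R.

Definition oddbits (k : nat) (x : R) : R :=
  ((deinterleave k (Num.truncn ((4 ^ k)%:R * x))).2)%:R / (2 ^ k)%:R.

Lemma deinterleave_lt k N :
  ((deinterleave k N).1 < 2 ^ k)%N /\ ((deinterleave k N).2 < 2 ^ k)%N.
Proof.
elim: k N => [|k IH] N //=; have [] := IH (N %/ 4)%N; rewrite expnS; lia.
Qed.

Lemma bits_nondecreasing (x : R) :
  nondecreasing_seq (evenbits ^~ x) /\ nondecreasing_seq (oddbits ^~ x).
Proof.
have E k : (Num.truncn ((4 ^ k.+1)%:R * x) %/ 4)%N = Num.truncn ((4 ^ k)%:R * x).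
  by rewrite expnS natrM -mulrA truncn_mul_div.
split; apply/nondecreasing_seqP => k; rewrite /evenbits /oddbits /= E;
  rewrite ler_pdivrMr ?ltr0n ?expn_gt0// mulrAC ler_pdivlMr ?ltr0n ?expn_gt0//;
  rewrite -!natrM ler_nat expnS mulnA leq_mul2r; lia.
Qed.

End Deinterleave.

(** * Two independent uniform variables from one *)

Section UniformSplitting.
Local Open Scope ereal_scope.
Context {R : realType}.
Local Notation mu := (@lebesgue_measure R).
Local Notation Om := (measurableTypeR R).
Local Notation P := (uniform_prob (@ltr01 R)).

Lemma measurable_nat_fun d (T : measurableType d) (f : nat -> T) :
  measurable_fun setT f.
Proof. by []. Qed.

Lemma measurable_evenbits k : measurable_fun setT (@evenbits R k).
Proof.
apply: (measurableT_comp (@measurable_nat_fun _ R (fun N => (deinterleave k N).1%:R / (2 ^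
  k)%:R)%R)).
by apply: (measurableT_comp measurable_truncn); exact: measurable_funM.
Qed.

Lemma measurable_oddbits k : measurable_fun setT (@oddbits R k).
Proof.
apply: (measurableT_comp (@measurable_nat_fun _ R (fun N => (deinterleave k N).2%:R / (2 ^
  k)%:R)%R)).
by apply: (measurableT_comp measurable_truncn); exact: measurable_funM.
Qed.

Definition dyadic_floor (k : nat) (x : R) : R :=
  (Num.truncn ((2 ^ k)%:R * x))%:R / (2 ^ k)%:R.

Lemma dyadic_floor_nondecreasing (x : R) : nondecreasing_seq (dyadic_floor ^~ x).
Proof.
apply/nondecreasing_seqP => k; rewrite /dyadic_floor.
rewrite ler_pdivrMr ?ltr0n ?expn_gt0// mulrAC ler_pdivlMr ?ltr0n ?expn_gt0//.
rewrite -!natrM ler_nat expnS mulnA leq_mul2r; apply/orP; right.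
rewrite natrM -mulrA -[X in (X * 2)%N](@truncn_mul_div R _ 2)//.
by rewrite mulnC mulnC leq_trunc_div.
Qed.

Lemma dyadic_floor_bounds (k : nat) (x : R) : (0 <= x)%R ->
  (x - (2 ^ k)%:R^-1 <= dyadic_floor k x <= x)%R.
Proof.
move=> x0; have k0 : (0 < (2 ^ k)%:R :> R)%R by rewrite ltr0n expn_gt0.
have /andP[h1 h2] := truncn_itv (mulr_ge0 (ltW k0) x0).
apply/andP; split; last by rewrite /dyadic_floor ler_pdivrMr// (mulrC x).
rewrite /dyadic_floor ler_pdivlMr// mulrBl mulVf ?gt_eqF// lerBlDr (mulrC x).
by rewrite ltW// (lt_le_trans h2)// -natr1.
Qed.

Lemma dyadic_floor_cvg (x : R) : (0 <= x)%R -> dyadic_floor ^~ x @ \oo --> x.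
Proof.
move=> x0; have b k : (x - k.+1%:R^-1 <= dyadic_floor k x <= x)%R.
  have /andP[h1 ->] := dyadic_floor_bounds k x0; rewrite andbT.
  apply: le_trans h1; rewrite lerD2l lerN2 lef_pV2 ?posrE ?ltr0n ?expn_gt0//.
  by rewrite ler_nat ltn_expl.
apply: (@squeeze_cvgr _ _ _ _ (fun k => x - k.+1%:R^-1)%R (fun=> x)).
- exact: nearW.
- rewrite -[X in _ --> X]subr0; apply: cvgB; first exact: cvg_cst.
  exact: cvg_harmonic.
- exact: cvg_cst.
Qed.

Lemma measurable_dyadic_floor k : measurable_fun setT (dyadic_floor k).
Proof.
apply: (measurableT_comp (@measurable_nat_fun _ R (fun N => N%:R / (2 ^ k)%:R)%R)).
by apply: (measurableT_comp measurable_truncn); exact: measurable_funM.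
Qed.

Lemma measurable_gt_set d (T : measurableType d) (f : T -> R) (a : R) :
  measurable_fun setT f -> measurable [set x | a < f x]%R.
Proof.
by move=> mf; have := mf measurableT _ (measurable_itv `]a, +oo[); rewrite setTI set_itvoy.
Qed.

(** The truncations increase to x, so the events of exceeding [a] strictly increase to the event a <
    x. This is why open right rays are the test sets here. *)
Lemma uniform_dyadic_floor_cvg (a : R) :
  P [set x | a < dyadic_floor k x]%R @[k --> \oo] --> P `]a, +oo[%classic.
Proof.
have mD k : measurable [set x | a < dyadic_floor k x]%R.
  by apply: measurable_gt_set; exact: measurable_dyadic_floor.
rewrite uniform01E//; under eq_cvg do rewrite uniform01E//.
have -> : `]a, +oo[%classic `&` `[0%R, 1%R[%classic =
    \bigcup_k ([set x | a < dyadic_floor k x]%R `&` `[0%R, 1%R[%classic).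
  apply/seteqP; split => x.
    move=> [] /=; rewrite !in_itv/= andbT => ax x01.
    have /andP[x0 _] := x01.
    have [k _ /(_ k (leqnn k)) ak] : \forall k \near \oo, (a < dyadic_floor k x)%R.
      exact: (cvgr_gt x (dyadic_floor_cvg x0)).
    by exists k => //=; rewrite in_itv.
  move=> [k _ [ak]] x01; split => //; rewrite /= in_itv/= andbT.
  move: x01; rewrite /= in_itv/= => /andP[x0 _].
  by apply: (lt_le_trans ak); case/andP: (dyadic_floor_bounds k x0).
have mF i : (measurable : set (set Om)) ([set x | a < dyadic_floor i x]%R `&` `[0%R, 1%R[%classic).
  by apply: measurableI => //; exact: mD.
apply: nondecreasing_cvg_mu => //.
- exact: bigcupT_measurable.
- move=> i j ij; apply/subsetPset => x [ai x01]; split => //.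
  by apply: lt_le_trans ai _; exact: dyadic_floor_nondecreasing.
Qed.

(** At a finite level independence is a count: 2k uniform bits amount to two independent blocks of k
    uniform bits. *)
Lemma uniform_bits (k : nat) (a b : R) :
  P [set x | a < evenbits k x /\ b < oddbits k x]%R =
  P [set x | a < dyadic_floor k x]%R * P [set x | b < dyadic_floor k x]%R.
Proof.
rewrite (@uniform_truncn R (4 ^ k) (fun N => a < (deinterleave k N).1%:R / (2 ^ k)%:R /\
  b < (deinterleave k N).2%:R / (2 ^ k)%:R)%R); last by rewrite expn_gt0.
have D c : P [set x | c < dyadic_floor k x]%R = ((2 ^ k)%:R^-1 *
    \sum_(i < (2 ^ k)%N) (c < i%:R / (2 ^ k)%:R)%R%:R)%:E.
  rewrite (@uniform_truncn R (2 ^ k) (fun N => c < N%:R / (2 ^ k)%:R)%R) ?expn_gt0//.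
  congr (_ * _)%:E; apply: eq_bigr => i _; rewrite indicE; congr (nat_of_bool _)%:R.
  by apply/idP/idP; rewrite in_setE.
rewrite !D -EFinM mulrACA -invfM -natrM -expnMn.
rewrite -(sum_deinterleave k (fun i => (a < i%:R / (2 ^ k)%:R)%R%:R)
  (fun i => (b < i%:R / (2 ^ k)%:R)%R%:R)).
congr (_ * _)%:E; apply: eq_bigr => i _; rewrite indicE -natrM mulnb.
by congr (nat_of_bool _)%:R; apply/idP/andP; rewrite in_setE.
Qed.

Lemma sup_bits_gt (u : nat -> R) (a : R) : has_ubound (range u) ->
  (a < sup (range u))%R <-> exists k, (a < u k)%R.
Proof.
move=> ub; split.
  by move=> /sup_gt[|_ [k _ <-] ak]; [exists (u 0%N); exists 0%N|exists k].
by move=> [k ak]; apply: lt_le_trans ak _; apply: ub_le_sup => //; exists k.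
Qed.

(** As a supremum of increasing truncations, it exceeds [a] exactly when some truncation does; the
    limit events are thus increasing unions of finite-level ones. *)
Definition evenpart (x : Om) : Om := sup (range (evenbits ^~ x)).
Definition oddpart (x : Om) : Om := sup (range (oddbits ^~ x)).

Lemma bits_ubound (x : R) :
  has_ubound (range (evenbits ^~ x)) /\ has_ubound (range (oddbits ^~ x)).
Proof.
split; exists 1%R => _ [k _ <-]; rewrite ler_pdivrMr ?ltr0n ?expn_gt0// mul1r ler_nat ltnW//;
  by case: (deinterleave_lt k (Num.truncn ((4 ^ k)%:R * x))).
Qed.

Lemma measurable_evenpart : measurable_fun setT evenpart.
Proof.
apply: (measurable_fun_cvg (h := @evenbits R)); first exact: measurable_evenbits.
by move=> x _; apply: nondecreasing_cvgn;
  [exact: (bits_nondecreasing x).1|exact: (bits_ubound x).1].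
Qed.

Lemma measurable_oddpart : measurable_fun setT oddpart.
Proof.
apply: (measurable_fun_cvg (h := @oddbits R)); first exact: measurable_oddbits.
by move=> x _; apply: nondecreasing_cvgn;
  [exact: (bits_nondecreasing x).2|exact: (bits_ubound x).2].
Qed.

Lemma uniform_parts_rays (a b : R) :
  P (evenpart @^-1` `]a, +oo[ `&` oddpart @^-1` `]b, +oo[) =
  P `]a, +oo[%classic * P `]b, +oo[%classic.
Proof.
pose F k := [set x | a < evenbits k x /\ b < oddbits k x]%R.
have mF k : measurable (F k).
  apply: measurableI; apply: measurable_gt_set.
    exact: measurable_evenbits.
  exact: measurable_oddbits.
have FE : \bigcup_k F k = evenpart @^-1` `]a, +oo[ `&` oddpart @^-1` `]b, +oo[.
  apply/seteqP; split => x.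
    move=> [k _ [ak bk]]; split => /=; rewrite in_itv/= andbT.
      by apply/(sup_bits_gt _ (bits_ubound x).1); exists k.
    by apply/(sup_bits_gt _ (bits_ubound x).2); exists k.
  move=> [] /=; rewrite !in_itv/= !andbT.
  move=> /(sup_bits_gt _ (bits_ubound x).1)[i ai] /(sup_bits_gt _ (bits_ubound x).2)[j bj].
  exists (maxn i j) => //; split.
    by apply: lt_le_trans ai _; apply: (bits_nondecreasing x).1; exact: leq_maxl.
  by apply: lt_le_trans bj _; apply: (bits_nondecreasing x).2; exact: leq_maxr.
have c1 : P (F k) @[k --> \oo] --> P (\bigcup_k F k).
  apply: nondecreasing_cvg_mu => //; first exact: bigcupT_measurable.
  move=> i j ij; apply/subsetPset => x [ai bi]; split.
    by apply: lt_le_trans ai _; exact: (bits_nondecreasing x).1.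
  by apply: lt_le_trans bi _; exact: (bits_nondecreasing x).2.
rewrite -FE.
have c2 : P (F k) @[k --> \oo] --> P `]a, +oo[%classic * P `]b, +oo[%classic.
  under eq_cvg do rewrite uniform_bits.
  by apply: cvgeM; [by rewrite mule_def_fin ?fin_num_measure|exact:
    uniform_dyadic_floor_cvg|exact: uniform_dyadic_floor_cvg].
by rewrite -(cvg_lim _ c1)// (cvg_lim _ c2).
Qed.

End UniformSplitting.

Section RectangleLaw.
Local Open Scope ereal_scope.
Context {R : realType} d (T : measurableType d) (P : probability T R).
Local Notation Om := (measurableTypeR R).

Lemma law_on_rays (X : T -> Om) (mu1 : probability Om R) (F : set T) (c : R) :
  measurable_fun setT X -> measurable F -> (0 <= c)%R ->
  (forall a, P (X @^-1` `]a, +oo[ `&` F) = mu1 `]a, +oo[%classic * c%:E) ->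
  forall A, measurable A -> P (X @^-1` A `&` F) = mu1 A * c%:E.
Proof.
move=> mX mF c0 h A mA.
pose m1_ := [the {measure set Om -> \bar R} of pushforward (mrestr P mF) X].
pose m1 := m1_ mX.
pose m2 := [the {measure set Om -> \bar R} of mscale (NngNum c0) mu1].
suff : m1 A = m2 A by rewrite /m1 /m1_ /m2 /= /pushforward /mrestr /mscale /= muleC.
apply: eq_law_rays => // [|a].
  rewrite /m1 /m1_ /= /pushforward /mrestr preimage_setT setTI.
  by rewrite (le_lt_trans (probability_le1 _ _)) ?ltry.
by rewrite /m1 /m1_ /m2 /= /pushforward /mrestr /mscale /= muleC -h.
Qed.

Lemma law_on_ray_products (X Y : T -> Om) (mu1 mu2 : probability Om R) :
  measurable_fun setT X -> measurable_fun setT Y ->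
  (forall a b, P (X @^-1` `]a, +oo[ `&` Y @^-1` `]b, +oo[) =
     mu1 `]a, +oo[%classic * mu2 `]b, +oo[%classic) ->
  forall A B, measurable A -> measurable B ->
    P (X @^-1` A `&` Y @^-1` B) = mu1 A * mu2 B.
Proof.
move=> mX mY h A B mA mB.
have mXA C : measurable C -> measurable (X @^-1` C).
  by move=> mC; rewrite -[_ @^-1` _]setTI; exact: mX.
have mYB C : measurable C -> measurable (Y @^-1` C).
  by move=> mC; rewrite -[_ @^-1` _]setTI; exact: mY.
have finE (mu : probability Om R) C : measurable C -> (fine (mu C))%:E = mu C.
  by move=> mC; rewrite fineK// fin_num_measure.
have step b : P (X @^-1` A `&` Y @^-1` `]b, +oo[) = mu1 A * mu2 `]b, +oo[%classic.
  rewrite -(finE mu2)//; apply: law_on_rays => // [||a].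
  - exact: mYB.
  - by rewrite fine_ge0.
  - by rewrite h finE.
rewrite setIC [RHS]muleC -(finE mu1)//; apply: law_on_rays => // [||b].
- exact: mXA.
- by rewrite fine_ge0.
- by rewrite setIC step finE// muleC.
Qed.

End RectangleLaw.

(** * Prescribed laws through the quantile function *)

Section Quantile.
Local Open Scope ereal_scope.
Context {R : realType}.
Local Notation mu := (@lebesgue_measure R).
Local Notation Om := (measurableTypeR R).
Local Notation P := (uniform_prob (@ltr01 R)).

Lemma uniform_parts (A B : set Om) : measurable A -> measurable B ->
  P (evenpart @^-1` A `&` oddpart @^-1` B) = P A * P B.
Proof.
apply: law_on_ray_products; [exact: measurable_evenpart|exact: measurable_oddpart|].
exact: uniform_parts_rays.
Qed.

Variable nu : probability Om R.

Let F (x : R) : R := fine (nu `]-oo, x]%classic).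

Let FE x : (F x)%:E = nu `]-oo, x]%classic.
Proof. by rewrite fineK// fin_num_measure. Qed.

Let F_nd x y : (x <= y)%R -> (F x <= F y)%R.
Proof.
move=> xy; rewrite -lee_fin !FE; apply: le_measure; rewrite ?inE//.
by apply: subset_itvl; rewrite bnd_simp.
Qed.

(** Right continuity of the distribution function, in the form used to compare with an infimum. *)
Let F_right_limit (u x : R) : (forall y, x < y -> u <= F y)%R -> (u <= F x)%R.
Proof.
move=> h; rewrite -lee_fin FE (@itvNycEbigcap _ false).
have cv : nu `]-oo, (x + n.+1%:R^-1)%R]%classic @[n --> \oo] -->
    nu (\bigcap_n `]-oo, (x + n.+1%:R^-1)%R]%classic).
  apply: nonincreasing_cvg_mu => //.
  - by rewrite (le_lt_trans (probability_le1 _ _)) ?ltry.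
  - by apply: bigcap_measurable => //; exists 0%N.
  - move=> k n kn; apply/subsetPset; apply: subset_itvl.
    by rewrite bnd_simp lerD2l lef_pV2 ?posrE// ler_nat.
rewrite -(cvg_lim _ cv)//; apply: lime_ge; first by apply/cvg_ex; eexists; exact: cv.
by apply: nearW => n; rewrite -FE lee_fin h// ltrDl invr_gt0.
Qed.

Let F_ge1_lt (u : R) : (u < 1)%R -> exists x, (u <= F x)%R.
Proof.
move=> u1.
have cv : nu `]-oo, n%:R]%classic @[n --> \oo] --> nu (\bigcup_n `]-oo, n%:R]%classic).
  apply: nondecreasing_cvg_mu => //; first exact: bigcupT_measurable.
  by move=> k n kn; apply/subsetPset; apply: subset_itvl; rewrite bnd_simp ler_nat.
have UT : \bigcup_n `]-oo, n%:R]%classic = [set: R].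
  apply/seteqP; split => // x _; exists (Num.truncn x).+1 => //=.
  by rewrite in_itv/= ltW// truncnS_gt.
rewrite UT probability_setT in cv.
have [k _ /(_ k (leqnn k)) uk] : \forall k \near \oo, (u < F k%:R)%R.
  exact: (cvgr_gt 1%R (fine_cvg cv)).
by exists k%:R; exact: ltW.
Qed.

Let F_lt (u : R) : (0 < u)%R -> exists x, (F x < u)%R.
Proof.
move=> u0.
have cv : nu `]-oo, (- n%:R)%R]%classic @[n --> \oo] --> nu (\bigcap_n `]-oo, (- n%:R)%R]%classic).
  apply: nonincreasing_cvg_mu => //.
  - by rewrite (le_lt_trans (probability_le1 _ _)) ?ltry.
  - by apply: bigcap_measurable => //; exists 0%N.
  - move=> k n kn; apply/subsetPset; apply: subset_itvl.
    by rewrite bnd_simp lerN2 ler_nat.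
have UT : \bigcap_n `]-oo, (- n%:R)%R]%classic = set0 :> set R.
  apply/seteqP; split => // x /(_ (Num.truncn (- x)).+1 I) /=.
  by rewrite in_itv/= lerNr leNgt truncnS_gt.
rewrite UT measure0 in cv.
have [k _ /(_ k (leqnn k)) uk] : \forall k \near \oo, (F (- k%:R) < u)%R.
  exact: (cvgr_lt 0%R (fine_cvg cv)).
by exists (- k%:R)%R.
Qed.

(** Generalized inverse of the distribution function. The value 0 off the open unit interval is a
    default, taken on a null set of the uniform law. *)
Let g (u : Om) : Om := if (0 < (u : R) < 1)%R then inf [set x : R | u <= F x]%R else 0%R.

(** The adjunction between a distribution function and its quantile function; right continuity makes
    the infimum attained. *)
Let gE (u a : R) : (0 < u < 1)%R -> (a < g u)%R = (F a < u)%R.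
Proof.
move=> u01; rewrite /g u01; case/andP: u01 => u0 u1.
have [x0 ux0] := F_ge1_lt u1.
apply/idP/idP; apply: contraTT; rewrite -!leNgt => h.
  apply: ge_inf => //.
  have [y Fy] := F_lt u0; exists y => z /= uz; rewrite leNgt; apply/negP => zy.
  by have := le_lt_trans (F_nd (ltW zy)) Fy; rewrite ltNge uz.
apply: F_right_limit => y ay.
have [|z /= uz zy] := inf_lt _ (le_lt_trans h ay); first by exists x0.
exact: le_trans uz (F_nd (ltW zy)).
Qed.

Let g_ray (a : R) : g @^-1` `]a, +oo[ `&` `]0%R, 1%R[ = `]F a, 1%R[%classic.
Proof.
apply/seteqP; split => u /=; rewrite !in_itv/= ?andbT.
  by move=> [+ u01]; rewrite gE// => ->; case/andP: u01.
move=> /andP[Fu u1]; have u01 : (0 < u < 1)%R.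
  by rewrite u1 andbT (le_lt_trans _ Fu)// fine_ge0.
by rewrite gE.
Qed.

Let mg : measurable_fun setT g.
Proof.
apply: (@measurability _ _ Om Om setT g (@RGenOInfty.G R)); first exact: RGenOInfty.measurableE.
move=> _ [_ [a ->] <-]; rewrite setTI.
rewrite -[X in measurable X]setIT -(setUv (`]0%R, 1%R[%classic : set R)) setIUr g_ray.
apply: measurableU => //.
(* Off the open unit interval [g] is 0, so the ray pulls back to all or nothing there, according to
   the sign of [a]. *)
have [a0|a0] := ltP a 0%R.
  rewrite (_ : _ `&` _ = ~` (`]0%R, 1%R[%classic : set R)); first exact: measurableC.
  apply/seteqP; split => [u []//|u /= u01]; split => //; rewrite /g in_itv/= andbT.
  by case: ifPn => // h; exfalso; apply: u01; rewrite in_itv.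
rewrite (_ : _ `&` _ = set0)//; apply/seteqP; split => // u [] /=.
rewrite /g !in_itv/= andbT; case: ifPn => // _.
by rewrite ltNge a0.
Qed.

Lemma exists_quantile : exists h : Om -> Om, measurable_fun setT h /\
  forall A, measurable A -> P (h @^-1` A) = nu A.
Proof.
exists g; split => // A mA.
have mgB B : measurable B -> measurable (g @^-1` B).
  by move=> mB; rewrite -[_ @^-1` _]setTI; exact: mg.
suff : forall a : R, P (g @^-1` `]a, +oo[ `&` setT) = nu `]a, +oo[%classic * 1%:E.
  move=> h; have := law_on_rays mg measurableT ler01 h mA.
  by rewrite setIT mule1.
move=> a; rewrite setIT mule1 uniform01E; last exact: mgB.
(* The point 0 is split off because [g] inverts the distribution function only on the open
   interval. *)
have -> : g @^-1` `]a, +oo[ `&` `[0%R, 1%R[ =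
    `]F a, 1%R[%classic `|` (g @^-1` `]a, +oo[ `&` [set 0%R]) :> set R.
  rewrite -g_ray; apply/seteqP; split => u /=; rewrite !in_itv/= ?andbT.
    move=> [gu /andP[]]; rewrite le_eqVlt => /orP[/eqP u0|u0 u1]; first by right.
    by left; rewrite u0.
  by move=> [[gu /andP[/ltW u0 u1]]|[gu u0]]; split => //; rewrite ?u0 ?lexx ?ltr01.
have m1 : (measurable : set (set R)) (`]F a, 1%R[%classic : set R) by [].
have m2 : (measurable : set (set R)) (g @^-1` `]a, +oo[ `&` [set 0%R]).
  by apply: measurableI => //; exact: mgB.
have mu2 : mu (g @^-1` `]a, +oo[ `&` [set 0%R]) = 0.
  apply/eqP; rewrite eq_le measure_ge0 andbT -(lebesgue_measure_set1 0%R).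
  by apply: le_measure; rewrite ?inE.
have F1 : (F a <= 1)%R by rewrite -lee_fin FE; exact: probability_le1.
transitivity (mu `]F a, 1%R[%classic).
  apply/eqP; rewrite eq_le; apply/andP; split.
    apply: (@le_trans _ _ (mu `]F a, 1%R[%classic + mu (g @^-1` `]a, +oo[ `&` [set 0%R]))).
      exact: measureU2.
    by rewrite mu2 adde0.
  by apply: le_measure; rewrite ?inE//; exact: measurableU.
rewrite [LHS]lebesgue_measure_itv/= lte_fin.
have -> : `]a, +oo[%classic = ~` `]-oo, a]%classic :> set R by rewrite setCitvl.
rewrite probability_setC// -FE; by case: ltgtP F1 => // -> _; rewrite subee.
Qed.

End Quantile.

(** * From rectangles to general planar sets, several pairs at once *)

Section IndependentPairs.
Local Open Scope ereal_scope.
Context {R : realType} d (T : measurableType d) (P : probability T R).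
Local Notation Om := (measurableTypeR R).
Variables (mu nu : probability Om R) (X Y : nat -> T -> R) (F : set T).
Hypotheses (mX : forall k, measurable_fun setT (X k))
  (mY : forall k, measurable_fun setT (Y k)) (mF : measurable F).

Lemma measurable_forall_lt N (B : nat -> set T) : (forall k, measurable (B k)) ->
  measurable [set w | forall k, (k < N)%N -> B k w].
Proof.
move=> mB; rewrite (_ : [set w | _] = \bigcap_(k in [set k | (k < N)%N]) B k)//.
case: N => [|N]; last by apply: bigcap_measurable => //; exists 0%N.
rewrite (_ : \bigcap_(k in _) _ = setT)//.
by apply/seteqP; split => // w _ k /=; rewrite ltn0.
Qed.

Lemma measurable_preimage (Z : T -> R) (A : set R) :
  measurable_fun setT Z -> measurable A -> measurable (Z @^-1` A).
Proof. by move=> mZ mA; rewrite -[_ @^-1` _]setTI; exact: mZ. Qed.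

Lemma measurable_pair_preimage k (S : set (R * R)) : measurable S ->
  measurable [set w | S (X k w, Y k w)].
Proof.
move=> mS; have mXY : measurable_fun setT (fun w => (X k w, Y k w)).
  exact: measurable_fun_pair.
by rewrite -[X in measurable X]setTI; exact: mXY.
Qed.

(** Hybrid argument: in the auxiliary claim the first j pairs are tested by arbitrary sets [S k] and
    the others still by rectangles. Moving from j to j + 1 is [pair_law] for the pair j, with the
    constraints on the remaining pairs, and [F], gathered in one event. *)
Lemma indep_pairs :
  (forall N (A C : nat -> set R), (forall k, measurable (A k)) -> (forall k, measurable (C k)) ->
    P ([set w | forall k, (k < N)%N -> A k (X k w) /\ C k (Y k w)] `&` F) =
    (\prod_(k < N) (fine (mu (A k)) * fine (nu (C k))))%:E * P F) ->
  forall N (S : nat -> set (R * R)), (forall k, measurable (S k)) ->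
    P ([set w | forall k, (k < N)%N -> S k (X k w, Y k w)] `&` F) =
    (\prod_(k < N) fine ((mu \x nu) (S k)))%:E * P F.
Proof.
move=> h N S mS.
pose PF := fine (P F).
have PFE : P F = PF%:E by rewrite /PF fineK// fin_num_measure.
suff main j : (j <= N)%N -> forall A C : nat -> set R,
    (forall k, measurable (A k)) -> (forall k, measurable (C k)) ->
    P ([set w | forall k, (k < N)%N -> if (k < j)%N then S k (X k w, Y k w)
       else A k (X k w) /\ C k (Y k w)] `&` F) =
    (\prod_(k < N) (if (k < j)%N then fine ((mu \x nu) (S k))
       else fine (mu (A k)) * fine (nu (C k))))%:E * P F.
  have := main N (leqnn N) (fun=> setT) (fun=> setT) (fun=> measurableT) (fun=> measurableT).
  have -> : [set w | forall k, (k < N)%N -> if (k < N)%N then S k (X k w, Y k w)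
       else setT (X k w) /\ setT (Y k w)] = [set w | forall k, (k < N)%N -> S k (X k w, Y k w)].
    by apply/seteqP; split => w /= H k kN; have := H k kN; rewrite kN.
  move=> ->; congr (_%:E * _); apply: eq_bigr => k _; by rewrite ltn_ord.
elim: j => [_ A C mA mC|j IH jN A C mA mC]; first exact: h.
pose g (k : nat) := (if (k < j)%N then fine ((mu \x nu) (S k))
       else fine (mu (A k)) * fine (nu (C k)))%R.
pose j' := Ordinal jN.
pose c := (\prod_(k < N | k != j') g k)%R.
pose F' := [set w | forall k, (k < N)%N -> (if (k == j)%N then True else
   if (k < j)%N then S k (X k w, Y k w) else A k (X k w) /\ C k (Y k w))] `&` F.
have g0 k : (0 <= g k)%R.
  by rewrite /g; case: ifPn => _; rewrite ?mulr_ge0 ?fine_ge0.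
have c0 : (0 <= c * PF)%R.
  by rewrite mulr_ge0 ?fine_ge0//; apply: prodr_ge0 => k _; exact: g0.
have mF' : measurable F'.
  apply: measurableI => //.
  apply: (@measurable_forall_lt N (fun k => [set w | if (k == j)%N then True else
    if (k < j)%N then S k (X k w, Y k w) else A k (X k w) /\ C k (Y k w)])) => k.
  case: (k == j); first exact: measurableT.
  case: (k < j)%N; first exact: measurable_pair_preimage.
  by apply: measurableI; exact: measurable_preimage.
have hrect A0 C0 : measurable A0 -> measurable C0 ->
    P (X j @^-1` A0 `&` Y j @^-1` C0 `&` F') = mu A0 * nu C0 * (c * PF)%:E.
  move=> mA0 mC0.
  pose A' k := if (k == j)%N then A0 else A k.
  pose C' k := if (k == j)%N then C0 else C k.
  have mA' k : measurable (A' k) by rewrite /A'; case: ifP.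
  have mC' k : measurable (C' k) by rewrite /C'; case: ifP.
  have := IH (ltnW jN) A' C' mA' mC'.
  have -> : [set w | forall k, (k < N)%N -> if (k < j)%N then S k (X k w, Y k w)
         else A' k (X k w) /\ C' k (Y k w)] `&` F = X j @^-1` A0 `&` Y j @^-1` C0 `&` F'.
    rewrite setIA; congr (_ `&` _); apply/seteqP; split => w /=.
      move=> H; split; first by have := H j jN; rewrite ltnn /A' /C' eqxx.
      by move=> k kN; have := H k kN; rewrite /A' /C'; case: eqVneq.
    move=> [Hj H] k kN; have := H k kN; rewrite /A' /C'.
    by case: eqVneq => [-> _|_ //]; rewrite ltnn.
  move=> ->.
  rewrite PFE -(@fineK _ (mu A0)) ?fin_num_measure// -(@fineK _ (nu C0)) ?fin_num_measure//.
  rewrite -!EFinM mulrA; congr (_ * _)%:E.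
  rewrite [LHS](bigD1 j')//= ltnn /A' /C' eqxx; congr (_ * _)%R; apply: eq_bigr => k kj.
  by rewrite /g; case: (eqVneq (k : nat) j) => // kjE; move: kj; rewrite -val_eqE /= kjE eqxx.
have -> : [set w | forall k, (k < N)%N -> if (k < j.+1)%N then S k (X k w, Y k w)
       else A k (X k w) /\ C k (Y k w)] `&` F = (fun w => (X j w, Y j w)) @^-1` S j `&` F'.
  rewrite setIA; congr (_ `&` _); apply/seteqP; split => w /=.
    move=> H; split; first by have := H j jN; rewrite ltnSn.
    move=> k kN; have := H k kN; case: eqVneq => // kj.
    by rewrite ltnS (leq_eqVlt k j) (negbTE kj).
  move=> [Hj H] k kN; have := H k kN; rewrite ltnS (leq_eqVlt k j).
  by case: eqVneq => [-> //|_ //].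
rewrite (@pair_law _ _ R P _ Om _ Om mu nu (X j) (Y j) F' (c * PF) (mX j) (mY j) mF' c0 hrect (S
  j) (mS j)).
have fS : (mu \x nu) (S j) = (fine ((mu \x nu) (S j)))%:E.
  pose pr : probability (Om * Om)%type R := (mu \x nu).
  apply/esym/fineK. exact: (fin_num_measure pr _ (mS j)).
rewrite PFE [in LHS]fS -!EFinM mulrA; congr (_ * _)%:E.
rewrite [RHS](bigD1 j')//= ltnSn; congr (_ * _)%R; apply: eq_bigr => k kj.
rewrite /g ltnS (leq_eqVlt k j); case: eqVneq => // kjE.
by move: kj; rewrite -val_eqE /= kjE eqxx.
Qed.

End IndependentPairs.

(** * Levy's construction of scalar Brownian motion *)

Section DyadicIncrements.
Local Open Scope ereal_scope.
Context {R : realType} d (T : measurableType d) (P : probability T R).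
Local Notation Om := (measurableTypeR R).
Variables U V : T -> T.
Hypotheses (mU : measurable_fun setT U) (mV : measurable_fun setT V).
Hypothesis splitUV : forall A B, measurable A -> measurable B ->
  P (U @^-1` A `&` V @^-1` B) = P A * P B.

Lemma measurable_iter k : measurable_fun setT (iter k V).
Proof. by elim: k => [|k IH]; [exact: measurable_id|exact: measurableT_comp mV IH]. Qed.

(** Induction peels off the first seed: [splitUV] separates [U w] from [V w], and the remaining
    seeds are those of [V w]. The event [E] keeps track of what is left after N seeds. *)
Lemma indep_seeds N (h : nat -> T -> R) (nu : nat -> probability Om R)
    (A : nat -> set R) (E : set T) :
  (forall k, measurable_fun setT (h k)) ->
  (forall k B, measurable B -> P (h k @^-1` B) = nu k B) ->
  (forall k, measurable (A k)) -> measurable E ->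
  P ([set w | forall k, (k < N)%N -> A k (h k (U (iter k V w)))] `&` (iter N V) @^-1` E) =
  (\prod_(k < N) fine (nu k (A k)))%:E * P E.
Proof.
elim: N h nu A => [|N IH] h nu A mh lh mA mE.
  rewrite big_ord0 mul1e; congr (P _); apply/seteqP; split => [w [_]//|w Ew].
  by split.
pose C := [set w | forall k, (k < N)%N -> A k.+1 (h k.+1 (U (iter k V w)))] `&` (iter N V) @^-1` E.
have mhA k : measurable (h k @^-1` A k) by apply: measurable_preimage.
have mC : measurable C.
  apply: measurableI; last by rewrite -[_ @^-1` _]setTI; exact: measurable_iter.
  apply: (@measurable_forall_lt _ _ N (fun k => [set w | A k.+1 (h k.+1 (U (iter k V w)))])) => k.
  rewrite -[X in measurable X]setTI.
  exact: (measurableT_comp (mh k.+1) (measurableT_comp mU (measurable_iter k))).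
rewrite (_ : _ `&` _ = U @^-1` (h 0%N @^-1` A 0%N) `&` V @^-1` C); last first.
  apply/seteqP; split => w /=.
    move=> [H Ew]; split; first exact: (H 0%N).
    split; last by rewrite /= -iterSr.
    by move=> k kN; rewrite -iterSr; exact: (H k.+1).
  move=> [H0 [H Ew]]; split; last by rewrite -[V _]/(iter N.+1 V w) iterSr.
  move=> [|k]//; rewrite ltnS => kN.
  by rewrite -[iter k.+1 V w]/(iter k.+1 V w) iterSr; exact: H.
rewrite splitUV// lh// (IH (fun k => h k.+1) (fun k => nu k.+1) (fun k => A k.+1))//.
rewrite -[X in X * _](@fineK _ (nu 0%N (A 0%N))) ?fin_num_measure//.
- by rewrite muleA -EFinM big_ord_recl.
- exact: mA.
- by move=> k B mB; exact: lh.
Qed.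

(** The length 2^(-n) of a level-n interval, hence the variance of a Brownian increment over it.
    Level 0 has no parent, so its noise, of variance 1, is the increment itself. *)
Definition lvar (n : nat) : R := (2^-1 ^+ n)%R.
Definition noise_var (n : nat) : R := if n is n'.+1 then (lvar n' / 4)%R else 1%R.

Lemma lvar_gt0 n : (0 < lvar n)%R.
Proof. by rewrite exprn_gt0// invr_gt0. Qed.

Variable q : nat -> T -> R.
Hypothesis mq : forall n, measurable_fun setT (q n).
Hypothesis lq : forall n A, measurable A -> P (q n @^-1` A) = Nv 0%R (noise_var n) A.

(* [U] and [V] split one uniform seed into two independent ones, so
   [U (iter n V w)], n >= 0, are independent seeds, one per dyadic level; each is
   split again into one seed per increment of that level. *)
Definition noise (n k : nat) (w : T) : R := q n (U (iter k V (U (iter n V w)))).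

Lemma measurable_noise n k : measurable_fun setT (noise n k).
Proof.
apply: (measurableT_comp (mq n)); apply: (measurableT_comp mU).
apply: (measurableT_comp (measurable_iter k)); apply: (measurableT_comp mU).
exact: measurable_iter.
Qed.

(* Levy's midpoint refinement: the halves of a N(0, s) increment d are
   d/2 + e and d/2 - e with e an independent N(0, s/4) variable. *)
Fixpoint delta (n k : nat) (w : T) : R :=
  if n is n'.+1 then (delta n' k./2 w / 2 + (-1) ^+ k * noise n k./2 w)%R
  else noise 0 k w.

Lemma measurable_delta n k : measurable_fun setT (delta n k).
Proof.
elim: n k => [|n IH] k; first exact: measurable_noise.
apply: measurable_funD.
  by apply: measurable_funM; [exact: IH|exact: measurable_cst].
by apply: measurable_funM; [exact: measurable_cst|exact: measurable_noise].
Qed.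

Lemma delta_split n k w : delta n k w = (delta n.+1 k.*2 w + delta n.+1 k.*2.+1 w)%R.
Proof.
rewrite [delta n.+1 k.*2 w]/= [delta n.+1 k.*2.+1 w]/= doubleK uphalf_double.
by rewrite -[((-1) ^+ k.*2)%R]signr_odd odd_double exprS -[((-1) ^+ k.*2)%R]signr_odd odd_double;
  field.
Qed.

Let noise_indep n N (C : nat -> set R) : (forall k, measurable (C k)) ->
  P [set w | forall k, (k < N)%N -> C k (q n (U (iter k V w)))] =
  (\prod_(k < N) fine (Nv 0%R (noise_var n) (C k)))%:E.
Proof.
move=> mC.
have := @indep_seeds N (fun=> q n) (fun=> Nv 0%R (noise_var n)) C setT (fun=> mq n) (fun k B mB
  => lq n mB) mC measurableT.
by rewrite preimage_setT setIT probability_setT mule1.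
Qed.

Let measurable_noise_set n N (C : nat -> set R) : (forall k, measurable (C k)) ->
  measurable [set w | forall k, (k < N)%N -> C k (q n (U (iter k V w)))].
Proof.
move=> mC; apply: (@measurable_forall_lt _ _ N (fun k => [set w | C k (q n (U (iter k V w)))]))
  => k.
rewrite -[X in measurable X]setTI.
exact: (measurableT_comp (mq n) (measurableT_comp mU (measurable_iter k))).
Qed.

Lemma prod_double (f : nat -> R) M :
  (\prod_(k < M.*2) f k = \prod_(k < M) (f k.*2 * f k.*2.+1))%R.
Proof.
elim: M => [|M IH]; first by rewrite !big_ord0.
by rewrite doubleS !big_ord_recr /= IH mulrA.
Qed.

Lemma indep_delta n N (A : nat -> set R) (E : set T) :
  (forall k, measurable (A k)) -> measurable E ->
  P ([set w | forall k, (k < N)%N -> A k (delta n k w)] `&` (iter n.+1 V) @^-1` E) =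
  (\prod_(k < N) fine (Nv 0%R (lvar n) (A k)))%:E * P E.
Proof.
elim: n N A E => [|n IH] N A E mA mE.
  rewrite (_ : _ `&` _ = U @^-1` [set w | forall k, (k < N)%N -> A k (q 0%N (U (iter k V w)))]
    `&` V @^-1` E)//.
  rewrite splitUV//; last exact: measurable_noise_set.
  by rewrite noise_indep// /noise_var /lvar expr0.
(* Level n + 1 is produced in pairs of siblings, so an even number of increments is treated first; a
   general N is padded with [setT] at the end. *)
have main M (A' : nat -> set R) : (forall k, measurable (A' k)) ->
    P ([set w | forall k, (k < M.*2)%N -> A' k (delta n.+1 k w)] `&` (iter n.+2 V) @^-1` E) =
    (\prod_(k < M.*2) fine (Nv 0%R (lvar n.+1) (A' k)))%:E * P E.
  move=> mA'.
  pose S k := [set z : R * R | A' k.*2 (z.1 / 2 + z.2)%R /\ A' k.*2.+1 (z.1 / 2 - z.2)%R].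
  have mS k : measurable (S k).
    have mhalf : measurable_fun setT (fun z : R * R => z.1 / 2)%R.
      by apply: measurable_funM => //; exact: measurable_cst.
    apply: measurableI; rewrite -[X in measurable X]setTI.
      exact: (measurable_funD mhalf measurable_snd).
    exact: (measurable_funB mhalf measurable_snd).
  have mF : measurable ((iter n.+2 V) @^-1` E).
    by rewrite -[_ @^-1` _]setTI; exact: measurable_iter.
  (* [V] preserves [P]; the induction hypothesis with no increment at all accounts for the
     iterations below. *)
  have PF : P ((iter n.+2 V) @^-1` E) = P E.
    have := IH 0%N (fun=> setT) (V @^-1` E) (fun=> measurableT).
    rewrite big_ord0 mul1e (_ : [set w | _] = setT) ?setTI; last by apply/seteqP; split.
    have -> : iter n.+1 V @^-1` (V @^-1` E) = iter n.+2 V @^-1` E by [].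
    move=> ->; last by rewrite -[_ @^-1` _]setTI; exact: mV.
    by have := splitUV measurableT mE; rewrite preimage_setT setTI probability_setT mul1e.
  have pairs K (A0 C : nat -> set R) : (forall k, measurable (A0 k)) -> (forall k, measurable (C
    k)) ->
      P ([set w | forall k, (k < K)%N -> A0 k (delta n k w) /\ C k (noise n.+1 k w)] `&`
         (iter n.+2 V) @^-1` E) =
      (\prod_(k < K) (fine (Nv 0%R (lvar n) (A0 k)) * fine (Nv 0%R (noise_var n.+1) (C k))))%:E *
      P ((iter n.+2 V) @^-1` E).
    move=> mA0 mC.
    pose E1 := [set w | forall k, (k < K)%N -> C k (q n.+1 (U (iter k V w)))].
    have mE1 : measurable E1 by exact: measurable_noise_set.
    have mUE1 : measurable (U @^-1` E1) by rewrite -[_ @^-1` _]setTI; exact: mU.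
    have mVE : measurable (V @^-1` E) by rewrite -[_ @^-1` _]setTI; exact: mV.
    rewrite (_ : _ `&` _ = [set w | forall k, (k < K)%N -> A0 k (delta n k w)] `&`
      (iter n.+1 V) @^-1` (U @^-1` E1 `&` V @^-1` E)); last first.
      apply/seteqP; split => w /=.
        move=> [H Ew]; split; first by move=> k kK; have [] := H k kK.
        by split => // k kK; have [] := H k kK.
      by move=> [H1 [H2 Ew]]; split => // k kK; split; [exact: H1|exact: H2].
    rewrite IH//; last exact: measurableI.
    by rewrite splitUV// noise_indep// PF big_split/= EFinM muleA.
  have := @indep_pairs R _ T P (Nv 0%R (lvar n)) (Nv 0%R (noise_var n.+1)) (delta n)
    (noise n.+1) _ (measurable_delta n) (measurable_noise n.+1) mF pairs M S mS.
  rewrite PF (_ : [set w | _] = [set w | forall k, (k < M.*2)%N -> A' k (delta n.+1 k w)]).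
    move=> ->; congr (_%:E * _); rewrite (prod_double (fun k => fine (Nv 0%R (lvar n.+1) (A'
      k)))); apply: eq_bigr => k _.
    have -> : (lvar n.+1 = lvar n / 2)%R by rewrite /lvar exprSr.
    rewrite -fineM; last 2 first.
    - by apply: (fin_num_measure (Nv 0%R (lvar n / 2)%R)); exact: mA'.
    - by apply: (fin_num_measure (Nv 0%R (lvar n / 2)%R)); exact: mA'.
    by congr fine; exact: (normal_prob_half_rotation (lvar_gt0 n) (mA' k.*2) (mA' k.*2.+1)).
  apply/seteqP; split => w /= H k kM.
    have kM' : (k./2 < M)%N by rewrite -ltn_double (leq_ltn_trans _ kM)// -{2}(odd_double_half k)
      leq_addl.
    have [H0 H1] := H _ kM'; rewrite -signr_odd.
    have := odd_double_half k; case: (odd k) => /= kE.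
      by have -> : A' k = A' k./2.*2.+1; [rewrite -[in LHS]kE|rewrite expr1 mulN1r].
    by have -> : A' k = A' k./2.*2; [rewrite -[in LHS]kE|rewrite expr0 mul1r].
  split.
    have := H k.*2; rewrite ltn_double => /(_ kM).
    by rewrite /= doubleK -signr_odd odd_double expr0 mul1r.
  have := H k.*2.+1; rewrite ltn_Sdouble => /(_ kM).
  by rewrite /= uphalf_double -signr_odd /= odd_double expr1 mulN1r.
pose A' k := if (k < N)%N then A k else setT.
have mA' k : measurable (A' k) by rewrite /A'; case: ifP.
have := main N A' mA'.
have NN : (N <= N.*2)%N by rewrite -addnn leq_addr.
have -> : [set w | forall k, (k < N.*2)%N -> A' k (delta n.+1 k w)] =
    [set w | forall k, (k < N)%N -> A k (delta n.+1 k w)].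
  apply/seteqP; split => w /= H k kN.
    by have := H k (leq_trans kN NN); rewrite /A' kN.
  by rewrite /A'; case: ifPn => // kN'; exact: H.
move=> ->; congr (_%:E * _).
rewrite (big_ord_widen _ (fun k => fine (Nv 0%R (lvar n.+1) (A k))) NN) [RHS]big_mkcond/=.
apply: eq_bigr => k _; rewrite /A'; case: ifP => // _.
by rewrite probability_setT.
Qed.

End DyadicIncrements.

(** * Almost sure decay of the increments *)

Section GoodPaths.
Local Open Scope ereal_scope.
Context {R : realType}.
Local Notation Om := (measurableTypeR R).

(* Any rate strictly between 2^(-1/2) and 1 works: the standard deviation at
   level n is 2^(-n/2), and the 4^n first increments cover the time interval
   [0, 2^n]. *)
Definition modulus (n : nat) : R := ((9 / 10) ^+ n)%R.

Lemma modulus_gt0 n : (0 < modulus n)%R.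
Proof. by rewrite exprn_gt0// divr_gt0. Qed.

(** From exp y = exp(y / 3)^3 >= (y / 3)^3. The cube is chosen because modulus^2 / lvar equals
    (81/50)^n, whose cube outgrows the 4^n increments of level n while its square does not. *)
Lemma expRN_le_cube (y : R) : (0 < y)%R -> (expR (- y) <= 27 / y ^+ 3)%R.
Proof.
move=> y0; rewrite expRN -[X in (_ <= X)%R]invrK invf_div lef_pV2 ?posrE ?expR_gt0//; last first.
  by rewrite divr_gt0// exprn_gt0.
have -> : (y ^+ 3 / 27 = (y / 3) ^+ 3)%R by field.
have -> : expR y = (expR (y / 3) ^+ 3)%R.
  by rewrite -expRM_natr; congr expR; field.
have y3 : (0 <= y / 3)%R by rewrite divr_ge0// ltW.
apply: lerXn2r; rewrite ?nnegrE ?expR_ge0//.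
by rewrite (le_trans _ (expR_ge1Dx _))// lerDr.
Qed.

Lemma normal_modulus_tail (n : nat) :
  (((4 ^ n)%:R)%:E * Nv 0%R (lvar n) [set x : R | modulus n < `|x|]%R <=
   (432 * (125 / 128) ^+ n)%:E).
Proof.
apply: (@le_trans _ _ ((4 ^ n)%:R%:E *
    (expR (- modulus n ^+ 2 / (lvar n *+ 2)) *+ 2)%:E)).
  apply: lee_wpmul2l; first by rewrite lee_fin.
  exact: (normal_tail (lvar_gt0 n) (ltW (modulus_gt0 n))).
rewrite -EFinM lee_fin.
(* Half of modulus^2 / lvar. Then 432 = 2 x 27 x 2^3 collects the two tails, the constant of the
   cubic bound and this halving, while 125/128 = 4 (5/8)^3 bounds the true ratio 4 (50/81)^3. *)
set y := ((81 / 50) ^+ n / 2 : R)%R.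
have y0 : (0 < y)%R by rewrite divr_gt0// exprn_gt0// divr_gt0.
have -> : (- modulus n ^+ 2 / (lvar n *+ 2) = - y)%R.
  rewrite mulNr; congr (- _)%R; rewrite -(mulr_natr (lvar n)) invfM mulrA /modulus /lvar.
  by rewrite -exprM mulnC exprM -exprVn -exprMn /y; congr (_ ^+ _ / _)%R; field.
have h := expRN_le_cube y0.
apply: (@le_trans _ _ ((4 ^ n)%:R * (27 / y ^+ 3 *+ 2))%R).
  by rewrite ler_wpM2l// lerMn2r h.
rewrite (_ : _ * _ = 432 * (4 * (50 / 81) ^+ 3) ^+ n)%R.
  have r0 (a b : nat) : (0 <= a%:R / b%:R :> R)%R by rewrite divr_ge0.
  have E : (125 / 128 = 4 * (5 / 8) ^+ 3 :> R)%R by field.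
  apply: ler_wpM2l; first exact: ler0n.
  apply: lerXn2r; rewrite ?nnegrE ?r0// ?E.
  apply: ler_wpM2l; first exact: ler0n.
  by apply: lerXn2r; rewrite ?nnegrE; [exact: r0|exact: r0|lra].
have -> : ((4 * (50 / 81) ^+ 3) ^+ n = 4 ^+ n * (((81 / 50) ^+ n)^-1) ^+ 3 :> R)%R.
  rewrite exprMn; congr (_ * _)%R; rewrite -exprM mulnC exprM; congr (_ ^+ 3)%R.
  by rewrite -exprVn; congr (_ ^+ n)%R; field.
have a0 : ((81 / 50 : R) ^+ n != 0)%R.
  by apply: lt0r_neq0; apply: exprn_gt0; rewrite divr_gt0.
by rewrite natrX /y; move: a0; set a := (_ ^+ n)%R; set b := (4 ^+ n)%R => a0; field.
Qed.

Lemma geometric_nneseries_lty (C r : R) (u : nat -> \bar R) :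
  (0 <= C)%R -> (0 <= r < 1)%R -> (forall n, 0 <= u n <= (C * r ^+ n)%:E) ->
  \sum_(n <oo) u n < +oo.
Proof.
move=> C0 /andP[r0 r1] hu.
apply: (@le_lt_trans _ _ (C / (1 - r))%:E); last by rewrite ltry.
apply: lime_le.
  by apply: is_cvg_nneseries => n _ _; case/andP: (hu n).
apply: nearW => n; rewrite big_mkord.
apply: (@le_trans _ _ (\sum_(i < n) (C * r ^+ i)%:E)).
  by apply: lee_sum => i _; case/andP: (hu i).
rewrite sumEFin lee_fin -mulr_sumr ler_wpM2l//.
rewrite -[X in (_ <= X)%R]mul1r ler_pdivlMr ?subr_gt0//.
have := subrX1 r n; rewrite -opprB -[X in (_ = X * _)%R]opprB mulNr => /oppr_inj H.
by rewrite mulrC -H gerBl exprn_ge0.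
Qed.

End GoodPaths.

Section ExistsIncrements.
Local Open Scope ereal_scope.
Context {R : realType}.
Local Notation Om := (measurableTypeR R).

(* [is_brownian_motion] asks for continuity of every path, so an exceptional null
   set has to be removed without changing any law. *)
Lemma redirect_to_full_measure d (T : measurableType d) (P : probability T R) (N : set T) :
  measurable N -> P N = 0 -> exists r : T -> T, [/\ measurable_fun setT r,
    forall w, ~ N (r w) & forall A, measurable A -> P (r @^-1` A) = P A].
Proof.
move=> mN PN.
have [w0 Nw0] : exists w0, ~ N w0.
  apply: contrapT => /forallNP h; have : P N = P setT.
    by congr (P _); apply/seteqP; split => // w _; apply: contrapT; exact: h.
  by rewrite PN probability_setT => /eqP; rewrite eq_sym onee_eq0.
pose r w := if w \in N then w0 else w.
have rE A : r @^-1` A = (A `&` ~` N) `|` ([set w | N w /\ A w0]).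
  apply/seteqP; split => w; rewrite /r /=; case: ifPn => [|].
  - by rewrite in_setE; right.
  - by rewrite notin_setE; left.
  - by rewrite in_setE => Nw [[_]|[]].
  - by rewrite notin_setE => Nw [[]|[]].
have mr : measurable_fun setT r.
  move=> _ A mA; rewrite setTI rE; apply: measurableU.
    by apply: measurableI => //; exact: measurableC.
  have [Aw|Aw] := pselect (A w0).
    by rewrite (_ : [set _ | _] = N)//; apply/seteqP; split => // w [].
  by rewrite (_ : [set _ | _] = set0)//; apply/seteqP; split => // w [].
exists r; split => //.
  by move=> w; rewrite /r; case: ifPn; rewrite ?in_setE ?notin_setE.
move=> A mA; have mrA : measurable (r @^-1` A) by rewrite -[_ @^-1` _]setTI; exact: mr.
have PC B : measurable B -> P B = P (B `&` ~` N).
  move=> mB; rewrite -[in LHS](setIT B) -(setvU N) setIUr measureU.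
  - rewrite [X in _ + X](_ : _ = 0) ?adde0//.
    apply/eqP; rewrite eq_le measure_ge0 andbT -PN.
    by apply: le_measure; rewrite ?inE//; exact: measurableI.
  - by apply: measurableI => //; exact: measurableC.
  - exact: measurableI.
  - by rewrite setIACA setICl setI0.
rewrite PC// [RHS]PC//; congr (P _); apply/seteqP; split => w [];
  rewrite /r /= => + Nw; by rewrite memNset.
Qed.

Lemma exists_dyadic_increments : exists d (T : measurableType d) (P : probability T R)
    (D : nat -> nat -> T -> R),
  [/\ forall n k, measurable_fun setT (D n k),
      forall n k w, D n k w = (D n.+1 k.*2 w + D n.+1 k.*2.+1 w)%R,
      forall n N (A : nat -> set R), (forall k, measurable (A k)) ->
        P [set w | forall k, (k < N)%N -> A k (D n k w)] =
        (\prod_(k < N) fine (Nv 0%R (lvar n) (A k)))%:E &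
      forall w, \forall n \near \oo, forall k, (k < 4 ^ n)%N ->
        (`|D n k w| <= modulus n)%R].
Proof.
have [q hq] := choice (fun n => exists_quantile (Nv 0%R (@noise_var R n))).
pose U : Om -> Om := @evenpart R; pose V : Om -> Om := @oddpart R.
have mU : measurable_fun setT U := measurable_evenpart.
have mV : measurable_fun setT V := measurable_oddpart.
have mq n : measurable_fun setT (q n : Om -> R) := (hq n).1.
have lq n := (hq n).2.
pose P := [the probability Om R of uniform_prob (@ltr01 R)].
have sUV := @uniform_parts R.
pose D : nat -> nat -> Om -> R := delta U V q.
have mD n k : measurable_fun setT (D n k) by exact: measurable_delta.
have iD n N (A : nat -> set R) : (forall k, measurable (A k)) ->
    P [set w | forall k, (k < N)%N -> A k (D n k w)] =
    (\prod_(k < N) fine (Nv 0%R (lvar n) (A k)))%:E.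
  move=> mA; have := indep_delta mU mV sUV mq lq n N mA measurableT.
  by rewrite preimage_setT setIT probability_setT mule1.
have lD n k (A : set R) : measurable A -> P (D n k @^-1` A) = Nv 0%R (lvar n) A.
  move=> mA; pose A' j := if j == k then A else setT.
  have := iD n k.+1 A'.
  rewrite (_ : [set w | _] = D n k @^-1` A); last first.
    apply/seteqP; split => w /=; first by move=> /(_ k (ltnSn k)); rewrite /A' eqxx.
    by move=> Aw j jk; rewrite /A'; case: eqVneq => // ->.
  move=> ->; last by move=> j; rewrite /A'; case: ifP.
  rewrite big_ord_recr /= big1 ?mul1r; last first.
    move=> i _; rewrite /A' (ltn_eqF (ltn_ord i)).
    have nT : Nv 0%R (@lvar R n) setT = 1 by exact: probability_setT.
    by rewrite nT.
  rewrite /A' eqxx fineK//.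
  by apply: (fin_num_measure (Nv 0%R (@lvar R n))); exact: mA.
pose F n := [set w | exists k, (k < 4 ^ n)%N /\ (@modulus R n < `|D n k w|)%R].
have mtail n : measurable [set x : R | @modulus R n < `|x|]%R.
  by apply: measurable_gt_set; exact: normr_measurable.
have FE n : F n = \big[setU/set0]_(k < (4 ^ n)%N) (D n k @^-1` [set x : R | @modulus R n < `|x|]%R).
  rewrite -(bigcup_mkord _ (fun k => D n k @^-1` [set x : R | @modulus R n < `|x|]%R));
    apply/seteqP; split => [w [k [kn h]]|w [k kn h]]; exists k => //.
have mF n : measurable (F n).
  by rewrite FE; apply: bigsetU_measurable => k _; apply: measurable_preimage.
have PF n : P (F n) <= (432 * (125 / 128) ^+ n)%:E.
  apply: le_trans (normal_modulus_tail n); rewrite FE.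
  apply: (@le_trans _ _ (\sum_(k < (4 ^ n)%N) P (D n k @^-1` [set x : R | @modulus R n < `|x|]%R))).
    by apply: (Boole_inequality P (A := fun k => D n k @^-1` _)) => k _; exact: measurable_preimage.
  pose x := Nv 0%R (lvar n) [set x : R | @modulus R n < `|x|]%R.
  have xE : (fine x)%:E = x.
    by rewrite fineK//; exact: (fin_num_measure (Nv 0%R (lvar n)) _ (mtail n)).
  rewrite (eq_bigr (fun=> (fine x)%:E)); last first.
    by move=> k _; rewrite xE; exact: lD.
  by rewrite sumEFin sumr_const card_ord -(mulr_natl (fine x)) EFinM xE.
(* Borel-Cantelli: almost surely only finitely many levels violate the modulus. *)
have N0 : P (lim_sup_set F) = 0.
  apply: lim_sup_set_cvg0 => //; apply: (@geometric_nneseries_lty _ 432 (125 / 128)).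
  - exact: ler0n.
  - lra.
  - by move=> n; rewrite measure_ge0 PF.
have mN : measurable (lim_sup_set F).
  apply: bigcapT_measurable => n; exact: bigcup_measurable.
have [r [mr Nr lr]] := redirect_to_full_measure mN N0.
exists _, Om, P, (fun n k w => D n k (r w)); split.
- by move=> n k; exact: measurableT_comp (mD n k) mr.
- by move=> n k w; exact: delta_split.
- move=> n N A mA; rewrite -iD// -[RHS]lr//.
  apply: (@measurable_forall_lt _ Om N (fun k => D n k @^-1` A k)) => k.
  exact: measurable_preimage.
- move=> w; have /existsNP[n /not_implyP[_ nF]] := Nr w.
  exists n => // j nj k kj; rewrite leNgt; apply/negP => h; apply: nF.
  by exists j => //; exists k.
Qed.

End ExistsIncrements.

(** * Continuous paths from dyadic increments *)

Section DyadicPath.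
Context {R : realType}.
Variable D : nat -> nat -> R.
Hypothesis Dsplit : forall n k, D n k = D n.+1 k.*2 + D n.+1 k.*2.+1.
Hypothesis Dsmall : \forall n \near \oo, forall k, (k < 4 ^ n)%N -> `|D n k| <= modulus n.

(** The number of complete level-n intervals in [0, t]; truncation makes it 0 for negative t. *)
Definition grid_index (n : nat) (t : R) : nat := Num.truncn ((2 ^ n)%:R * t).

Definition partial_sum (n N : nat) : R := \sum_(k < N) D n k.

Definition grid_approx (t : R) (n : nat) : R := partial_sum n (grid_index n t).

Definition dyadic_path (t : R) : R := limn (grid_approx t).

Lemma partial_sum_double n N : partial_sum n.+1 N.*2 = partial_sum n N.
Proof.
rewrite /partial_sum; elim: N => [|N IH]; first by rewrite !big_ord0.
by rewrite doubleS !big_ord_recr /= IH (Dsplit n N) addrA.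
Qed.

Lemma grid_indexS n t : (grid_index n.+1 t)./2 = grid_index n t.
Proof. by rewrite /grid_index expnS natrM -mulrA -divn2 truncn_mul_div. Qed.

(** Refining the grid doubles the index up to a last binary digit, and a coarse sum equals the fine
    sum over twice as many terms. Hence at most one fine increment is added. *)
Lemma approxS_le n t : (grid_index n.+1 t < 4 ^ n.+1)%N ->
  (forall k, (k < 4 ^ n.+1)%N -> `|D n.+1 k| <= modulus n.+1) ->
  `|grid_approx t n.+1 - grid_approx t n| <= modulus n.+1.
Proof.
move=> gn hD; rewrite /grid_approx; have := odd_double_half (grid_index n.+1 t).
rewrite grid_indexS -(partial_sum_double n); case: (odd _) => /= gE.
  rewrite -gE add1n. rewrite /partial_sum [X in X - _]big_ord_recr /= addrAC subrr add0r; apply: hD.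
  by rewrite (leq_ltn_trans _ gn)// -gE leq_addl.
by rewrite -gE add0n subrr normr0 ltW// modulus_gt0.
Qed.

Lemma grid_index_lt n (t : R) : t < (2 ^ n)%:R -> (grid_index n t < 4 ^ n)%N.
Proof.
move=> tn; have [t0|t0] := lerP 0 t.
  rewrite /grid_index truncn_lt_nat ?mulr_ge0// (_ : 4 ^ n = 2 ^ n * 2 ^ n)%N;
    last by rewrite -expnMn.
  by rewrite natrM ltr_pM2l// ltr0n expn_gt0.
rewrite /grid_index (_ : Num.truncn _ = 0%N) ?expn_gt0//; apply/truncn0Pn.
by rewrite -ltNge (lt_trans _ ltr01)// pmulr_rlt0// ltr0n expn_gt0.
Qed.

Lemma modulusS n : modulus n.+1 = 9 / 10 * modulus n :> R.
Proof. by rewrite /modulus exprS. Qed.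

Lemma cvg_modulus : (@modulus R) @ \oo --> (0 : R).
Proof. by apply: cvg_expr; rewrite ger0_norm ?divr_ge0// ltr_pdivrMr//; lra. Qed.

Let good (n0 : nat) := forall n, (n0 <= n)%N -> forall k, (k < 4 ^ n)%N -> `|D n k| <= modulus n.

Let good_exists : exists n0, good n0.
Proof. by have [n0 _ h] := Dsmall; exists n0. Qed.

(** The factor 9 is r / (1 - r) for r = 9/10: the moduli of levels n + 1 to n + j add up exactly to
    the right-hand side. *)
Lemma approx_cauchy n0 t : good n0 -> t < (2 ^ n0)%:R ->
  forall n j, (n0 <= n)%N -> `|grid_approx t (n + j) - grid_approx t n| <= 9 * (modulus n -
    modulus (n + j)).
Proof.
move=> g0 tn0 n j nn0; elim: j => [|j IH].
  by rewrite addn0 !subrr normr0 mulr0.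
have -> : grid_approx t (n + j.+1) - grid_approx t n =
  (grid_approx t (n + j).+1 - grid_approx t (n + j)) + (grid_approx t (n + j) - grid_approx t n).
  by rewrite addnS addrA subrK.
rewrite (le_trans (ler_normD _ _))//.
have h : `|grid_approx t (n + j).+1 - grid_approx t (n + j)| <= modulus (n + j).+1.
  apply: approxS_le; last by apply: g0; rewrite (leq_trans nn0)// -addnS leq_addr.
  apply: grid_index_lt; rewrite (lt_le_trans tn0)// ler_nat leq_exp2l//.
  by rewrite (leq_trans nn0)// -addnS leq_addr.
apply: (le_trans (lerD h IH)); rewrite addnS modulusS; lra.
Qed.

Lemma path_approx n0 t : good n0 -> t < (2 ^ n0)%:R ->
  grid_approx t @ \oo --> dyadic_path t /\
  forall n, (n0 <= n)%N -> `|dyadic_path t - grid_approx t n| <= 9 * modulus n.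
Proof.
move=> g0 tn0; have hc := approx_cauchy g0 tn0.
have cv : cvgn (grid_approx t).
  apply: cauchy_cvg; apply/cauchy_ballP => e e0.
  have [n1 _ h1] : \forall n \near \oo, 9 * modulus n < e / 2.
    have c9 : (fun n => 9 * modulus n : R) @ \oo --> (0 : R).
      by rewrite -[X in _ --> X](mulr0 9); apply: cvgMr; exact: cvg_modulus.
    by apply: (cvgr_lt 0 c9); rewrite divr_gt0.
  pose N := maxn n0 n1.
  have hN m : (N <= m)%N -> `|grid_approx t m - grid_approx t N| < e / 2.
    move=> Nm; rewrite -(subnKC Nm) (le_lt_trans (hc _ _ (leq_maxl _ _)))//.
    rewrite (le_lt_trans _ (h1 N (leq_maxr _ _)))// ler_wpM2l// gerBl.
    exact/ltW/modulus_gt0.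
  exists ([set grid_approx t m | m in [set m | (N <= m)%N]], [set grid_approx t m | m in [set m |
    (N <= m)%N]]).
    by split; exists N => // m Nm; exists m.
  move=> [_ _] [[a Na <-] [b Nb <-]] /=.
  rewrite /ball /= -(subrKA (grid_approx t N)) (le_lt_trans (ler_normD _ _))//.
  by rewrite (splitr e) ltrD ?hN// distrC hN.
split; first exact: cv.
move=> n nn0; have c1 : (fun j => `|grid_approx t (j + n) - grid_approx t n|) @ \oo -->
  `|dyadic_path t - grid_approx t n|.
  apply: cvg_norm; apply: cvgB; last exact: cvg_cst.
  by rewrite (cvg_shiftn n (grid_approx t)).
rewrite -(cvg_lim _ c1)//; apply: limr_le; first by apply/cvg_ex; eexists; exact: c1.
apply: nearW => j; rewrite addnC (le_trans (hc _ _ nn0))// ler_wpM2l// gerBl.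
exact/ltW/modulus_gt0.
Qed.

Lemma natr_exp2_lt (x : R) : exists n0, x < (2 ^ n0)%:R.
Proof.
exists (Num.truncn x).+1; apply: (lt_le_trans (truncnS_gt x)).
by rewrite ler_nat ltnW// ltn_expl.
Qed.

Lemma good_bound (x : R) : exists2 n0, good n0 & x < (2 ^ n0)%:R.
Proof.
have [n1 g1] := good_exists; have [n2 h2] := natr_exp2_lt x.
exists (maxn n1 n2).
  by move=> n /(leq_trans (leq_maxl _ _)); exact: g1.
by rewrite (lt_le_trans h2)// ler_nat leq_exp2l// leq_maxr.
Qed.

Lemma approx_cvg t : grid_approx t @ \oo --> dyadic_path t.
Proof. by have [n0 g0 tn0] := good_bound t; have [] := path_approx g0 tn0. Qed.

(** The increment straddling t tends to 0, so sums that include it have the same limit. They serve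
    to write increments of the path after t without touching the straddling interval. *)
Lemma approx_next_cvg t :
  (fun n => partial_sum n (grid_index n t).+1) @ \oo --> dyadic_path t.
Proof.
have [n0 g0 tn0] := good_bound t.
rewrite -[X in _ --> X]addr0.
have -> : (fun n => partial_sum n (grid_index n t).+1) =
    (fun n => grid_approx t n + D n (grid_index n t)).
  by apply/funext => n; rewrite /partial_sum big_ord_recr.
apply: cvgD; first exact: approx_cvg.
apply/norm_cvg0P.
apply: (@squeeze_cvgr _ _ _ _ (fun=> 0) (@modulus R)); [|exact: cvg_cst|exact: cvg_modulus].
exists n0 => // n nn0 /=; rewrite normr_ge0/=; apply: (g0 _ nn0); apply: grid_index_lt.
by rewrite (lt_le_trans tn0)// ler_nat leq_exp2l.
Qed.

Lemma grid_index_nd n (s t : R) : s <= t -> (grid_index n s <= grid_index n t)%N.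
Proof. by move=> st; apply: le_truncn; rewrite ler_wpM2l. Qed.

Lemma grid_index_close n (s t : R) : s <= t -> t - s < (2 ^ n)%:R^-1 ->
  (grid_index n t <= (grid_index n s).+1)%N.
Proof.
move=> st ts; have p0 : 0 < (2 ^ n)%:R :> R by rewrite ltr0n expn_gt0.
rewrite leqNgt /grid_index truncn_gt_nat -ltNge.
have : (2 ^ n)%:R * t < (2 ^ n)%:R * s + 1.
  by rewrite -ltrBlDl -mulrBr mulrC -ltr_pdivlMr// mul1r.
move=> /lt_le_trans; apply; rewrite -[in leRHS]natr1 lerD2r; exact/ltW/truncnS_gt.
Qed.

(** 19 = 9 + 1 + 9: two errors of approximation by grid sums, and at most one increment between the
    grid sums of times closer than one cell. *)
Lemma path_modulus n0 n (s t : R) : good n0 -> (n0 <= n)%N -> s <= t -> t < (2 ^ n0)%:R ->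
  t - s < (2 ^ n)%:R^-1 -> `|dyadic_path t - dyadic_path s| <= 19 * modulus n.
Proof.
move=> g0 nn0 st tn0 ts.
have [_ ht] := path_approx g0 tn0; have [_ hs] := path_approx g0 (le_lt_trans st tn0).
have hts : `|grid_approx t n - grid_approx s n| <= modulus n.
  have : (grid_index n t = grid_index n s) \/ (grid_index n t = (grid_index n s).+1).
    have := grid_index_close st ts; rewrite leq_eqVlt ltnS => /orP[/eqP|] h; first by right.
    by left; apply/eqP; rewrite eqn_leq h grid_index_nd.
  rewrite /grid_approx => -[->|->]; first by rewrite subrr normr0 ltW// modulus_gt0.
  rewrite /partial_sum [X in X - _]big_ord_recr /= addrAC subrr add0r; apply: (g0 _ nn0).
  apply: grid_index_lt; rewrite (le_lt_trans st)// (lt_le_trans tn0)// ler_nat leq_exp2l//.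
have -> : dyadic_path t - dyadic_path s = (dyadic_path t - grid_approx t n) + (grid_approx t n -
  grid_approx s n) - (dyadic_path s - grid_approx s n).
  by rewrite -!addrA; ring.
apply: (le_trans (ler_normB _ _)); apply: (le_trans (lerD (ler_normD _ _) (lexx _))).
have := lerD (lerD (ht n nn0) hts) (hs n nn0); move=> /le_trans; apply; lra.
Qed.

Lemma dyadic_path_continuous : continuous dyadic_path.
Proof.
(* The margin 1 keeps the nearby times s within the range controlled from level [n0] on. *)
move=> t; have [n0 g0 tn0] := good_bound (t + 1).
apply/cvgrPdist_lt => e e0.
have [n1 _ h1] : \forall n \near \oo, 19 * modulus n < e.
  have c9 : (fun n => 19 * modulus n : R) @ \oo --> (0 : R).
    by rewrite -[X in _ --> X](mulr0 19); apply: cvgMr; exact: cvg_modulus.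
  exact: (cvgr_lt 0 c9).
pose n := maxn n0 n1.
have p0 : 0 < (2 ^ n)%:R^-1 :> R by rewrite invr_gt0 ltr0n expn_gt0.
have one0 : 0 < 1 :> R by [].
near=> s.
have ts : `|t - s| < (2 ^ n)%:R^-1 by near: s; exact: cvgr_dist_lt.
have s1 : s < (2 ^ n0)%:R.
  rewrite (lt_trans _ tn0)// -ltrBlDl (le_lt_trans (ler_norm _))// distrC.
have t1 : t < (2 ^ n0)%:R by rewrite (lt_trans _ tn0)// ltrDl.
rewrite (le_lt_trans _ (h1 n (leq_maxr _ _)))//.
have [st|ts'] := lerP s t.
  by apply: (path_modulus g0 (leq_maxl _ _) st t1); rewrite (le_lt_trans (ler_norm _)).
rewrite distrC; apply: (path_modulus g0 (leq_maxl _ _) (ltW ts') s1).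
by rewrite (le_lt_trans (ler_norm _))// distrC.
Unshelve. all: by end_near. Qed.

End DyadicPath.

(** * Affine images of normal laws *)

Section Affine.
Local Open Scope ereal_scope.
Context {R : realType}.
Local Notation mu := (@lebesgue_measure R).
Local Notation Om := (measurableTypeR R).

Lemma lebesgue_measureM (c : R) (A : set R) : c != 0%R -> measurable A ->
  mu A = `|c|%:E * pushforward mu (fun x : Om => c * x : Om)%R A.
Proof.
move=> c0 mA.
have mM : measurable_fun setT (fun x : Om => c * x : Om)%R by exact: mulrl_measurable.
pose nu_ := [the {measure set Om -> \bar R} of pushforward mu (fun x : Om => c * x : Om)%R].
pose nu := nu_ mM.
pose m2 := [the {measure set Om -> \bar R} of mscale (NngNum (normr_ge0 c)) nu].
suff : mu A = m2 A by [].
apply: lebesgue_measure_unique => //= _ [[a b]] _ <-.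
rewrite /m2 /= /mscale /= /nu /nu_ /= /pushforward.
have [cp|cn] := ltP 0%R c.
  rewrite (_ : _ @^-1` _ = `]a / c, b / c]%classic)%R; last first.
    by apply/seteqP; split => x /=; rewrite !in_itv/= ltr_pdivrMr// ler_pdivlMr// (mulrC x).
  rewrite !lebesgue_measure_itv/= !lte_fin ltr_pM2r ?invr_gt0//.
  case: ifPn => _; rewrite ?mule0// gtr0_norm// -!EFinB -EFinM -mulrBl mulrCA mulfV// mulr1//.
have {}cn : (c < 0)%R by rewrite lt_neqAle c0.
rewrite (_ : _ @^-1` _ = `[b / c, a / c[%classic)%R; last first.
  by apply/seteqP; split => x /=; rewrite !in_itv/= ltr_ndivlMr// ler_ndivrMr// (mulrC x) andbC.
rewrite !lebesgue_measure_itv/= !lte_fin ltr_nM2r ?invr_lt0//.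
case: ifPn => _; rewrite ?mule0// ltr0_norm// -!EFinB -EFinM -mulrBl.
by rewrite mulNr mulrCA mulfV// mulr1 opprB.
Qed.

Lemma ge0_integral_dilation (f : R -> \bar R) (c : R) : c != 0%R ->
  measurable_fun setT f -> (forall x, 0 <= f x) ->
  \int[mu]_x f x = `|c|%:E * \int[mu]_x f (c * x)%R.
Proof.
move=> c0 mf f0.
have mM : measurable_fun setT (fun x : Om => c * x : Om)%R by exact: mulrl_measurable.
pose nu_ := [the {measure set Om -> \bar R} of pushforward mu (fun x : Om => c * x : Om)%R].
pose nu := nu_ mM.
transitivity (\int[mscale (NngNum (normr_ge0 c)) nu]_x f x).
  by apply: eq_measure_integral => /= A mA _; exact: lebesgue_measureM.
rewrite ge0_integral_mscale//; congr (_ * _).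
by rewrite ge0_integral_pushforward.
Qed.

Lemma normal_prob_affine (m v c y : R) (A : set R) : c != 0%R -> (0 < v)%R ->
  measurable A ->
  Nv m v [set x | A (c * x + y)%R] = Nv (c * m + y)%R (c ^+ 2 * v)%R A.
Proof.
move=> c0 v0 mA; rewrite !normal_probE.
pose g x := (\1_A x * normal_pdf (c * m + y) (Num.sqrt (c ^+ 2 * v)) x)%:E.
have mg : measurable_fun setT g.
  by apply/measurable_EFinP/measurable_funM; [exact: measurable_indic|exact: measurable_normal_pdf].
have g0 x : 0 <= g x by rewrite lee_fin mulr_ge0// normal_pdf_ge0.
have mgy : measurable_fun setT (fun x : R => g (x + y)%R).
  by apply: (measurableT_comp mg); apply: measurable_funD => //; exact: measurable_cst.
have c2 : (0 < c ^+ 2)%R by rewrite exprn_even_gt0.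
transitivity (`|c|%:E * \int[mu]_x g (c * x + y)%R); last first.
  have E := ge0_integral_dilation c0 mgy (fun x => g0 (x + y)%R).
  exact: (etrans (esym E) (ge0_integral_translation y mg g0)).
rewrite -ge0_integralZl//; last first.
  by apply: (measurableT_comp mgy); exact: mulrl_measurable.
apply: eq_integral => x _; rewrite /g -EFinM; congr EFin.
rewrite (_ : \1_[set x | A (c * x + y)%R] x = \1_A (c * x + y)%R)%R; last first.
  by rewrite !indicE; congr (nat_of_bool _)%:R; apply/idP/idP; rewrite !in_setE.
rewrite mulrCA; congr (_ * _)%R;
  rewrite (normal_pdf_sqrtE _ _ v0) (normal_pdf_sqrtE _ _ (mulr_gt0 c2 v0)) mulrA.
congr (_ * expR _)%R.
  have -> : (c ^+ 2 * v * pi *+ 2 = c ^+ 2 * (v * pi *+ 2))%R by rewrite -mulrA mulrnAr.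
  by rewrite sqrtrM ?sqr_ge0// sqrtr_sqr invfM mulrA mulfV ?normr_eq0// mul1r.
by field; rewrite c0 gt_eqF.
Qed.

End Affine.

Section BorelCoordinates.
Context {R : realType}.

Lemma mem_bigsetU_ord T k (F : 'I_k -> set T) x :
  (\big[setU/set0]_(i < k) F i) x <-> exists i, F i x.
Proof.
split=> [|[i Fi]]; last by rewrite (bigD1 i)//=; left.
by apply: (big_ind (fun S : set T => S x -> exists i, F i x)) => //[S S' hS hS' []//|i _ Fi];
  exists i.
Qed.

Lemma borel_coord k (i : 'I_k) (A : set R) : measurable A ->
  borel [set x : 'cV[R]_k | A (x i 0)].
Proof.
move=> mA; apply: sub_sigma_algebra; apply/mem_bigsetU_ord; exists i.
by exists A => //; rewrite setTI.
Qed.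

End BorelCoordinates.

(** * Measurability relative to a sub-sigma-algebra *)

Section SubSigmaMeasurable.
Context {R : realType} {T : pointedType}.
Implicit Types (F : set (set T)) (f g : T -> R).

(** Filtrations are families of bare sets of events, so measurability is stated on preimages;
    [g_sigma_algebraType] then turns such a family into a measurable space on which the usual
    closure results apply. *)
Definition smeasurable F f : Prop := forall A, measurable A -> F (f @^-1` A).

Lemma smeasurableP F f : sigma_algebra setT F ->
  smeasurable F f <->
  measurable_fun (setT : set (g_sigma_algebraType F)) (f : g_sigma_algebraType F -> R).
Proof.
move=> sF; have FE : <<s F >> = F := sigma_algebra_id sF; split => [mf _ A mA|mf A mA].
  by rewrite setTI /measurable/= FE; exact: mf.
by have := mf measurableT A mA; rewrite setTI /measurable/= FE.
Qed.

Lemma smeasurable_sub F F' f : F `<=` F' -> smeasurable F f -> smeasurable F' f.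
Proof. by move=> FF mf A mA; exact/FF/mf. Qed.

Variable F : set (set T).
Hypothesis sF : sigma_algebra setT F.

Lemma smeasurable_cst (c : R) : smeasurable F (fun=> c).
Proof. by apply/(smeasurableP _ sF); exact: measurable_cst. Qed.

Lemma smeasurableD f g : smeasurable F f -> smeasurable F g ->
  smeasurable F (fun w => f w + g w).
Proof.
move=> /(smeasurableP _ sF) mf /(smeasurableP _ sF) mg.
by apply/(smeasurableP _ sF); exact: measurable_funD.
Qed.

Lemma smeasurableZ (c : R) f : smeasurable F f -> smeasurable F (fun w => c * f w).
Proof.
move=> /(smeasurableP _ sF) mf; apply/(smeasurableP _ sF).
by apply: measurable_funM => //; exact: measurable_cst.
Qed.

Lemma smeasurable_sum I (s : seq I) (P : pred I) (f : I -> T -> R) :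
  (forall i, P i -> smeasurable F (f i)) ->
  smeasurable F (fun w => \sum_(i <- s | P i) f i w).
Proof.
move=> mf; elim: s => [|i s IH].
  rewrite (_ : (fun w => _) = fun=> 0); first exact: smeasurable_cst.
  by apply/funext => w; rewrite big_nil.
have [Pi|Pi] := boolP (P i); last first.
  rewrite (_ : (fun w => _) = fun w => \sum_(i <- s | P i) f i w)//.
  by apply/funext => w; rewrite big_cons (negbTE Pi).
rewrite (_ : (fun w => _) = fun w => f i w + \sum_(i <- s | P i) f i w).
  by apply: smeasurableD => //; exact: mf.
by apply/funext => w; rewrite big_cons Pi.
Qed.

Lemma smeasurable_sum_nat (a b : nat) (f : nat -> T -> R) :
  (forall k, (a <= k < b)%N -> smeasurable F (f k)) ->
  smeasurable F (fun w => \sum_(a <= k < b) f k w).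
Proof.
move=> mf; rewrite (_ : (fun w => _) =
    fun w => \sum_(k <- index_iota a b | (a <= k < b)%N) f k w).
  exact: smeasurable_sum.
by apply/funext => w; rewrite big_seq_cond [RHS]big_seq_cond; apply: eq_bigl => k;
  rewrite mem_index_iota andbT andbb.
Qed.

Lemma smeasurable_lim (f : nat -> T -> R) g : (forall n, smeasurable F (f n)) ->
  (forall w, f ^~ w @ \oo --> g w) -> smeasurable F g.
Proof.
move=> mf fg; apply/(smeasurableP _ sF).
apply: (@measurable_fun_cvg _ (g_sigma_algebraType F) R setT f); last by move=> w _.
by move=> n; apply/(smeasurableP _ sF).
Qed.

(** The coordinates generate the Borel sets, and the sets with preimage in [F] form a sigma-algebra.
    Adaptedness of vector processes is reduced to real coordinates by this equivalence. *)
Lemma smeasurable_cV k (X : T -> 'cV[R]_k) :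
  (forall i, smeasurable F (fun w => X w i 0)) <->
  (forall B, borel B -> F (X @^-1` B)).
Proof.
split=> [mX|mX i A mA]; last exact: (mX _ (borel_coord i mA)).
move=> B; suff : @borel R k `<=` [set C | F (X @^-1` C)] by apply.
apply: smallest_sub.
  have -> : [set C | F (X @^-1` C)] = image_set_system setT X F.
    by apply/funext => C; rewrite /image_set_system /= setTI.
  exact: sigma_algebra_image.
move=> C /mem_bigsetU_ord [i [A mA <-]].
by have := mX i A mA; rewrite setTI.
Qed.

End SubSigmaMeasurable.

Section VectorLimits.
Context {R : realType}.

Lemma cvg_cV T (F : set_system T) {FF : Filter F} k (X : T -> 'cV[R]_k) (l : 'cV[R]_k) :
  (forall i, (fun t => X t i 0) @ F --> l i 0) -> X @ F --> l.
Proof.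
move=> h A [P lP PA]; rewrite /nbhs /=.
have : \forall t \near F, forall ij : 'I_k * 'I_1, P ij.1 ij.2 (X t ij.1 ij.2).
  apply: filter_forall => -[i j] /=; have := h i; rewrite -(ord1 j) => hi.
  exact: hi (lP i j).
by apply: filterS => t Xt; apply: PA => i j; exact: (Xt (i, j)).
Qed.

Lemma cvg_cV_coord T (F : set_system T) {FF : Filter F} k (X : T -> 'cV[R]_k) (l : 'cV[R]_k) i :
  X @ F --> l -> (fun t => X t i 0) @ F --> l i 0.
Proof. by move=> Xl; apply: (cvg_comp X (fun M : 'cV[R]_k => M i 0) Xl);
  exact: coord_continuous. Qed.

Lemma cvg_sumr T (F : set_system T) {FF : Filter F} I (s : seq I) (f : I -> T -> R) (l : I -> R) :
  (forall i, f i @ F --> l i) ->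
  (fun t => \sum_(i <- s) f i t) @ F --> \sum_(i <- s) l i.
Proof.
move=> h; elim: s => [|i s IH].
  rewrite big_nil (_ : (fun t => _) = fun=> 0); first exact: cvg_cst.
  by apply/funext => t; rewrite big_nil.
rewrite big_cons (_ : (fun t => _) = fun t => f i t + \sum_(i <- s) f i t).
  by apply: cvgD.
by apply/funext => t; rewrite big_cons.
Qed.

Lemma cvg_mulmx T (F : set_system T) {FF : Filter F} k l (A : 'M[R]_(l, k))
    (X : T -> 'cV[R]_k) (x : 'cV[R]_k) :
  X @ F --> x -> (fun t => A *m X t) @ F --> A *m x.
Proof.
move=> Xx; apply: cvg_cV => i; rewrite mxE (_ : (fun t => _) = fun t => \sum_j A i j * X t j 0).
  by apply: (cvg_sumr (f := fun j t => A i j * X t j 0)) => j;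
    have h := @cvg_cV_coord _ _ FF _ _ _ j Xx; exact: cvgMr h.
by apply/funext => t; rewrite mxE.
Qed.

Definition cadlag k (f : R -> 'cV[R]_k) : Prop :=
  (forall t, 0 <= t -> f s @[s --> t^'+] --> f t) /\
  (forall t, 0 < t -> exists l : 'cV[R]_k, f s @[s --> t^'-] --> l).

Lemma within_continuous_cadlag k (f : R -> 'cV[R]_k) :
  {within [set t : R | 0 <= t], continuous f} -> cadlag f.
Proof.
move=> /subspace_continuousP cf; split => [t t0|t t0].
  apply: cvg_trans (cf t t0); apply: cvg_app => A hA.
  suff : nbhs t [set s | t < s -> A s] by [].
  apply: (@filterS _ _ _ [set s | 0 <= s -> A s]) hA => s /= As ts; apply: As.
  by rewrite (le_trans t0)// ltW.
exists (f t); apply: cvg_trans (cf t (ltW t0)); apply: cvg_app => A hA.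
suff : nbhs t [set s | s < t -> A s] by [].
apply: (@filterS2 _ _ _ [set s | 0 <= s -> A s] [set s | 0 < s]) hA (lt_nbhsr t0) => s /= As s0 _.
by apply: As; exact: ltW.
Qed.

Lemma cadlagD k (f g : R -> 'cV[R]_k) : cadlag f -> cadlag g ->
  cadlag (fun t => f t + g t).
Proof.
move=> [f1 f2] [g1 g2]; split => [t t0|t t0]; first exact: (cvgD (f1 t t0) (g1 t t0)).
have [[l fl] [l' gl]] := (f2 t t0, g2 t t0).
by exists (l + l'); exact: (cvgD fl gl).
Qed.

Lemma cadlag_mulmx k l (A : 'M[R]_(l, k)) (f : R -> 'cV[R]_k) : cadlag f ->
  cadlag (fun t => A *m f t).
Proof.
move=> [f1 f2]; split => [t t0|t t0]; first by apply: cvg_mulmx; exact: (f1 t t0).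
by have [x fx] := f2 t t0; exists (A *m x); apply: cvg_mulmx.
Qed.

End VectorLimits.

(** * Past and future on the dyadic grids *)

Section IncrementSigmaAlgebras.
Local Open Scope ereal_scope.
Context {R : realType} d (T : measurableType d) (P : probability T R).
Local Notation Om := (measurableTypeR R).
Variable D : nat -> nat -> T -> R.
Hypothesis mD : forall n k, measurable_fun setT (D n k).
Hypothesis Dsplit : forall n k w, D n k w = (D n.+1 k.*2 w + D n.+1 k.*2.+1 w)%R.
Hypothesis Dlaw : forall n N (A : nat -> set R), (forall k, measurable (A k)) ->
  P [set w | forall k, (k < N)%N -> A k (D n k w)] =
  (\prod_(k < N) fine (Nv 0%R (lvar n) (A k)))%:E.

Definition rect n N (A : nat -> set R) : set T :=
  [set w | forall k, (k < N)%N -> A k (D n k w)].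

Lemma measurable_rect n N A : (forall k, measurable (A k)) -> measurable (rect n N A).
Proof.
move=> mA; apply: (@measurable_forall_lt _ T N (fun k => D n k @^-1` A k)) => k.
exact: measurable_preimage.
Qed.

Let maskl N (A : nat -> set R) k : set R := if (k < N)%N then A k else setT.

Let rect_mask n N K A : (N <= K)%N -> rect n N A = rect n K (maskl N A).
Proof.
move=> NK; apply/seteqP; split => w H k kN.
  by rewrite /maskl; case: ifPn => // h; exact: H.
by have := H k (leq_trans kN NK); rewrite /maskl kN.
Qed.

Let measurable_mask N A : (forall k, measurable (A k)) -> forall k, measurable (maskl N A k).
Proof. by move=> mA k; rewrite /maskl; case: ifP. Qed.

Definition past_rects n N : set (set T) :=
  [set E | exists2 A, (forall k, measurable (A k)) & E = rect n N A].

(** The starting index is imposed by [setT] below [N] rather than by a range of indices, so that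
    past and future sets are rectangles of one shape and intersect as such; the length [M] is
    arbitrary. *)
Definition future_rects n N : set (set T) :=
  [set E | exists M A, [/\ forall k, measurable (A k),
     forall k, (k < N)%N -> A k = setT & E = rect n M A]].

Definition past n N := <<s past_rects n N >>.
Definition future n N := <<s future_rects n N >>.

Lemma past_rects_measurable n N : past_rects n N `<=` measurable.
Proof. by move=> _ [A mA ->]; exact: measurable_rect. Qed.

Lemma future_rects_measurable n N : future_rects n N `<=` measurable.
Proof. by move=> _ [M [A [mA _ ->]]]; exact: measurable_rect. Qed.

Lemma past_rects_setI n N : setI_closed (past_rects n N).
Proof.
move=> _ _ [A mA ->] [B mB ->]; exists (fun k => A k `&` B k).
  by move=> k; exact: measurableI.
apply/seteqP; split => w; first by move=> [HA HB] k kN; split; [exact: HA|exact: HB].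
by move=> H; split => k kN; have [] := H k kN.
Qed.

Lemma future_rects_setI n N : setI_closed (future_rects n N).
Proof.
move=> _ _ [M [A [mA AT ->]]] [M' [B [mB BT ->]]].
exists (maxn M M'), (fun k => maskl M A k `&` maskl M' B k); split.
- by move=> k; apply: measurableI; exact: measurable_mask.
- by move=> k kN; rewrite /maskl AT// BT// !if_same setIT.
rewrite (rect_mask _ _ (leq_maxl M M')) (rect_mask _ _ (leq_maxr M M')).
apply/seteqP; split => w; first by move=> [HA HB] k kN; split; [exact: HA|exact: HB].
by move=> H; split => k kN; have [] := H k kN.
Qed.

Let NvT n : fine (Nv 0%R (@lvar R n) setT) = 1%R.
Proof.
have E : Nv 0%R (@lvar R n) setT = 1 by exact: probability_setT.
by rewrite E.
Qed.

(** The law of a rectangle is a product over k, and each increment is constrained by at most one of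
    the two rectangles, so the product separates. Both are first padded to a common length. *)
Lemma indep_past_future_level n N N' : (N <= N')%N ->
  indep_families P (past n N) (future n N').
Proof.
move=> NN; apply: indep_generated.
- exact: past_rects_measurable.
- exact: future_rects_measurable.
- exact: past_rects_setI.
- exact: future_rects_setI.
move=> _ _ [A mA ->] [M [B [mB BT ->]]].
pose K := maxn N M.
rewrite (rect_mask n A (leq_maxl N M : (N <= K)%N)) (rect_mask n B (leq_maxr N M : (M <= K)%N)).
have mA' := measurable_mask N mA; have mB' := measurable_mask M mB.
have -> : rect n K (maskl N A) `&` rect n K (maskl M B) = rect n K (fun k => maskl N A k `&`
  maskl M B k).
  apply/seteqP; split => w; first by move=> [HA HB] k kN; split; [exact: HA|exact: HB].
  by move=> H; split => k kN; have [] := H k kN.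
rewrite !Dlaw//; last by move=> k; exact: measurableI.
rewrite -EFinM -big_split/=; congr EFin; apply: eq_bigr => k _.
rewrite /maskl; case: ifPn => kN.
  have -> : (if (k < M)%N then B k else setT) = setT.
    by rewrite BT ?if_same// (leq_trans kN).
  by rewrite setIT NvT mulr1.
by rewrite setTI NvT mul1r.
Qed.

Lemma past_coord n N k : (k < N)%N -> smeasurable (past n N) (D n k).
Proof.
move=> kN A mA; apply: sub_sigma_algebra.
exists (fun j => if j == k then A else setT); first by move=> j; case: ifP.
apply/seteqP; split => w /=; first by move=> Aw j _; case: eqVneq => // ->.
by move=> /(_ k kN); rewrite eqxx.
Qed.

Lemma future_coord n N k : (N <= k)%N -> smeasurable (future n N) (D n k).
Proof.
move=> kN A mA; apply: sub_sigma_algebra.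
exists k.+1, (fun j => if j == k then A else setT); split.
- by move=> j; case: ifP.
- by move=> j jN; rewrite ltn_eqF// (leq_trans jN).
apply/seteqP; split => w /=; first by move=> Aw j _; case: eqVneq => // ->.
by move=> /(_ k (ltnSn k)); rewrite eqxx.
Qed.

Lemma sigma_past n N : sigma_algebra setT (past n N).
Proof. exact: smallest_sigma_algebra. Qed.

Lemma sigma_future n N : sigma_algebra setT (future n N).
Proof. exact: smallest_sigma_algebra. Qed.

Lemma past_sub (F : set (set T)) n N : sigma_algebra setT F ->
  (forall k, (k < N)%N -> smeasurable F (D n k)) -> past n N `<=` F.
Proof.
move=> sF mF; apply: smallest_sub => // _ [A mA ->].
have [F0 FC FU] := sF.
have FE : <<s F >> = F := sigma_algebra_id sF.
have := @measurable_forall_lt _ (g_sigma_algebraType F) N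
  (fun k => if (k < N)%N then D n k @^-1` A k else setT).
rewrite /measurable /= FE (_ : [set w | _] = rect n N A); last first.
  apply/seteqP; split => w /= H k kN; last by rewrite kN; exact: H.
  by have := H k kN; rewrite kN.
apply => k; case: ifPn => kN; first exact: mF.
by have := FC _ F0; rewrite setD0.
Qed.

Lemma future_sub (F : set (set T)) n N : sigma_algebra setT F ->
  (forall k, (N <= k)%N -> smeasurable F (D n k)) -> future n N `<=` F.
Proof.
move=> sF mF; apply: smallest_sub => // _ [M [A [mA AT ->]]].
have [F0 FC FU] := sF.
have FE : <<s F >> = F := sigma_algebra_id sF.
have := @measurable_forall_lt _ (g_sigma_algebraType F) M (fun k => D n k @^-1` A k).
rewrite /measurable /= FE; apply => k.
have [Nk|kN] := leqP N k; first exact: mF.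
by rewrite AT// preimage_setT; have := FC _ F0; rewrite setD0.
Qed.

Let Dsplit_fun n k : D n k = fun w => (D n.+1 k.*2 w + D n.+1 k.*2.+1 w)%R.
Proof. by apply/funext => w; exact: Dsplit. Qed.

Lemma past_step n N N' : (N.*2 <= N')%N -> past n N `<=` past n.+1 N'.
Proof.
move=> NN; apply: past_sub; first exact: sigma_past.
move=> k kN; rewrite Dsplit_fun; have kN' : (k.*2.+1 < N')%N.
  by rewrite (leq_trans _ NN)// ltn_Sdouble.
by apply: (smeasurableD (@sigma_past _ _)); apply: past_coord => //; exact: ltnW.
Qed.

Lemma future_step n N N' : (N' <= N.*2)%N -> future n N `<=` future n.+1 N'.
Proof.
move=> NN; apply: future_sub; first exact: sigma_future.
move=> k kN; rewrite Dsplit_fun; have kN' : (N' <= k.*2)%N.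
  by rewrite (leq_trans NN)// leq_double.
by apply: (smeasurableD (@sigma_future _ _)); apply: future_coord => //; exact: leqW.
Qed.

(** Coarse increments are sums of fine ones. The pasts of t thus increase with the level, which
    makes their union a pi-system. *)
Lemma past_grid_mono (t : R) n m : (n <= m)%N ->
  past n (grid_index n t) `<=` past m (grid_index m t).
Proof.
move=> /subnKC <-; elim: (m - n)%N => [|j IH]; first by rewrite addn0.
apply: subset_trans IH _; rewrite addnS; apply: past_step.
by rewrite -(grid_indexS (n + j) t) -[leqRHS]odd_double_half leq_addl.
Qed.

Lemma future_grid_mono (t : R) n m : (n <= m)%N ->
  future n (grid_index n t).+1 `<=` future m (grid_index m t).+1.
Proof.
move=> /subnKC <-; elim: (m - n)%N => [|j IH]; first by rewrite addn0.
apply: subset_trans IH _; rewrite addnS; apply: future_step.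
rewrite -(grid_indexS (n + j) t) doubleS -[in leqLHS](odd_double_half (grid_index (n + j).+1 t)).
by case: (odd _); rewrite ?add1n ?add0n.
Qed.

(* The dyadic increment straddling t belongs to neither side; it vanishes in the
   limit. *)
Definition dyadic_past (t : R) : set (set T) := [set A | exists n, past n (grid_index n t) A].
Definition dyadic_future (t : R) : set (set T) := [set A | exists n, future n (grid_index n t).+1
  A].

Lemma past_measurable n N : past n N `<=` measurable.
Proof. exact/g_sigma_sub_measurable/past_rects_measurable. Qed.

Lemma future_measurable n N : future n N `<=` measurable.
Proof. exact/g_sigma_sub_measurable/future_rects_measurable. Qed.

Lemma sigma_algebra_setI (F : set (set T)) A B : sigma_algebra setT F -> F A -> F B -> F (A `&` B).
Proof.
move=> sF FA FB; have FE : <<s F >> = F := sigma_algebra_id sF.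
have := @measurableI _ (g_sigma_algebraType F) A B.
by rewrite /measurable /= FE; exact.
Qed.

(** Both unions over levels are directed, hence pi-systems, and two events can be compared at the
    finer of their two levels. *)
Lemma indep_dyadic_past_future t :
  indep_families P <<s dyadic_past t >> <<s dyadic_future t >>.
Proof.
apply: indep_generated.
- by move=> A [n /past_measurable].
- by move=> A [n /future_measurable].
- move=> A B [n nA] [m mB]; exists (maxn n m).
  apply: (@sigma_algebra_setI (past _ _)); first exact: sigma_past.
    exact: past_grid_mono (leq_maxl n m) _ nA.
  exact: past_grid_mono (leq_maxr n m) _ mB.
- move=> A B [n nA] [m mB]; exists (maxn n m).
  apply: (@sigma_algebra_setI (future _ _)); first exact: sigma_future.
    exact: future_grid_mono (leq_maxl n m) _ nA.
  exact: future_grid_mono (leq_maxr n m) _ mB.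
move=> A B [n nA] [m mB].
apply: (@indep_past_future_level (maxn n m) _ _ (leqnSn (grid_index (maxn n m) t))).
  exact: past_grid_mono (leq_maxl n m) _ nA.
exact: future_grid_mono (leq_maxr n m) _ mB.
Qed.

Lemma coord_law n k (A : set R) : measurable A -> P (D n k @^-1` A) = Nv 0%R (lvar n) A.
Proof.
move=> mA; have := @Dlaw n k.+1 (fun j => if j == k then A else setT).
rewrite (_ : [set w | _] = D n k @^-1` A); last first.
  apply/seteqP; split => w /=; first by move=> /(_ k (ltnSn k)); rewrite eqxx.
  by move=> Aw j _; case: eqVneq => // ->.
move=> ->; last by move=> j; case: ifP.
rewrite big_ord_recr /= big1 ?mul1r; last first.
  by move=> j _; rewrite (ltn_eqF (ltn_ord j)) NvT.
rewrite eqxx fineK//.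
by apply: (fin_num_measure (Nv 0%R (@lvar R n))); exact: mA.
Qed.

(** Blocks have r + 1 >= 1 increments: an empty block would have variance 0, where [normal_prob] is
    not the law of the zero variable. *)
Lemma block_law n i r (A : set R) : measurable A ->
  P [set w | A (\sum_(i <= k < i + r.+1) D n k w)%R] = Nv 0%R (r.+1%:R * lvar n)%R A.
Proof.
elim: r A => [|r IH] A mA.
  rewrite mul1r -(coord_law n i mA)//; congr (P _); apply/seteqP; split => w /=;
    by rewrite addn1 big_nat1.
pose X w := (\sum_(i <= k < i + r.+1) D n k w)%R; pose Y := D n (i + r.+1)%N.
have mX : measurable_fun setT X by apply: measurable_sum => k; exact: mD.
have sX : smeasurable (past n (i + r.+1)) X.
  apply: (smeasurable_sum_nat (@sigma_past _ _)) => k /andP[_ kir]; exact: past_coord.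
have sY : smeasurable (future n (i + r.+1)) Y by exact: future_coord.
pose S := [set z : R * R | A (z.1 + z.2)%R].
have mS : measurable S.
  rewrite -[S]setTI; exact: (measurable_funD measurable_fst measurable_snd).
have := @pair_law _ T R P _ Om _ Om (Nv 0%R (r.+1%:R * lvar n)%R) (Nv 0%R (lvar n)) X Y setT 1
  mX (mD _ _) measurableT ler01 _ S mS.
rewrite setIT mule1 (_ : _ @^-1` S = [set w | A (\sum_(i <= k < i + r.+2) D n k w)%R]); last first.
  apply/seteqP; split => w; rewrite /S /X /Y /=.
    by rewrite (addnS i r.+1) big_nat_recr//= leq_addr.
  by rewrite (addnS i r.+1) big_nat_recr//= leq_addr.
move=> ->.
  have rv0 : (0 < r.+1%:R * @lvar R n)%R by rewrite mulr_gt0// lvar_gt0.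
  rewrite (normal_prob_conv 0%R 0%R rv0 (lvar_gt0 n) mA) addr0.
  by rewrite -[X in (_ + X)%R]mul1r -mulrDl natr1.
move=> A0 B0 mA0 mB0; rewrite setIT mule1.
rewrite (indep_past_future_level (leqnn _) (sX _ mA0) (sY _ mB0)); congr (_ * _).
  exact: IH.
exact: coord_law.
Qed.

End IncrementSigmaAlgebras.

(** * The scalar Brownian motion *)

Section ScalarBrownianMotion.
Local Open Scope ereal_scope.
Context {R : realType} d (T : measurableType d) (P : probability T R).
Local Notation Om := (measurableTypeR R).
Variable D : nat -> nat -> T -> R.
Hypothesis mD : forall n k, measurable_fun setT (D n k).
Hypothesis Dsplit : forall n k w, D n k w = (D n.+1 k.*2 w + D n.+1 k.*2.+1 w)%R.
Hypothesis Dlaw : forall n N (A : nat -> set R), (forall k, measurable (A k)) ->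
  P [set w | forall k, (k < N)%N -> A k (D n k w)] =
  (\prod_(k < N) fine (Nv 0%R (lvar n) (A k)))%:E.
Hypothesis Dsmall : forall w, \forall n \near \oo, forall k, (k < 4 ^ n)%N ->
  (`|D n k w| <= modulus n)%R.

Definition brownian_path (t : R) (w : T) : R := dyadic_path (fun n k => D n k w) t.

Local Notation B := brownian_path.

Lemma partial_sumB (E : nat -> nat -> R) n a b : (a <= b)%N ->
  (partial_sum E n b - partial_sum E n a = \sum_(a <= k < b) E n k)%R.
Proof.
move=> ab; rewrite /partial_sum -!(big_mkord xpredT) (big_cat_nat (leq0n a) ab)/=.
by rewrite addrAC subrr add0r.
Qed.

Lemma brownian_path_past (s t : R) : (s <= t)%R -> smeasurable <<s dyadic_past D t >> (B s).
Proof.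
move=> st; have sF : sigma_algebra setT <<s dyadic_past D t >> by exact: smallest_sigma_algebra.
apply: (smeasurable_lim sF (f := fun n w => \sum_(0 <= k < grid_index n s) D n k w)%R) => [n|w].
  apply: (@smeasurable_sub _ _ (past D n (grid_index n t))).
    by move=> A pA; apply: sub_sigma_algebra; exists n.
  apply: (smeasurable_sum_nat (@sigma_past _ _ _ D _ _)) => k /andP[_ ks]; apply: past_coord.
  by rewrite (leq_trans ks)// grid_index_nd.
have := @approx_cvg R (fun n k => D n k w) (fun n k => Dsplit n k w) (Dsmall w) s.
rewrite (_ : grid_approx _ _ = fun n => \sum_(0 <= k < grid_index n s) D n k w)%R//.
by apply/funext => n; rewrite big_mkord.
Qed.

(** The approximating sums start one cell after the grid index of u, hence at or beyond the first
    grid point after t; including the straddling cell at v instead changes nothing in the limit. *)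
Lemma brownian_increment_future (t u v : R) : (t <= u)%R -> (u <= v)%R ->
  smeasurable <<s dyadic_future D t >> (fun w => B v w - B u w)%R.
Proof.
move=> tu uv; have sF : sigma_algebra setT <<s dyadic_future D t >> by exact:
  smallest_sigma_algebra.
apply: (smeasurable_lim sF (f := fun n w =>
  \sum_((grid_index n u).+1 <= k < (grid_index n v).+1) D n k w)%R) => [n|w].
  apply: (@smeasurable_sub _ _ (future D n (grid_index n t).+1)).
    by move=> A pA; apply: sub_sigma_algebra; exists n.
  apply: (smeasurable_sum_nat (@sigma_future _ _ _ D _ _)) => k /andP[uk _]; apply: future_coord.
  by rewrite (leq_trans _ uk)// ltnS grid_index_nd.
rewrite [X in X @ _ --> _](_ : _ = fun n =>
    (partial_sum (fun n k => D n k w) n (grid_index n v).+1 -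
     partial_sum (fun n k => D n k w) n (grid_index n u).+1)%R); last first.
  by apply/funext => n; rewrite partial_sumB// ltnS grid_index_nd.
by apply: cvgB; apply: approx_next_cvg.
Qed.

Lemma measurable_brownian_path t : measurable_fun setT (B t).
Proof.
have sub : <<s dyadic_past D t >> `<=` measurable.
  by apply: g_sigma_sub_measurable => A [n /(past_measurable mD)].
by move=> _ A mA; rewrite setTI; apply: sub; exact: brownian_path_past.
Qed.

Lemma brownian_path0 w : B 0%R w = 0%R.
Proof.
rewrite /brownian_path /dyadic_path (_ : grid_approx _ _ = fun=> 0%R).
  by rewrite lim_cst.
by apply/funext => n; rewrite /grid_approx /partial_sum /grid_index mulr0 truncn0 big_ord0.
Qed.

Lemma grid_index_cvg (t : R) : (0 <= t)%R ->
  ((grid_index n t)%:R * lvar n)%R @[n --> \oo] --> t.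
Proof.
move=> t0; rewrite [X in X @ _ --> _](_ : _ = dyadic_floor ^~ t); last first.
  apply/funext => n; rewrite /dyadic_floor /lvar; congr (_ * _)%R.
  by rewrite exprVn -natrX.
exact: dyadic_floor_cvg.
Qed.

Lemma brownian_increment_law (s t : R) (A : set R) : (0 <= s)%R -> (s < t)%R ->
  measurable A -> P [set w | A (B t w - B s w)%R] = Nv 0%R (t - s)%R A.
Proof.
move=> s0 st mA; have t0 : (0 <= t)%R by rewrite (le_trans s0)// ltW.
pose gap n := (grid_index n t - grid_index n s)%N.
have gap_cvg : ((gap n)%:R * lvar n)%R @[n --> \oo] --> (t - s)%R.
  rewrite (_ : (fun n => _) = fun n => ((grid_index n t)%:R * lvar n - (grid_index n s)%:R * lvar
    n)%R).
    by apply: cvgB; exact: grid_index_cvg.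
  by apply/funext => n; rewrite /gap natrB ?mulrBl// grid_index_nd// ltW.
(* At coarse levels s and t may share a cell, leaving an empty block of variance 0; the sequence is
   therefore started at a level where the gap is positive. *)
have [n0 _ gap0] : \forall n \near \oo, (0 < (gap n)%:R * @lvar R n)%R.
  by apply: (cvgr_gt _ gap_cvg); rewrite subr_gt0.
pose X n w := (\sum_(grid_index (n + n0) s <= k < grid_index (n + n0) t) D (n + n0) k w)%R.
apply: (@normal_limit R _ T P X (fun w => B t w - B s w)%R 0%R (t - s)%R
  (fun n => (gap (n + n0))%:R * lvar (n + n0))%R) => //.
- by move=> n; apply: measurable_sum => k; exact: mD.
- by apply: measurable_funB; exact: measurable_brownian_path.
- move=> w.
  rewrite [X in X @ _ --> _](_ : _ = fun n =>
      (grid_approx (fun n k => D n k w) t (n + n0)%N -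
       grid_approx (fun n k => D n k w) s (n + n0)%N)%R); last first.
    apply/funext => n; rewrite /grid_approx partial_sumB//.
    by rewrite grid_index_nd// ltW.
  rewrite (cvg_shiftn n0 (fun n => grid_approx (fun n k => D n k w) t n -
    grid_approx (fun n k => D n k w) s n)%R).
  by apply: cvgB; apply: approx_cvg.
- by move=> n; apply: gap0; exact: leq_addl.
- by rewrite subr_gt0.
- by rewrite (cvg_shiftn n0 (fun n => (gap n)%:R * lvar n)%R).
- move=> n C mC.
  have g0 : (0 < gap (n + n0))%N.
    have := gap0 (n + n0)%N (leq_addl _ _).
    by rewrite lt0n; apply: contraPN => /eqP ->; rewrite mul0r ltxx.
  rewrite -(prednK g0) -(block_law mD Dlaw _ (grid_index (n + n0) s)) //.
  rewrite prednK// /gap subnKC//; last by rewrite grid_index_nd// ltW.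
Qed.

Definition natural_filtration (t : R) : set (set T) :=
  <<s [set E | exists s A, [/\ (0 <= s <= t)%R, measurable A & E = B s @^-1` A]] >>.

Lemma natural_filtration_sub_past t : natural_filtration t `<=` <<s dyadic_past D t >>.
Proof.
apply: smallest_sub; first exact: smallest_sigma_algebra.
by move=> _ [s [A [/andP[_ st] mA ->]]]; exact: brownian_path_past.
Qed.

Lemma is_filtration_natural : is_filtration natural_filtration.
Proof.
split=> [t t0|s t s0 st].
  split; first exact: smallest_sigma_algebra.
  apply: g_sigma_sub_measurable => _ [s [A [_ mA ->]]].
  by rewrite -[X in measurable X]setTI; exact: measurable_brownian_path.
apply: sub_sigma_algebra2 => _ [r [A [/andP[r0 rs] mA ->]]].
by exists r, A; split => //; rewrite r0 (le_trans rs).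
Qed.

Definition brownian_cV (t : R) (w : T) : 'cV[R]_1 := const_mx (B t w).

Lemma brownian_cV_coord t w i : brownian_cV t w i 0%R = B t w.
Proof. by rewrite mxE. Qed.

Lemma sym_posdef1 : sym_posdef (1%:M : 'M[R]_1).
Proof.
split; first by rewrite trmx1.
move=> x x0; rewrite /dot mul1mx mxE big_ord1 mxE -expr2 exprn_even_gt0//=.
apply: contraNN x0 => /eqP x0; apply/eqP/matrixP => i j.
by rewrite !ord1 x0 mxE.
Qed.

Lemma is_brownian_motion1 :
  is_brownian_motion P natural_filtration (0 : 'cV[R]_1) 1%:M 0 brownian_cV.
Proof.
have cB w : continuous (B ^~ w) by apply: dyadic_path_continuous.
have cX w : {within [set t : R | (0 <= t)%R], continuous (fun t => brownian_cV t w)}.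
  apply: continuous_subspaceT => t; apply: cvg_cV => i.
  under eq_fun do rewrite brownian_cV_coord.
  by rewrite brownian_cV_coord; exact: cB.
have sub t : (0 <= t)%R -> forall C, borel C -> natural_filtration t (brownian_cV t @^-1` C).
  move=> t0; apply/(smeasurable_cV (@smallest_sigma_algebra _ _ _)) => i A mA.
  apply: sub_sigma_algebra; exists t, A; split => //; first by rewrite t0 lexx.
  by apply/seteqP; split => w /=; rewrite brownian_cV_coord.
split.
- exact: sym_posdef1.
- split; last exact: sub.
  split; first by move=> t t0 C bC; apply: (is_filtration_natural.1 t t0).2; exact: sub.
  by move=> w; exact: within_continuous_cadlag.
- exact: cX.
- by apply: aeW => w; apply/matrixP => i j; rewrite !mxE brownian_path0.
- move=> s t s0 st a A a0 mA.
  have a00 : a 0%R 0%R != 0%R.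
    apply: contraNN a0 => /eqP a0; apply/eqP/matrixP => i j.
    by rewrite !ord1 a0 mxE.
  have dotE w : dot a (brownian_cV t w - brownian_cV s w) = (a 0 0 * (B t w - B s w) + 0)%R.
    by rewrite /dot mxE big_ord1 !mxE addr0.
  rewrite (_ : _ @^-1` A = [set w | [set x | A (a 0 0 * x + 0)%R] (B t w - B s w)%R]); last first.
    by apply/seteqP; split => w /=; rewrite dotE.
  have mA' : measurable [set x : R | A (a 0 0 * x + 0)%R].
    rewrite -[X in measurable X]setTI.
    have mf : measurable_fun setT (fun x : R => a 0 0 * x + 0)%R.
      by apply: measurable_funD; [exact: mulrl_measurable|exact: measurable_cst].
    exact: mf.
  have ts0 : (0 < t - s)%R by rewrite subr_gt0.
  rewrite (brownian_increment_law s0 st mA') (normal_prob_affine 0 0 a00 ts0 mA).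
  have -> : dot a ((t - s) *: 0) = (a 0 0 * 0 + 0)%R.
    by rewrite /dot scaler0 mulmx0 mxE mulr0 addr0.
  have -> // : dot a ((t - s) *: 1%:M *m a) = (a 0 0 ^+ 2 * (t - s))%R.
  by rewrite /dot -scalemxAl mul1mx mxE big_ord1 !mxE mulrCA mulrC -expr2.
- move=> t t0 A C FA IC.
  apply: (indep_dyadic_past_future mD Dsplit Dlaw (natural_filtration_sub_past FA)).
  move: C IC; apply: smallest_sub; first exact: smallest_sigma_algebra.
  move=> _ [u [v [C [tu uv bC ->]]]].
  move: C bC; apply/(smeasurable_cV (@smallest_sigma_algebra _ _ _)) => i A' mA'.
  rewrite (_ : _ @^-1` _ = (fun w => B v w - B u w)%R @^-1` A').
    exact: brownian_increment_future.
  by apply/seteqP; split => w /=; rewrite !mxE.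
Qed.

End ScalarBrownianMotion.

Lemma exists_brownian_motion1 (R : realType) :
  exists (d : measure_display) (T : measurableType d) (P : probability T R)
    (F : R -> set (set T)) (X : process T 1),
    is_filtration F /\ is_brownian_motion P F (0 : 'cV[R]_1) 1%:M 0 X.
Proof.
have [d [T [P [D [mD Dsplit Dlaw Dsmall]]]]] := @exists_dyadic_increments R.
exists d, T, P, (natural_filtration D), (brownian_cV D); split.
  exact: is_filtration_natural.
exact: is_brownian_motion1.
Qed.

(** * Brownian motion in R^k *)

Section DotProduct.
Context {R : realType}.

Lemma dot0v k (x : 'cV[R]_k) : dot 0 x = 0.
Proof. by rewrite /dot trmx0 mul0mx mxE. Qed.

Lemma dotv0 k (x : 'cV[R]_k) : dot x 0 = 0.
Proof. by rewrite /dot mulmx0 mxE. Qed.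

Lemma dotDr k (x y z : 'cV[R]_k) : dot x (y + z) = dot x y + dot x z.
Proof. by rewrite /dot mulmxDr mxE. Qed.

Lemma dotZr k (c : R) (x y : 'cV[R]_k) : dot x (c *: y) = c * dot x y.
Proof. by rewrite /dot -scalemxAr mxE. Qed.

Lemma dot_mulmxr k l (x : 'cV[R]_k) (A : 'M[R]_(k, l)) (y : 'cV[R]_l) :
  dot x (A *m y) = dot (A^T *m x) y.
Proof. by rewrite /dot trmx_mul trmxK mulmxA. Qed.

Lemma dotE k (x y : 'cV[R]_k) : dot x y = \sum_i x i 0 * y i 0.
Proof. by rewrite /dot mxE; apply: eq_bigr => i _; rewrite mxE. Qed.

Lemma dot_quadr k l (a : 'cV[R]_k) (C : 'M[R]_(k, l)) (G : 'M[R]_l) :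
  dot a (C *m G *m C^T *m a) = dot (C^T *m a) (G *m (C^T *m a)).
Proof. by rewrite -!mulmxA dot_mulmxr. Qed.

End DotProduct.

(** * Sigma-algebras, independence and null sets on a product *)

Section ProductSpace.
Local Open Scope ereal_scope.
Context {R : realType} d (L : measurableType d) (Q : probability L R).
Context d' (L' : measurableType d') (Q' : probability L' R).
Local Notation Om := (measurableTypeR R).

(** [prod_filtration] at a fixed time has this form; the separate name also serves the
    sigma-algebras generated by increments. *)
Definition rect_sigma (F : set (set L)) (F' : set (set L')) : set (set (L * L')) :=
  <<s [set A `*` B | A in F & B in F'] >>.

Lemma rect_sigma_fst F F' (f : L -> R) : sigma_algebra setT F' ->
  smeasurable F f -> smeasurable (rect_sigma F F') (f \o fst).
Proof.
move=> sF' mf A mA; apply: sub_sigma_algebra; exists (f @^-1` A); first exact: mf.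
have [F'0 F'C _] := sF'; exists setT; first by rewrite -(setD0 setT); exact: F'C.
by apply/seteqP; split => -[x y]/= //; case.
Qed.

Lemma rect_sigma_snd F F' (f : L' -> R) : sigma_algebra setT F ->
  smeasurable F' f -> smeasurable (rect_sigma F F') (f \o snd).
Proof.
move=> sF mf A mA; apply: sub_sigma_algebra.
have [F0 FC _] := sF; exists setT; first by rewrite -(setD0 setT); exact: FC.
exists (f @^-1` A); first exact: mf.
by apply/seteqP; split => -[x y]/= //; case.
Qed.

Let rects_measurable (F : set (set L)) (F' : set (set L')) :
  F `<=` measurable -> F' `<=` measurable ->
  [set A `*` B | A in F & B in F'] `<=` measurable.
Proof. by move=> mF mF' _ [A FA [B FB <-]]; apply: measurableX; [exact: mF|exact: mF']. Qed.

Lemma rect_sigma_measurable F F' : F `<=` measurable -> F' `<=` measurable ->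
  rect_sigma F F' `<=` measurable.
Proof. by move=> mF mF'; apply: g_sigma_sub_measurable; exact: rects_measurable. Qed.

Lemma is_filtration_prod (F : R -> set (set L)) (F' : R -> set (set L')) :
  is_filtration F -> is_filtration F' -> is_filtration (prod_filtration F F').
Proof.
move=> [sF iF] [sF' iF']; split=> [t t0|s t s0 st].
  split; first exact: smallest_sigma_algebra.
  by apply: rect_sigma_measurable; [exact: (sF t t0).2|exact: (sF' t t0).2].
apply: sub_sigma_algebra2 => _ [A FA [B FB <-]].
by exists A; [exact: iF FA|exists B => //; exact: iF' FB].
Qed.

(** On rectangles, the product measure and the independence in each factor split the probability
    into four factors, which can be regrouped; rectangles are a pi-system. *)
Lemma indep_rect_sigma (F E : set (set L)) (F' E' : set (set L')) :
  sigma_algebra setT F -> sigma_algebra setT E ->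
  sigma_algebra setT F' -> sigma_algebra setT E' ->
  F `<=` measurable -> E `<=` measurable -> F' `<=` measurable -> E' `<=` measurable ->
  indep_families Q F E -> indep_families Q' F' E' ->
  indep_families (Q \x Q') (rect_sigma F F') (rect_sigma E E').
Proof.
move=> sF sE sF' sE' mF mE mF' mE' QI QI'.
have pi (S : set (set L)) (S' : set (set L')) : sigma_algebra setT S ->
    sigma_algebra setT S' -> setI_closed [set A `*` B | A in S & B in S'].
  move=> sS sS' _ _ [A SA [A' SA' <-]] [B SB [B' SB' <-]].
  exists (A `&` B); first exact: sigma_algebra_setI.
  by exists (A' `&` B'); [exact: sigma_algebra_setI|rewrite setXI].
apply: indep_generated; [exact: rects_measurable|exact: rects_measurable|exact: pi|exact: pi|].
move=> _ _ [A FA [A' FA' <-]] [B EB [B' EB' <-]].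
have [mA mB mA' mB'] := And4 (mF _ FA) (mE _ EB) (mF' _ FA') (mE' _ EB').
have E1 (S : set L) (S' : set L') : measurable S -> measurable S' ->
    (Q \x Q') (S `*` S') = Q S * Q' S' by exact: product_measure1E.
rewrite -setXI; transitivity (Q (A `&` B) * Q' (A' `&` B')).
  by apply: E1; exact: measurableI.
transitivity (Q A * Q' A' * (Q B * Q' B')); first by rewrite QI// QI'// muleACA.
by congr (_ * _); apply/esym; exact: E1.
Qed.

Lemma ae_fst (S : set L) : {ae Q, forall w, S w} -> {ae (Q \x Q'), forall w, S w.1}.
Proof.
move=> [N [mN QN0 SN]]; exists (N `*` setT); split.
- exact: measurableX.
- transitivity (Q N * Q' setT); first by apply: product_measure1E; [exact: mN|exact: measurableT].
  by rewrite [Q N]QN0 mul0e.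
- by move=> [x y] /= /SN.
Qed.

Lemma ae_snd (S : set L') : {ae Q', forall w, S w} -> {ae (Q \x Q'), forall w, S w.2}.
Proof.
move=> [N [mN QN0 SN]]; exists (setT `*` N); split.
- exact: measurableX.
- transitivity (Q setT * Q' N); first by apply: product_measure1E; [exact: measurableT|exact: mN].
  by rewrite [Q' N]QN0 mule0.
- by move=> [x y] /= /SN.
Qed.

End ProductSpace.

Section AffineGaussian.
Local Open Scope ereal_scope.
Context {R : realType}.
Local Notation Om := (measurableTypeR R).

Lemma normal_prob_shift (m v c : R) (A : set R) : (0 < v)%R -> measurable A ->
  Nv m v [set x | A (x + c)%R] = Nv (m + c)%R v A.
Proof.
move=> v0 mA; have := @normal_prob_affine R m v 1 c A (oner_neq0 _) v0 mA.
rewrite mul1r expr1n mul1r => <-; congr (normal_prob _ _ _).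
by apply/seteqP; split => x /=; rewrite mul1r.
Qed.

(* [normal_prob _ 0] is not a point mass, hence the disjunction; the degenerate case
   does occur below, when [C^T *m a] or [D^T *m a] vanishes. *)
Definition gaussian d (L : measurableType d) (Q : probability L R) (f : L -> R) (m v : R) :=
  measurable_fun setT f /\
  (((0 < v)%R /\ forall A, measurable A -> Q (f @^-1` A) = Nv m v A) \/
   (v = 0%R /\ forall w, f w = m)).

Lemma gaussian_sum d (L : measurableType d) (Q : probability L R)
    d' (L' : measurableType d') (Q' : probability L' R) f f' (m m' v v' c : R) A :
  gaussian Q f m v -> gaussian Q' f' m' v' -> (0 < v + v')%R -> measurable A ->
  (Q \x Q') [set w | A (f w.1 + f' w.2 + c)%R] = Nv (m + m' + c)%R (v + v')%R A.
Proof.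
move=> [mf hf] [mf' hf'] vv mA.
have mshift (S : set R) (y : R) : measurable S -> measurable [set x : R | S (x + y)%R].
  move=> mS; rewrite -[X in measurable X]setTI.
  have mg : measurable_fun setT (fun x : R => x + y)%R.
    by apply: measurable_funD => //; exact: measurable_cst.
  exact: mg.
have E1 (S : set L) (S' : set L') : measurable S -> measurable S' ->
    (Q \x Q') (S `*` S') = Q S * Q' S' by exact: product_measure1E.
have QT : Q setT = 1 := probability_setT Q.
have QT' : Q' setT = 1 := probability_setT Q'.
have mpre (S : set R) : measurable S -> measurable (f @^-1` S).
  by move=> mS; rewrite -[X in measurable X]setTI; exact: mf.
have mpre' (S : set R) : measurable S -> measurable (f' @^-1` S).
  by move=> mS; rewrite -[X in measurable X]setTI; exact: mf'.
case: hf => -[v0 hf]; case: hf' => -[v'0 hf'].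
- pose S := [set z : R * R | A (z.1 + z.2 + c)%R].
  have mS : measurable S.
    rewrite -[S]setTI; exact: (measurable_funD measurable_fst measurable_snd measurableT (mshift
      A c mA)).
  have rect (B B' : set R) : measurable B -> measurable B' ->
    (Q \x Q')%E ((f \o fst) @^-1` B `&` (f' \o snd) @^-1` B' `&` setT) =
    Nv m v B * Nv m' v' B' * 1%:E.
    move=> mB mB'; rewrite setIT mule1 -(hf _ mB) -(hf' _ mB').
    by apply: E1; [exact: mpre|exact: mpre'].
  have := @pair_law _ (L * L')%type R (Q \x Q')%E _ Om _ Om (Nv m v) (Nv m' v')
    (f \o fst) (f' \o snd) setT 1 (measurableT_comp mf measurable_fst)
    (measurableT_comp mf' measurable_snd) measurableT ler01 rect S mS.
  rewrite setIT mule1 => ->.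
  rewrite -(normal_prob_shift _ c vv mA).
  exact: (normal_prob_conv m m' v0 v'0 (mshift A c mA)).
(* One summand is constant: the event depends on the other factor alone, and the constant only
   shifts the mean. *)
- rewrite v'0 addr0 -(normal_prob_shift _ c v0 mA) -(normal_prob_shift _ m' v0 (mshift A c mA)) -hf.
    rewrite (_ : [set w | _] = (f @^-1` [set x | A (x + m' + c)%R]) `*` setT); last first.
      by apply/seteqP; split => -[x y]/=; rewrite hf'//; case.
    by rewrite [LHS]E1 ?QT' ?mule1//; apply: mpre; exact: (mshift _ m' (mshift A c mA)).
  exact: (mshift _ m' (mshift A c mA)).
- rewrite v0 add0r (addrC m) -(normal_prob_shift _ c v'0 mA) -(normal_prob_shift _ m v'0 (mshift
  A c mA)) -hf'.
    rewrite (_ : [set w | _] = setT `*` (f' @^-1` [set x | A (x + m + c)%R])); last first.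
      by apply/seteqP; split => -[x y]/=; rewrite hf (addrC m)//; case.
    by rewrite [LHS]E1 ?QT ?mul1e//; apply: mpre'; exact: (mshift _ m (mshift A c mA)).
  exact: (mshift _ m (mshift A c mA)).
- by move: vv; rewrite v0 v'0 addr0 ltxx.
Qed.

End AffineGaussian.

(** * Affine combinations of independent Brownian motions *)

Section BrownianSum.
Context {R : realType} d (L : measurableType d) (Q : probability L R).
Context d' (L' : measurableType d') (Q' : probability L' R).
Variables (F : R -> set (set L)) (F' : R -> set (set L')).
Hypotheses (isF : is_filtration F) (isF' : is_filtration F').
Variables (k l n : nat) (mu x : 'cV[R]_k) (Gam : 'M[R]_k) (chi : @process R L k).
Variables (nu x' : 'cV[R]_l) (Xi : 'M[R]_l) (beta : @process R L' l).
Hypothesis chiB : is_brownian_motion Q F mu Gam x chi.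
Hypothesis betaB : is_brownian_motion Q' F' nu Xi x' beta.
Variables (C : 'M[R]_(n, k)) (D : 'M[R]_(n, l)) (y g : 'cV[R]_n).
Let V := (C *m Gam *m C^T + D *m Xi *m D^T).
Hypothesis Vpos : sym_posdef V.

(** The terms [y] and [t *: g] adjust starting point and drift. They build a motion with given
    statistics from centred ones, and vanish when [chi] is lifted. *)
Definition brownian_sum : @process R (L * L')%type n :=
  fun t w => (C *m chi t w.1 + D *m beta t w.2 + y + t *: g).

Local Notation X := brownian_sum.

Lemma brownian_sum_increment s t w : (X t w - X s w =
  C *m (chi t w.1 - chi s w.1) + D *m (beta t w.2 - beta s w.2) + (t - s) *: g).
Proof.
rewrite /X !mulmxBr scalerBl; apply/matrixP => i j; rewrite !mxE; ring.
Qed.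

Lemma brownian_measurable d0 (T : measurableType d0) (P : probability T R) F0 r
    m0 S0 x0 (X0 : @process R T r) t i :
  is_filtration F0 -> is_brownian_motion P F0 m0 S0 x0 X0 -> (0 <= t) ->
  smeasurable (F0 t) (fun w => X0 t w i 0).
Proof.
move=> [sF0 _] X0B t0 A mA; exact: ((bm_adapted X0B).2 t t0 _ (borel_coord i mA)).
Qed.

Lemma smeasurable_affine (FL : set (set L)) (FL' : set (set L')) (f : L -> 'cV[R]_k)
    (f' : L' -> 'cV[R]_l) (c : 'cV[R]_n) i :
  sigma_algebra setT FL -> sigma_algebra setT FL' ->
  (forall j, smeasurable FL (fun w => f w j 0)) ->
  (forall j, smeasurable FL' (fun w => f' w j 0)) ->
  smeasurable (rect_sigma FL FL') (fun w => (C *m f w.1 + D *m f' w.2 + c) i 0).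
Proof.
move=> sL sL' mf mf'; have sR : sigma_algebra setT (rect_sigma FL FL').
  exact: smallest_sigma_algebra.
rewrite (_ : (fun w => _) = fun w =>
    \sum_j C i j * f w.1 j 0 + \sum_j D i j * f' w.2 j 0 + c i 0); last first.
  by apply/funext => w; rewrite !mxE.
apply: (smeasurableD sR); last exact: (smeasurable_cst sR).
apply: (smeasurableD sR); apply: (smeasurable_sum sR) => j _; apply: (smeasurableZ sR).
  exact: (@rect_sigma_fst _ _ _ _ _ FL FL' (fun w => f w j 0) sL' (mf j)).
exact: (@rect_sigma_snd _ _ _ _ _ FL FL' (fun w => f' w j 0) sL (mf' j)).
Qed.

Let sF t : (0 <= t) -> sigma_algebra setT (F t). Proof. by move=> t0; have [] := isF.1 t t0. Qed.
Let sF' t : (0 <= t) -> sigma_algebra setT (F' t). Proof. by move=> t0; have [] := isF'.1 t t0. Qed.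
Let mF t : (0 <= t) -> F t `<=` measurable. Proof. by move=> t0; have [] := isF.1 t t0. Qed.
Let mF' t : (0 <= t) -> F' t `<=` measurable. Proof. by move=> t0; have [] := isF'.1 t t0. Qed.

Lemma brownian_sum_adapted t : (0 <= t) ->
  forall B, borel B -> prod_filtration F F' t (X t @^-1` B).
Proof.
move=> t0; apply/(smeasurable_cV (@smallest_sigma_algebra _ _ _)) => i.
rewrite (_ : (fun w => _) = fun w =>
    (C *m chi t w.1 + D *m beta t w.2 + (y + t *: g)) i 0); last first.
  by apply/funext => w; rewrite addrA.
apply: smeasurable_affine; [exact: sF|exact: sF'| |] => j.
  exact: brownian_measurable chiB t0.
exact: brownian_measurable betaB t0.
Qed.

Lemma brownian_sum_continuous w :
  {within [set t : R | (0 <= t)], continuous (fun t => X t w)}.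
Proof.
apply/subspace_continuousP => t t0.
have /subspace_continuousP c1 : {within [set t : R | 0 <= t], continuous (fun t => chi t w.1)}.
  exact: (@bm_continuous _ _ _ _ _ _ _ _ _ _ chiB w.1).
have /subspace_continuousP c2 : {within [set t : R | 0 <= t], continuous (fun t => beta t w.2)}.
  exact: (@bm_continuous _ _ _ _ _ _ _ _ _ _ betaB w.2).
have c3 : (s *: g) @[s --> within [set t : R | (0 <= t)] (nbhs t)] --> (t *: g).
  by apply: cvg_within_filter; apply: cvgZr_tmp; exact: cvg_id.
apply: cvgD c3; apply: cvgD; last exact: cvg_cst.
by apply: cvgD; apply: cvg_mulmx; [exact: c1|exact: c2].
Qed.

Lemma dot_increment_gaussian d0 (T : measurableType d0) (P : probability T R) F0 r
    m0 S0 x0 (X0 : @process R T r) s t a :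
  is_filtration F0 -> is_brownian_motion P F0 m0 S0 x0 X0 -> (0 <= s) -> (s < t) ->
  gaussian P (fun w => dot a (X0 t w - X0 s w)) ((t - s) * dot a m0)
    ((t - s) * dot a (S0 *m a)).
Proof.
move=> isF0 X0B s0 st; have t0 : (0 <= t) by rewrite (le_trans s0)// ltW.
have m1 u i : (0 <= u) -> measurable_fun setT (fun w => X0 u w i 0).
  move=> u0 _ A mA; rewrite setTI; apply: (isF0.1 u u0).2.
  exact: (brownian_measurable i isF0 X0B u0).
split.
  rewrite (_ : (fun w => _) = fun w => (\sum_i a i 0 * (X0 t w i 0 - X0 s w i 0))); last first.
    by apply/funext => w; rewrite dotE; apply: eq_bigr => i _; rewrite !mxE.
  apply: measurable_sum => i; apply: measurable_funM; first exact: measurable_cst.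
  by apply: measurable_funB; exact: m1.
have [->|a0] := eqVneq a 0; [right|left].
  by rewrite !dot0v !mulr0; split => // w; rewrite dot0v.
split=> [|A mA].
  by rewrite mulr_gt0 ?subr_gt0//; exact: (bm_posdef X0B).2.
by have := bm_normal X0B s0 st a0 mA; rewrite dotZr -scalemxAl dotZr.
Qed.

(** The quadratic form of [V] at [a] is the sum of the forms of [Gam] at C' a and of [Xi] at D' a.
    One of these vectors may be 0, but not both, since [V] is positive definite. *)
Lemma brownian_sum_normal s t : (0 <= s) -> (s < t) ->
  normal_vector (Q \x Q')%E (fun w => X t w - X s w)
    ((t - s) *: (C *m mu + D *m nu + g)) ((t - s) *: V).
Proof.
move=> s0 st a A a0 mA; have ts : (0 < t - s) by rewrite subr_gt0.
have VE : dot a (V *m a) =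
    (dot (C^T *m a) (Gam *m (C^T *m a)) + dot (D^T *m a) (Xi *m (D^T *m a))).
  by rewrite mulmxDl dotDr !dot_quadr.
have Va : (0 < (t - s) * dot a (V *m a)) by apply: mulr_gt0 => //; exact: Vpos.2.
have g1 := dot_increment_gaussian (C^T *m a) isF chiB s0 st.
have g2 := dot_increment_gaussian (D^T *m a) isF' betaB s0 st.
rewrite VE mulrDr in Va.
have := gaussian_sum ((t - s) * dot a g) g1 g2 Va mA.
rewrite -!mulrDr -VE -!dot_mulmxr -!dotDr => E.
rewrite dotZr -scalemxAl dotZr -E; congr (_ _).
by apply/seteqP; split => w /=;
  rewrite brownian_sum_increment (dotDr a) (dotDr a) dotZr (dot_mulmxr a) (dot_mulmxr a).
Qed.

Lemma increments_after_measurable d0 (T : measurableType d0) r (X0 : @process R T r) t :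
  is_process X0 -> (0 <= t) -> increments_after X0 t `<=` measurable.
Proof.
move=> [mX _] t0; apply: g_sigma_sub_measurable => _ [u [v [B [tu uv bB ->]]]].
have m1 s i : (0 <= s) -> measurable_fun setT (fun w => X0 s w i 0).
  by move=> s0' _ A mA; rewrite setTI; exact: (mX s s0' _ (borel_coord i mA)).
have u0 : (0 <= u) by exact: le_trans tu.
have v0 : (0 <= v) by exact: le_trans uv.
move: B bB; apply/(smeasurable_cV (@sigma_algebra_measurable _ T)) => i A mA.
rewrite -[X in measurable X]setTI.
have mf : measurable_fun setT (fun w => (X0 v w i 0 - X0 u w i 0)).
  by apply: measurable_funB; exact: m1.
rewrite (_ : (fun w => _) = fun w => (X0 v w i 0 - X0 u w i 0)); first exact: mf.
by apply/funext => w; rewrite !mxE.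
Qed.

(** An increment of the sum is affine in the increments of both motions over the same interval.
    Independence from the past thus reduces to that of the two motions. *)
Lemma increments_sub t : (0 <= t) -> increments_after X t `<=`
  rect_sigma (increments_after chi t) (increments_after beta t).
Proof.
move=> t0; apply: smallest_sub; first exact: smallest_sigma_algebra.
move=> _ [u [v [B [tu uv bB ->]]]].
move: B bB; apply/(smeasurable_cV (@smallest_sigma_algebra _ _ _)) => i.
rewrite (_ : (fun w => _) = fun w => (C *m (chi v w.1 - chi u w.1) +
    D *m (beta v w.2 - beta u w.2) + (v - u) *: g) i 0); last first.
  by apply/funext => w; rewrite brownian_sum_increment.
apply: (@smeasurable_affine _ _ (fun w => chi v w - chi u w)
  (fun w => beta v w - beta u w)); try exact: smallest_sigma_algebra.
  move=> j A mA; apply: sub_sigma_algebra.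
  by exists u, v, [set z | A (z j 0)]; split => //; exact: borel_coord.
move=> j A mA; apply: sub_sigma_algebra.
by exists u, v, [set z | A (z j 0)]; split => //; exact: borel_coord.
Qed.

Lemma is_brownian_motion_sum :
  is_brownian_motion (Q \x Q')%E (prod_filtration F F')
    (C *m mu + D *m nu + g) V (C *m x + D *m x' + y) X.
Proof.
split.
- exact: Vpos.
- split; last exact: brownian_sum_adapted.
  split=> [t t0 B bB|w]; last by apply: within_continuous_cadlag; exact: brownian_sum_continuous.
  by apply: ((is_filtration_prod isF isF').1 t t0).2; exact: brownian_sum_adapted.
- exact: brownian_sum_continuous.
- apply: filterS2 (ae_fst Q' (bm_start chiB)) (ae_snd Q (bm_start betaB)) => w /= e1 e2.
  by rewrite /X e1 e2 scale0r addr0.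
- exact: brownian_sum_normal.
- move=> t t0 A B FA IB.
  have [p1 p2] := ((bm_adapted chiB).1, (bm_adapted betaB).1).
  apply: (@indep_rect_sigma _ _ _ Q _ _ Q' (F t) (increments_after chi t) (F' t)
    (increments_after beta t)) => //; last exact: increments_sub.
  + exact: sF.
  + exact: smallest_sigma_algebra.
  + exact: sF'.
  + exact: smallest_sigma_algebra.
  + exact: mF.
  + exact: increments_after_measurable.
  + exact: mF'.
  + exact: increments_after_measurable.
  + by move=> A0 B0 FA0 IB0; exact: (bm_indep chiB t0).
  + by move=> A0 B0 FA0 IB0; exact: (bm_indep betaB t0).
Qed.

End BrownianSum.

(** * Existence in every dimension *)

Section BrownianExistence.
Context {R : realType}.

Definition brownian_exists k (g : 'cV[R]_k) (Xi : 'M[R]_k) (x : 'cV[R]_k) : Prop :=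
  exists (d : measure_display) (T : measurableType d) (P : probability T R)
    (F : R -> set (set T)) (X : process T k),
    is_filtration F /\ is_brownian_motion P F g Xi x X.

(** The zero process needs some filtered space to live on; that of the scalar motion is borrowed. *)
Lemma brownian_exists0 (g : 'cV[R]_0) (Xi : 'M[R]_0) (x : 'cV[R]_0) :
  brownian_exists g Xi x.
Proof.
have [d [T [P [F [B [isF BB]]]]]] := @exists_brownian_motion1 R.
exists d, T, P, F, (fun _ _ => 0); split => //.
have trivial_event (S : set (set T)) (C : set 'cV[R]_0) :
    sigma_algebra setT S -> S ((fun _ : T => 0 : 'cV[R]_0) @^-1` C).
  move=> [S0 SC _]; have [C0|C0] := pselect (C 0).
    rewrite (_ : _ @^-1` _ = setT); first by rewrite -(setD0 setT); exact: SC.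
    by apply/seteqP; split.
  by rewrite (_ : _ @^-1` _ = set0)//; apply/seteqP; split.
have cX : {within [set t : R | 0 <= t], continuous (fun _ : R => 0 : 'cV[R]_0)}.
  by apply: continuous_subspaceT => t; exact: cvg_cst.
have sub t : 0 <= t -> forall C, borel C -> F t ((fun _ : T => 0 : 'cV[R]_0) @^-1` C).
  by move=> t0 C _; apply: trivial_event; exact: (isF.1 t t0).1.
split.
- split; first by apply/matrixP => -[].
  by move=> y; rewrite (_ : y = 0) ?eqxx//; apply/matrixP => -[].
- split; last exact: sub.
  split; first by move=> t t0 C bC; apply: (isF.1 t t0).2; exact: sub.
  by move=> w; exact: within_continuous_cadlag cX.
- by move=> w; exact: cX.
- by apply: aeW => w; apply/matrixP => -[].
- by move=> s t s0 st a A a0 _; move: a0; rewrite (_ : a = 0) ?eqxx//; apply/matrixP => -[].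
(* The increments of the zero process generate only the trivial events, which belong to the
   increment sigma-algebra of the scalar motion. *)
- move=> t t0 A C FA IC; apply: (bm_indep BB t0 FA).
  move: C IC; apply: smallest_sub; first exact: smallest_sigma_algebra.
  move=> _ [u [v [C [tu uv bC ->]]]].
  rewrite (_ : (fun w => _) = fun _ : T => 0); first by apply: trivial_event;
    exact: smallest_sigma_algebra.
  by apply/funext => w; rewrite subr0.
Qed.

Lemma sym_posdef_schur k (a : R) (b : 'cV[R]_k) (E : 'M[R]_k) :
  sym_posdef (block_mx a%:M b^T b E : 'M[R]_(1 + k)) ->
  0 < a /\ sym_posdef (E - a^-1 *: (b *m b^T)).
Proof.
move=> [sym pos].
have sE : E^T = E.
  by move: sym; rewrite tr_block_mx => /eq_block_mx[].
have form (s : R) (y : 'cV[R]_k) :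
  dot (col_mx s%:M y) (block_mx a%:M b^T b E *m col_mx s%:M y) =
  s ^+ 2 * a + s * dot b y *+ 2 + dot y (E *m y).
  have yb : (y^T *m b) 0 0 = dot b y.
    by rewrite -[y^T *m b]trmxK trmx_mul trmxK mxE.
  rewrite /dot tr_col_mx tr_scalar_mx mul_block_col mul_row_col.
  rewrite !mul_scalar_mx mul_mx_scalar mulmxDr -scalemxAr scalerDr.
  have DE (u v : 'M[R]_1) : (u + v) 0 0 = u 0 0 + v 0 0 by rewrite mxE.
  have ZE c (u : 'M[R]_1) : (c *: u) 0 0 = c * u 0 0 by rewrite mxE.
  rewrite !DE !ZE yb -/(dot b y) mxE eqxx mulr1n.
  by ring.
have a0 : 0 < a.
  have := pos (col_mx 1%:M 0); rewrite form expr1n mul1r dotv0 mulr0 mul0rn mulmx0 dotv0 !addr0.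
  apply; apply/eqP => /(congr1 usubmx); rewrite col_mxKu => /matrixP/(_ 0 0).
  by rewrite !mxE => /eqP; rewrite oner_eq0.
split => //; split.
  by rewrite raddfB /= sE linearZ /= trmx_mul trmxK.
(* This first coordinate minimizes the quadratic form for given [y]; the minimum is the form of the
   Schur complement. *)
move=> y y0; have := pos (col_mx (- a^-1 * dot b y)%:M y).
have -> : dot y ((E - a^-1 *: (b *m b^T)) *m y) =
    dot (col_mx (- a^-1 * dot b y)%:M y) (block_mx a%:M b^T b E *m col_mx (- a^-1 * dot b y)%:M y).
  rewrite form mulmxBl -scalemxAl -scaleN1r scalerA dotDr dotZr.
  rewrite -mulmxA [b *m (b^T *m y)](_ : _ = dot b y *: b); last first.
    by rewrite [b^T *m y]mx11_scalar mul_mx_scalar.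
  rewrite dotZr (_ : dot y b = dot b y); last by rewrite !dotE; apply: eq_bigr => i _;
    rewrite mulrC.
  by field; rewrite gt_eqF.
apply; apply/eqP => /(congr1 dsubmx); rewrite col_mxKd => h.
by move: y0; rewrite h linear0 eqxx.
Qed.

(** One step of a Cholesky factorization: sqrt(a) (1, b / a) times a scalar motion has covariance
    with blocks a, b', b, b b' / a, and an independent motion with the Schur complement as
    covariance, placed in the last k coordinates, supplies the rest. *)
Lemma exists_brownian_motion k (g : 'cV[R]_k) (Xi : 'M[R]_k) (x : 'cV[R]_k) :
  sym_posdef Xi -> brownian_exists g Xi x.
Proof.
elim: k g Xi x => [|k IH] g Xi x; first by move=> _; exact: brownian_exists0.
rewrite -[Xi](@submxK R 1 k 1 k); move: (ulsubmx _) (ursubmx _) (dlsubmx _) (drsubmx _) => A B b E.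
move=> Xpos; have Bb : B = b^T.
  have : (block_mx A B b E)^T = block_mx A B b E := Xpos.1.
  by rewrite tr_block_mx => /eq_block_mx[_ _ <-]; rewrite trmxK.
have Aa : A = (A 0 0)%:M by rewrite -mx11_scalar.
move: Xpos; rewrite Aa Bb; move: (A 0 0) => a Xpos.
have [a0 Spos] := sym_posdef_schur Xpos.
have [d' [T' [P' [F' [X' [isF' X'B]]]]]] := IH 0 _ 0 Spos.
have [d [T [P [F [X1 [isF X1B]]]]]] := @exists_brownian_motion1 R.
pose C : 'M[R]_(1 + k, 1) := Num.sqrt a *: col_mx 1%:M (a^-1 *: b).
pose D : 'M[R]_(1 + k, k) := col_mx 0 1%:M.
have cov : C *m 1%:M *m C^T + D *m (E - a^-1 *: (b *m b^T)) *m D^T = block_mx a%:M b^T b E.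
  rewrite mulmx1 /C linearZ/= -scalemxAl -scalemxAr scalerA -expr2 sqr_sqrtr ?ltW//.
  rewrite /D tr_col_mx tr_col_mx !linearZ /= trmx0 !trmx1 mul_col_row.
  rewrite mul_col_mx mul0mx mul1mx mul_col_row.
  rewrite !mulmx0 mulmx1 !mul1mx mulmx1 scale_block_mx add_block_mx !addr0.
  have a1 : a * a^-1 = 1 by rewrite divff ?gt_eqF.
  congr block_mx.
  - by rewrite scalemx1.
  - by rewrite scalerA a1 scale1r.
  - by rewrite mulmx1 scalerA a1 scale1r.
  - by rewrite -scalemxAl -scalemxAr !scalerA ?mulrA a1 mul1r scalerN addrC subrK.
have covpos : sym_posdef (C *m 1%:M *m C^T + D *m (E - a^-1 *: (b *m b^T)) *m D^T).
  by rewrite cov.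
have := is_brownian_motion_sum isF isF' X1B X'B x g covpos.
rewrite cov !mulmx0 !add0r => XB.
exists _, _, (P \x P')%E, (prod_filtration F F'), (brownian_sum X1 X' C D x g).
by split; [exact: is_filtration_prod|exact: XB].
Qed.

End BrownianExistence.

(** * Controls *)

Section LinearAlgebra.
Context {R : realType}.

Lemma sym_posdef_unit k (G : 'M[R]_k) : sym_posdef G -> G \in unitmx.
Proof.
move=> [sym pos]; rewrite -row_free_unit; apply: inj_row_free => u uG0.
apply: contrapT => u0; have := pos u^T.
rewrite -[G *m _]trmxK trmx_mul trmxK sym uG0 trmx0 dotv0 ltxx.
move=> h; have /h // : u^T != 0.
by apply/eqP => /(congr1 trmx); rewrite trmxK trmx0.
Qed.

(** A dependent enlarged family has rank at most d, which is already the rank of [M]; so adding [z]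
    does not enlarge the row space. *)
Lemma submx_of_not_row_free d m (M : 'M[R]_(d, m)) (z : 'rV[R]_m) :
  row_free M -> ~~ row_free (col_mx M z) -> (z <= M)%MS.
Proof.
move=> /eqP rM rz; have /leqifP := mxrank_leqif_sup (addsmxSl M z).
case: ifPn => [h _|_]; first exact: submx_trans (addsmxSr M z) h.
rewrite addsmxE rM => lt; move: rz; rewrite /row_free => /negP[].
by rewrite eqn_leq rank_leq_row /= [X in (X <= _)%N]addn1.
Qed.

(** This is the double orthogonal complement of [calR]: [delta] annihilates the rows of [Mm], which
    by maximality span [calM], and the annihilator of [calM] is [calR]. *)
Lemma orth_workload m n p d (Rm : 'M[R]_(m, n)) (Km : 'M[R]_(p, n)) (Mm : 'M[R]_(d, m))
    (delta : 'cV[R]_m) :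
  is_workload_matrix Rm Km Mm -> Mm *m delta = 0 -> calR Rm Km delta.
Proof.
move=> [freeM _ maxM] Md.
(* The rows of [N] span the transposed kernel of [Km], hence those of [A] span the transposed
   [calR]. The columns of [cokermx A] are the equations of that row space, and each is shown to lie
   in [calM]. *)
pose N := kermx Km^T; pose A := N *m Rm^T.
have calRA (u : 'rV[R]_n) : calR Rm Km (u *m A)^T.
  exists (u *m N)^T; last by rewrite -[LHS]trmxK trmx_mul trmxK -mulmxA.
  by apply: trmx_inj; rewrite trmx_mul trmxK trmx0 -mulmxA mulmx_ker mulmx0.
suff /submxP[u uE] : (delta^T <= A)%MS by rewrite -[delta]trmxK uE.
rewrite submxE; apply/eqP/matrixP => i j; rewrite [RHS]mxE ord1.
pose z := col j (cokermx A).
have Az : A *m z = 0 by rewrite /z colE mulmxA mulmx_coker mul0mx.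
have Mz : calM Rm Km z.
  move=> _ [y Ky <-].
  have /submxP[u uE] : (y^T <= N)%MS.
    by apply/sub_kermxP; rewrite -trmx_mul Ky trmx0.
  have -> : dot z (Rm *m y) = (y^T *m Rm^T *m z)^T 0 0 by rewrite /dot !trmx_mul !trmxK.
  by rewrite uE -(mulmxA u) -mulmxA Az mulmx0 trmx0 mxE.
have /submxP[u uE] : (z^T <= Mm)%MS by exact: submx_of_not_row_free (maxM _ Mz).
have : (z^T *m delta) 0 0 = 0 by rewrite uE -mulmxA Md mulmx0 mxE.
rewrite -[z^T *m delta]trmxK trmx_mul trmxK mxE => h.
by rewrite -[RHS]h /z ![in LHS]mxE ![in RHS]mxE; apply: eq_bigr => a _; rewrite !mxE.
Qed.

End LinearAlgebra.

Section AdaptedProcesses.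
Context {R : realType} d (T : measurableType d) (F : R -> set (set T)).
Hypothesis isF : is_filtration F.

Lemma adapted_mulmx k l (A : 'M[R]_(l, k)) (X : process T k) :
  is_adapted_process F X -> is_adapted_process F (fun t w => A *m X t w).
Proof.
move=> [[mX cX] aX].
have aY t : 0 <= t -> forall B, borel B -> F t ((fun w => A *m X t w) @^-1` B).
  move=> t0; have sF := (isF.1 t t0).1.
  apply/(smeasurable_cV sF) => i.
  rewrite (_ : (fun w => _) = fun w => \sum_j A i j * X t w j 0); last first.
    by apply/funext => w; rewrite mxE.
  apply: (smeasurable_sum sF) => j _; apply: (smeasurableZ sF).
  by move: j; apply/(smeasurable_cV sF); exact: aX.
split => //; split; first by move=> t t0 B bB; apply: (isF.1 t t0).2; exact: aY.
by move=> w; exact: (@cadlag_mulmx _ _ _ A (fun t => X t w) (cX w)).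
Qed.

Lemma adaptedD k (X Y : process T k) : is_adapted_process F X -> is_adapted_process F Y ->
  is_adapted_process F (fun t w => X t w + Y t w).
Proof.
move=> [[mX cX] aX] [[mY cY] aY].
have aXY t : 0 <= t -> forall B, borel B -> F t ((fun w => X t w + Y t w) @^-1` B).
  move=> t0; have sF := (isF.1 t t0).1.
  apply/(smeasurable_cV sF) => i.
  rewrite (_ : (fun w => _) = fun w => X t w i 0 + Y t w i 0); last first.
    by apply/funext => w; rewrite mxE.
  by apply: (smeasurableD sF); move: i; apply/(smeasurable_cV sF); [exact: aX|exact: aY].
split => //; split; first by move=> t t0 B bB; apply: (isF.1 t t0).2; exact: aXY.
by move=> w; exact: (@cadlagD _ _ (fun t => X t w) (fun t => Y t w) (cX w) (cY w)).
Qed.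

End AdaptedProcesses.

Lemma adapted_lift (R : realType) d (L : measurableType d) d' (L' : measurableType d')
    (F : R -> set (set L)) (F' : R -> set (set L')) k (X : process L k) :
  is_filtration F -> is_filtration F' ->
  is_adapted_process F X -> is_adapted_process (prod_filtration F F') (lift_process X).
Proof.
move=> isF isF' [[mX cX] aX].
have aY t : 0 <= t -> forall B, borel B ->
    prod_filtration F F' t (@lift_process R L L' k X t @^-1` B).
  move=> t0; have sF := (isF.1 t t0).1; have sF' := (isF'.1 t t0).1.
  apply/(smeasurable_cV (@smallest_sigma_algebra _ _ _)) => i.
  apply: (@rect_sigma_fst _ _ _ _ _ (F t) (F' t) (fun w => X t w i 0) sF').
  by move: i; apply/(smeasurable_cV sF); exact: aX.
split => //; split; last by move=> w; exact: cX.
by move=> t t0 B bB; apply: ((is_filtration_prod isF isF').1 t t0).2; exact: aY.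
Qed.

Lemma exists_lifted_brownian (R : realType) (m d : nat) (zo theta : 'cV[R]_m)
    (Sigma : 'M[R]_m) (Mm : 'M[R]_(d, m))
    (dL : measure_display) (L : measurableType dL) (Q : probability L R)
    (F : R -> set (set L)) (chi : process L d) :
  sym_posdef Sigma -> is_filtration F ->
  is_brownian_motion Q F (Mm *m theta) (Mm *m Sigma *m Mm^T) (Mm *m zo) chi ->
  exists (dL' : measure_display) (L' : measurableType dL')
         (Q' : probability L' R) (F' : R -> set (set L')),
    is_filtration F' /\
    exists X : process (L * L')%type m,
      is_brownian_motion (Q \x Q')%E (prod_filtration F F') theta Sigma zo X /\
      forall t w, Mm *m X t w = lift_process chi t w.
Proof.
move=> Spos isF; have [G GE] : exists G, G = Mm *m Sigma *m Mm^T by exists (Mm *m Sigma *m Mm^T).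
rewrite -GE => chiB.
have Gpos : sym_posdef G := bm_posdef chiB.
have Gu := sym_posdef_unit Gpos.
have [C CE] : exists C, C = Sigma *m Mm^T *m invmx G by exists (Sigma *m Mm^T *m invmx G).
pose D := 1%:M - C *m Mm.
have MC : Mm *m C = 1%:M by rewrite CE !mulmxA -GE mulmxV.
have MD : Mm *m D = 0 by rewrite mulmxBr mulmx1 mulmxA MC mul1mx subrr.
have Ct : C^T = invmx G *m Mm *m Sigma.
  by rewrite CE !trmx_mul trmx_inv trmxK Spos.1 Gpos.1 mulmxA.
have CMS : C *m Mm *m Sigma = C *m G *m C^T.
  by rewrite Ct !mulmxA -(mulmxA C G) mulmxV// mulmx1.
have SMC : Sigma *m Mm^T *m C^T = C *m G *m C^T.
  congr (_ *m _); by rewrite CE -(mulmxA _ (invmx G) G) mulVmx// mulmx1.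
(* With [CMS] and [SMC], both cross terms of D Sigma D' equal C G C'; the quadratic term does too,
   since M C = 1. Hence D Sigma D' = Sigma - C G C'. *)
have cov : C *m G *m C^T + D *m Sigma *m D^T = Sigma.
  have -> : D *m Sigma = Sigma - C *m G *m C^T by rewrite mulmxBl mul1mx CMS.
  have -> : D^T = 1%:M - Mm^T *m C^T by rewrite linearB /= trmx1 trmx_mul.
  rewrite mulmxBr mulmx1 mulmxBl (mulmxA Sigma) SMC (mulmxA _ Mm^T).
  by rewrite -(mulmxA _ C^T) -trmx_mul MC trmx1 mulmx1 subrr subr0 addrC subrK.
have [d' [L' [Q' [F' [beta [isF' betaB]]]]]] := exists_brownian_motion theta zo Spos.
(* Since [beta] has drift theta and starts at zo, the parts C M theta and (1 - C M) theta add up to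
   theta, and likewise for zo; no affine correction remains. *)
exists d', L', Q', F'; split => //; exists (brownian_sum chi beta C D 0 0); split.
  have covpos : sym_posdef (C *m G *m C^T + D *m Sigma *m D^T) by rewrite cov.
  have := is_brownian_motion_sum isF isF' chiB betaB 0 0 covpos.
  by rewrite cov !addr0 !mulmxBl !mul1mx !mulmxA (addrC (_ *m theta)) (addrC (_ *m zo)) !subrK.
move=> t w; rewrite /brownian_sum scaler0 !addr0 mulmxDr !mulmxA MC MD.
by rewrite mul1mx mul0mx addr0.
Qed.

Section Controls.
Context {R : realType} (m n p d : nat).
Variables (Rm : 'M[R]_(m, n)) (Km : 'M[R]_(p, n)) (Mm : 'M[R]_(d, m)).
Variables (Kdag : 'M[R]_(n, p)) (Rdag : 'M[R]_(n, m)) (Gm : 'M[R]_(d, p)).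
Hypothesis Mm_workload : is_workload_matrix Rm Km Mm.
Hypothesis Kdag_inv : is_Kdagger Km Kdag.
Hypothesis Rdag_inv : is_Rdagger Rm Km Rdag.
Hypothesis Gm_eq : Mm *m Rm = Gm *m Km.

Lemma control_decomposition (u : 'cV[R]_p) (z x : 'cV[R]_m) :
  calK Km u -> Mm *m z = Mm *m x + Gm *m u ->
  let y := Kdag *m u + Rdag *m (z - x - Rm *m (Kdag *m u)) in
  Km *m y = u /\ z = x + Rm *m y.
Proof.
move=> Ku Mz; have [_ KKu _] := Kdag_inv; have [KR RR] := Rdag_inv.
split; first by rewrite mulmxDr KKu// KR addr0.
rewrite mulmxDr RR; first by rewrite [X in x + X]addrC subrK addrC subrK.
apply: (orth_workload Mm_workload); rewrite !mulmxBr Mz (mulmxA Mm Rm) Gm_eq.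
by rewrite -mulmxA KKu// (addrC (Mm *m x)) addrK subrr.
Qed.

Lemma control_unique v (y y' : 'cV[R]_n) : standing_assumptions Rm Km v ->
  Km *m y = Km *m y' -> Rm *m y = Rm *m y' -> y = y'.
Proof.
move=> [_ inj0] Ky Ry.
have zero (x : 'cV[R]_n) : Km *m x = 0 -> Rm *m x = 0 -> dot v x <= 0 -> x = 0.
  move=> Kx Rx vx; suff : [set 0] x by [].
  by rewrite -inj0; split => // i; rewrite Kx.
have Kd : Km *m (y - y') = 0 by rewrite mulmxBr Ky subrr.
have Rd : Rm *m (y - y') = 0 by rewrite mulmxBr Ry subrr.
suff : y - y' = 0 by move/eqP; rewrite subr_eq0 => /eqP.
have [vy|/ltW vy] := leP (dot v (y - y')) 0; first exact: zero.
have /oppr_inj // : - (y - y') = - 0.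
rewrite oppr0; apply: zero; [by rewrite mulmxN Kd oppr0|by rewrite mulmxN Rd oppr0|].
by rewrite -scaleN1r dotZr mulN1r oppr_le0.
Qed.

Variables (zo theta : 'cV[R]_m) (Sigma : 'M[R]_m) (Zset : set 'cV[R]_m) (v : 'cV[R]_n).
Hypothesis standing : standing_assumptions Rm Km v.
Variables (disp : measure_display) (T : measurableType disp) (P : probability T R).
Variables (F : R -> set (set T)).
Variables (Z X : @process R T m) (U : @process R T p) (chi : @process R T d).
Hypothesis isF : is_filtration F.
Hypothesis ZF : is_adapted_process F Z.
Hypothesis UF : is_adapted_process F U.
Hypothesis XB : is_brownian_motion P F theta Sigma zo X.
Hypothesis MX : indistinguishable P (proc_mul Mm X) chi.
Hypothesis state : {ae P, forall w, forall t, 0 <= t ->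
  [/\ Mm *m Z t w = chi t w + Gm *m U t w, calK Km (U t w) & Zset (Z t w)]}.
Hypothesis control : {ae P, forall w, cv_le 0 (U 0 w) /\
  forall s t, 0 <= s -> s <= t -> cv_le (U s w) (U t w)}.

Definition control_of_state : @process R T n :=
  fun t w => Yhat Kdag U t w + Ytilde Rm Kdag Rdag Z X U t w.

Local Notation Y := control_of_state.

Let control_of_stateE : {ae P, forall w, forall t, 0 <= t ->
  Km *m Y t w = U t w /\ Z t w = X t w + Rm *m Y t w}.
Proof.
apply: filterS2 state MX => w hZ hX t t0; have [MZ KU _] := hZ t t0.
apply: (control_decomposition KU).
by rewrite MZ -(hX t t0).
Qed.

Let control_of_state_adapted : is_adapted_process F Y.
Proof.
(* [Y] is a fixed linear combination of [U], [Z] and [X], from which it inherits adaptedness and the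
   regularity of its paths. *)
have -> : Y = fun t w => Kdag *m U t w +
    (Rdag *m Z t w + ((- Rdag) *m X t w + (- (Rdag *m Rm *m Kdag)) *m U t w)).
  apply/funext => t; apply/funext => w; rewrite /Y /Ytilde /Yhat.
  by rewrite !mulmxBr !mulNmx !mulmxA !addrA.
do 3 ?[apply: (adaptedD isF)]; apply: (adapted_mulmx isF) => //.
exact: bm_adapted XB.
Qed.

Lemma is_network_control_of_state :
  is_network_control_for zo theta Sigma Rm Km Zset P F Z U X Y.
Proof.
split; last by apply: filterS control_of_stateE => w h t t0; exact: (h t t0).1.
split=> //.
- apply: filterS2 control_of_stateE state => w h hZ t t0.
  by have [_ _ Zt] := hZ t t0; split => //; exact: (h t t0).2.
- apply: filterS2 control_of_stateE control => w h [h0 hm].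
  split; first by rewrite (h 0 (lexx 0)).1.
  move=> s t s0 st; rewrite (h s s0).1 (h t (le_trans s0 st)).1.
  exact: hm.
Qed.

Lemma network_control_unique Y' :
  is_network_control_for zo theta Sigma Rm Km Zset P F Z U X Y' ->
  indistinguishable P Y' Y.
Proof.
move=> [Y'C Y'U]; apply: filterS3 control_of_stateE Y'U (nc_state Y'C) => w h hU hZ t t0.
apply: (control_unique standing).
  by rewrite (h t t0).1; exact: (hU t t0).
by apply: (addrI (X t w)); rewrite -(h t t0).2 -(hZ t t0).1.
Qed.

End Controls.

Theorem theorem5p2 (R : realType) (m n p d : nat)
  (m_gt0 : (0 < m)%N) (n_gt0 : (0 < n)%N) (p_gt0 : (0 < p)%N)
  (zo theta : 'cV[R]_m) (Sigma : 'M[R]_m)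
  (Rm : 'M[R]_(m, n)) (Km : 'M[R]_(p, n))
  (Zset : set 'cV[R]_m) (v : 'cV[R]_n)
  (Mm : 'M[R]_(d, m)) (Kdag : 'M[R]_(n, p)) (Rdag : 'M[R]_(n, m))
  (Gm : 'M[R]_(d, p))
  (Sigma_posdef : sym_posdef Sigma)
  (Z_compact : compact Zset)
  (Z_convex : convex_set (Zset : set (convex_lmodType 'cV[R]_m)))
  (Z_interior : interior Zset !=set0)
  (standing : standing_assumptions Rm Km v)
  (Mm_workload : is_workload_matrix Rm Km Mm)
  (Kdag_inv : is_Kdagger Km Kdag)
  (Rdag_inv : is_Rdagger Rm Km Rdag)
  (Gm_eq : Mm *m Rm = Gm *m Km)
  (dL : measure_display) (L : measurableType dL) (Q : probability L R)
  (Gt : R -> set (set L))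
  (U : process L p) (W chi : process L d)
  (U_control : is_reduced_control zo theta Sigma Km Zset Mm Gm Q Gt U W chi)
  (Z : process L m)
  (Z_adapted : is_adapted_process Gt Z)
  (Z_state : {ae Q, forall w, forall t, 0 <= t ->
                Mm *m Z t w = W t w /\ Zset (Z t w)}) :
  (exists (dL' : measure_display) (L' : measurableType dL')
          (Q' : probability L' R) (Gt' : R -> set (set L')),
     is_filtration Gt' /\
     exists X : process (L * L')%type m,
       is_brownian_motion (Q \x Q')%E (prod_filtration Gt Gt') theta Sigma zo X /\
       indistinguishable (Q \x Q')%E (proc_mul Mm X) (lift_process chi)) /\
  (forall (dL' : measure_display) (L' : measurableType dL')
          (Q' : probability L' R) (Gt' : R -> set (set L')),
     is_filtration Gt' ->
     forall X : process (L * L')%type m,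
       is_brownian_motion (Q \x Q')%E (prod_filtration Gt Gt') theta Sigma zo X ->
       indistinguishable (Q \x Q')%E (proc_mul Mm X) (lift_process chi) ->
       (exists Y : process (L * L')%type n,
          is_network_control_for zo theta Sigma Rm Km Zset (Q \x Q')%E
            (prod_filtration Gt Gt') (lift_process Z) (lift_process U) X Y) /\
       (forall Y : process (L * L')%type n,
          is_network_control_for zo theta Sigma Rm Km Zset (Q \x Q')%E
            (prod_filtration Gt Gt') (lift_process Z) (lift_process U) X Y ->
          indistinguishable (Q \x Q')%E Y
            (fun t w => Yhat Kdag (lift_process U) t w +
              Ytilde Rm Kdag Rdag (lift_process Z) X (lift_process U) t w))).
Proof.
have isF := rc_filtration U_control.
split.
  have [d' [L' [Q' [F' [isF' [X [XB MX]]]]]]] :=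
    exists_lifted_brownian Sigma_posdef isF (rc_chi U_control).
  exists d', L', Q', F'; split => //; exists X; split => //.
  by apply: aeW => w t _; exact: MX.
move=> dL' L' Q' F' isF' X XB MX.
have isFF := is_filtration_prod isF isF'.
have ZF := adapted_lift isF isF' Z_adapted.
have UF := adapted_lift isF isF' (rc_U U_control).
(* The almost sure properties are collected on the original space; [ae_fst] carries them to any
   product extension. *)
have state : {ae Q, forall w, forall t, 0 <= t ->
    [/\ Mm *m Z t w = chi t w + Gm *m U t w, calK Km (U t w) & Zset (Z t w)]}.
  apply: filterS3 (rc_state U_control) (rc_control U_control) Z_state.
  move=> w hW [_ [_ hK]] hZ t t0; split; [|exact: hK|exact: (hZ t t0).2].
  by rewrite (hZ t t0).1 (hW t t0).1.
have control : {ae Q, forall w, cv_le 0 (U 0 w) /\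
    forall s t, 0 <= s -> s <= t -> cv_le (U s w) (U t w)}.
  by apply: filterS (rc_control U_control) => w [h0 [hm _]].
split=> [|Y].
  exists (control_of_state Rm Kdag Rdag (lift_process Z) X (lift_process U)).
  exact: (is_network_control_of_state Mm_workload Kdag_inv Rdag_inv Gm_eq isFF ZF UF XB MX
    (ae_fst Q' state) (ae_fst Q' control)).
exact: (network_control_unique Mm_workload Kdag_inv Rdag_inv Gm_eq standing MX
  (ae_fst Q' state)).
Qed.
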